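(* Let $k>0$ and $\alpha,\mu,\omega,\gamma\in\mathbb{C}$ with $\operatorname{Re}(\alpha)>0$, $\operatorname{Re}(\mu)>0$. Let $f$ be a function on $[0,\infty)$ such that the Sumudu transforms of $f$ and of ${}_{k}P_{\alpha,\mu,\omega}^{\gamma}f$ exist, and let $F(u)=\mathcal{S}[f](u)$. Then, for $u>0$ with $\left|\omega k\left(\frac{u}{k}\right)^{\alpha/k}\right|<1$, $$\mathcal{S}\big({}_{k}P_{\alpha,\mu,\omega}^{\gamma}f(x)\big)(u)=\Big(\frac{u}{k}\Big)^{\frac{\mu}{k}}\Big(1-\omega k\Big(\frac{u}{k}\Big)^{\frac{\alpha}{k}}\Big)^{-\frac{\gamma}{k}}F(u).$$
   Context: The Sumudu transform is $\mathcal{S}[f](u)=\int_0^\infty\frac1u e^{-t/u}f(t)\,dt$, considered for functions $f$ in the set $A$ of functions for which there are $M,\tau_1,\tau_2>0$ with $|f(t)|\le Me^{|t|/\tau_j}$ for $t\in(-1)^j\times[0,\infty)$, and $u\in(-\tau_1,\tau_2)$; here $u>0$. Complex powers are principal branches. The $k$-gamma function is $\Gamma_k(z)=\int_0^\infty e^{-t^k/k}t^{z-1}\,dt$ for $\operatorname{Re}z>0$, and the $k$-Pochhammer symbol is $(\gamma)_{n,k}=\gamma(\gamma+k)\cdots(\gamma+(n-1)k)$, $(\gamma)_{0,k}=1$. The $k$-Mittag-Leffler function is $E_{k,\alpha,\mu}^{\gamma}(z)=\sum_{n=0}^\infty \frac{(\gamma)_{n,k}}{\Gamma_k(\alpha n+\mu)}\frac{z^n}{n!}$.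 The $k$-Prabhakar integral is $$\big({}_{k}P_{\alpha,\mu,\omega}^{\gamma}f\big)(x)=\int_0^x\frac{(x-t)^{\frac{\mu}{k}-1}}{k}E_{k,\alpha,\mu}^{\gamma}\big[\omega(x-t)^{\frac{\alpha}{k}}\big]f(t)\,dt .$$ *)

(* Defs.v *)
From mathcomp Require Import all_boot all_order all_algebra.
From mathcomp Require Import all_classical all_reals all_analysis.
From mathcomp Require Export complex.

Set Implicit Arguments.
Unset Strict Implicit.
Unset Printing Implicit Defensive.

Import Order.TTheory GRing.Theory Num.Theory.
Import numFieldNormedType.Exports.

Local Open Scope classical_set_scope.
Local Open Scope ring_scope.
Local Open Scope complex_scope.

Section ComplexAnalysis.
Context {R : realType}.
Implicit Types (z w : R[i]) (D : set R) (f : R -> R[i]).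

Definition cexp z : R[i] :=
  (expR (complex.Re z))%:C * (cos (complex.Im z) +i* sin (complex.Im z)).

(* The norm `|z| lives in R[i]; its real part is the modulus as an element
   of R. *)
Definition cmod z : R := complex.Re `|z|.

(* Principal argument, in ]-pi, pi]; its value at 0 is irrelevant. *)
Definition carg z : R :=
  let t := acos (complex.Re z / cmod z) in
  if 0 <= complex.Im z then t else - t.

Definition cln z : R[i] := ln (cmod z) +i* carg z.

(* Principal branch z ^ w = exp (w Log z); at z = 0 we follow the convention
   of powR: 0 ^ 0 = 1 and 0 ^ w = 0 otherwise. *)
Definition cpow z w : R[i] :=
  if z == 0 then (w == 0)%:R else cexp (w * cln z).

(* Lebesgue integral of complex-valued functions on the line, componentwise. *)
Definition cintegrable D f : Prop :=
  (@lebesgue_measure R).-integrable D (fun x => (complex.Re (f x))%:E) /\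
  (@lebesgue_measure R).-integrable D (fun x => (complex.Im (f x))%:E).

Definition cintegral D f : R[i] :=
  (\int[@lebesgue_measure R]_(x in D) complex.Re (f x)) +i*
  (\int[@lebesgue_measure R]_(x in D) complex.Im (f x)).

End ComplexAnalysis.

Section Sumudu.
Context {R : realType}.
Implicit Types (f : R -> R[i]) (u : R).

Definition sumudu_integrand f u (t : R) : R[i] :=
  (u^-1 * expR (- (t / u)))%:C * f t.

(* Existence at u is absolute convergence, which is what holds for measurable
   f with |f t| <= M exp (t / tau) on [0, +oo[ and 0 < u < tau. *)
Definition sumudu_exists f u : Prop :=
  cintegrable `[0, +oo[ (sumudu_integrand f u).

Definition sumudu f u : R[i] :=
  cintegral `[0, +oo[ (sumudu_integrand f u).

End Sumudu.

Section KPrabhakar.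
Context {R : realType}.
Implicit Types (k x : R) (alpha mu omega gamma z : R[i]) (f : R -> R[i]).

Definition kGamma k z : R[i] :=
  cintegral `]0, +oo[
    (fun t => (expR (- (t `^ k / k)))%:C * cpow t%:C (z - 1)).

Definition kpochhammer k gamma n : R[i] :=
  \prod_(i < n) (gamma + i%:R * k%:C).

(* The cast to numFieldType selects the topology of R[i] given by its norm. *)
Definition kMittagLeffler k alpha mu gamma z : R[i] :=
  limn (series (fun n : nat =>
    kpochhammer k gamma n / kGamma k (alpha * n%:R + mu)
      * (z ^+ n / n`!%:R)) : nat -> (R[i] : numFieldType)).

Definition kPrabhakar k alpha mu omega gamma f x : R[i] :=
  cintegral `[0, x] (fun t =>
    cpow (x - t)%:C (mu / k%:C - 1) / k%:C
      * kMittagLeffler k alpha mu gamma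
          (omega * cpow (x - t)%:C (alpha / k%:C))
      * f t).

End KPrabhakar.

(* Main.v *)
From HB Require Import structures.
Require Import Defs.
From mathcomp Require Import all_boot all_order all_algebra.
From mathcomp Require Import all_classical all_reals all_analysis.
From mathcomp Require Import measurable_realfun ring lra.

Set Implicit Arguments.
Unset Strict Implicit.
Unset Printing Implicit Defensive.

Import Order.TTheory GRing.Theory Num.Theory.
Import numFieldNormedType.Exports.

Local Open Scope classical_set_scope.
Local Open Scope ring_scope.
Local Open Scope complex_scope.

(** The Sumudu transform is a rescaled Laplace transform: S[g](u) is s L[g](s)
    at s = 1 / u. The k-Prabhakar integral of f is the convolution of f with a
    kernel, so that the theorem says L[Pf](s) = H(s) L[f](s), where H is the
    Laplace transform of the kernel. By definition the kernel is the series
    with terms kappa_n x ^ (z_n / k - 1) / k, z_n = alpha n + mu, and the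
    Laplace transform of each term is kappa_n Gamma_k(z_n) (s k) ^ (- z_n / k)
    (lap_power). The factors Gamma_k(z_n) cancel, and what remains is the
    binomial series of (1 - omega k (s k) ^ (- alpha / k)) ^ (- gamma / k)
    (binomial_series), multiplied by (s k) ^ (- mu / k).

    The interchange of sum and integral requires some care. For complex alpha
    the modulus of 1 / Gamma_k(z_n) exceeds 1 / Gamma_k(Re z_n), possibly by a
    factor that is geometric in n. Hence at s = 1 / u the double series need
    not converge absolutely, although the binomial series does. The proof
    bounds the ratio Gamma_k(Re z) / |Gamma_k(z)| geometrically in the sector
    |Im z| <= L Re z (rGamma_le_cmod); this gives the convergence of the
    Mittag-Leffler series, and absolute convergence of the double series for
    all large s (lap_prabhakar_ker).

    The identity for large s is then continued to s = 1 / u. The functions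
    L[f] and L[Pf] are real analytic on ]1 / u, +oo[ because both Sumudu
    transforms exist at u, and H is real analytic on [1 / u, +oo[ because
    |omega k (s k) ^ (- alpha / k)| is a nonincreasing function of s which is
    smaller than 1 at 1 / u (psexp_ker_transform). So the identity holds on
    ]1 / u, +oo[ by the identity theorem (psexp_continuation), and at 1 / u by
    dominated convergence (lap_factor_extend).

    Only functions of one real variable are continued: analyticity is the
    predicate psexp, an estimate of all Taylor remainders, which is stable
    under integration with respect to a parameter. Series are treated as
    integrals for the counting measure, to which the same results apply. *)

(** * Modulus, exponential and powers *)

Section ComplexBasics.
Context {R : realType}.
Implicit Types (z w : R[i]) (x : R).

Lemma cmodE z : cmod z = Num.sqrt (complex.Re z ^+ 2 + complex.Im z ^+ 2).
Proof. by case: z. Qed.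

Lemma cmod_ge0 z : 0 <= cmod z.
Proof. by rewrite cmodE sqrtr_ge0. Qed.

Lemma cmodM z w : cmod (z * w) = cmod z * cmod w.
Proof. by rewrite /cmod normrM /=; rewrite mulr0 subr0. Qed.

Lemma cmodD z w : cmod (z + w) <= cmod z + cmod w.
Proof.
have := ler_normD z w; rewrite lecE => /andP[_]; by [].
Qed.

Lemma cmodN z : cmod (- z) = cmod z.
Proof. by rewrite /cmod normrN. Qed.

Lemma cmodB z w : cmod (z - w) <= cmod z + cmod w.
Proof. by rewrite -(cmodN w) cmodD. Qed.

Lemma cmodr x : cmod x%:C = `|x|.
Proof. by rewrite cmodE/= expr0n/= addr0 sqrtr_sqr. Qed.

Lemma cmod0 : cmod (0 : R[i]) = 0.
Proof. by rewrite (_ : 0 = (0:R)%:C)// cmodr normr0. Qed.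

Lemma cmod1 : cmod (1 : R[i]) = 1.
Proof. by rewrite (_ : 1 = (1:R)%:C)// cmodr normr1. Qed.

Lemma normr_cmod z : `|z| = (cmod z)%:C.
Proof. by rewrite normc_def cmodE. Qed.

Lemma cmod_eq0 z : (cmod z == 0) = (z == 0).
Proof.
apply/idP/idP => [/eqP z0|/eqP->]; last by rewrite cmod0.
by rewrite -normr_eq0 normr_cmod z0.
Qed.

Lemma cmodV z : cmod z^-1 = (cmod z)^-1.
Proof.
have [->|z0] := eqVneq z 0; first by rewrite invr0 cmod0 invr0.
have c0 : cmod z != 0 by rewrite cmod_eq0.
by apply: (mulfI c0); rewrite -cmodM !mulfV// cmod1.
Qed.

Lemma cmodX z n : cmod (z ^+ n) = cmod z ^+ n.
Proof. by elim: n => [|n IH]; rewrite ?expr0 ?cmod1// !exprS cmodM IH. Qed.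

Lemma cmod_nat n : cmod (n%:R : R[i]) = n%:R.
Proof. by rewrite -(rmorph_nat (real_complex R)) cmodr normr_nat. Qed.

Lemma cmod_sum n (F : nat -> R[i]) :
  cmod (\sum_(i < n) F i) <= \sum_(i < n) cmod (F i).
Proof.
elim: n => [|n IH]; first by rewrite !big_ord0 cmod0.
by rewrite !big_ord_recr/= (le_trans (cmodD _ _))// lerD2r.
Qed.

Lemma Re_le_cmod z : `|complex.Re z| <= cmod z.
Proof. by rewrite cmodE -sqrtr_sqr ler_wsqrtr// lerDl sqr_ge0. Qed.

Lemma Im_le_cmod z : `|complex.Im z| <= cmod z.
Proof. by rewrite cmodE -sqrtr_sqr ler_wsqrtr// lerDr sqr_ge0. Qed.

Lemma cmod_le_ReIm z : cmod z <= `|complex.Re z| + `|complex.Im z|.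
Proof.
rewrite cmodE -[leRHS]ger0_norm ?addr_ge0// -sqrtr_sqr ler_wsqrtr//.
rewrite -[complex.Re z ^+ 2]real_normK ?num_real//.
rewrite -[complex.Im z ^+ 2]real_normK ?num_real//.
by rewrite sqrrD lerD2r lerDl mulrn_wge0// mulr_ge0.
Qed.

Lemma cReD z w : complex.Re (z + w) = complex.Re z + complex.Re w.
Proof. by case: z; case: w. Qed.
Lemma cImD z w : complex.Im (z + w) = complex.Im z + complex.Im w.
Proof. by case: z; case: w. Qed.
Lemma cReN z : complex.Re (- z) = - complex.Re z.
Proof. by case: z. Qed.
Lemma cImN z : complex.Im (- z) = - complex.Im z.
Proof. by case: z. Qed.
Lemma cReM z w : complex.Re (z * w) =
  complex.Re z * complex.Re w - complex.Im z * complex.Im w.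
Proof. by case: z; case: w. Qed.
Lemma cImM z w : complex.Im (z * w) =
  complex.Re z * complex.Im w + complex.Im z * complex.Re w.
Proof. by case: z; case: w. Qed.
Lemma cReMr z x : complex.Re (z * x%:C) = complex.Re z * x.
Proof. by rewrite cReM/= mulr0 subr0. Qed.
Lemma cImMr z x : complex.Im (z * x%:C) = complex.Im z * x.
Proof. by rewrite cImM/= mulr0 add0r. Qed.

Lemma complexP z w : complex.Re z = complex.Re w ->
  complex.Im z = complex.Im w -> z = w.
Proof. by case: z; case: w => /= a b c d -> ->. Qed.

Lemma cexpD z w : cexp (z + w) = cexp z * cexp w.
Proof.
rewrite /cexp cReD cImD expRD cosD sinD rmorphM /=.
rewrite mulrACA; congr (_ * _); apply: complexP => /=; ring.
Qed.

Lemma cexp0 : cexp (0 : R[i]) = 1.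
Proof. by rewrite /cexp /= expR0 cos0 sin0 mul1r. Qed.

Lemma cmod_cexp z : cmod (cexp z) = expR (complex.Re z).
Proof.
rewrite /cexp cmodM cmodr ger0_norm ?expR_ge0//.
by rewrite cmodE /= cos2Dsin2 sqrtr1 mulr1.
Qed.

Lemma cexp_neq0 z : cexp z != 0.
Proof. by rewrite -cmod_eq0 cmod_cexp gt_eqF// expR_gt0. Qed.

Lemma cexpN z : cexp (- z) = (cexp z)^-1.
Proof.
by apply: (mulfI (cexp_neq0 z)); rewrite -cexpD subrr cexp0 mulfV// cexp_neq0.
Qed.

Lemma cexpX z n : cexp z ^+ n = cexp (n%:R * z).
Proof.
elim: n => [|n IH]; first by rewrite expr0 mul0r cexp0.
by rewrite exprS IH -cexpD -{1}[z]mul1r -mulrDl nat1r.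
Qed.

Lemma cexpr x : cexp x%:C = (expR x)%:C.
Proof. by rewrite /cexp /= cos0 sin0 mulr1. Qed.

(** The power of a positive real number: on that half-line the principal
    logarithm is the real one, so that the laws of exponents hold for all
    complex exponents. *)
Definition rpow : R -> R[i] -> R[i] := locked (fun x z => cexp (z * (ln x)%:C)).

Lemma rpowE x z : rpow x z = cexp (z * (ln x)%:C).
Proof. by rewrite /rpow -lock. Qed.

Lemma rpowD x z w : rpow x (z + w) = rpow x z * rpow x w.
Proof. by rewrite !rpowE mulrDl cexpD. Qed.

Lemma rpowN x z : rpow x (- z) = (rpow x z)^-1.
Proof. by rewrite !rpowE mulNr cexpN. Qed.

Lemma rpowMl x (y : R) z : 0 < x -> 0 < y -> rpow (x * y) z = rpow x z * rpow y z.
Proof.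
by move=> x0 y0; rewrite !rpowE lnM ?posrE// rmorphD mulrDr cexpD.
Qed.

Lemma rpowVl x z : 0 < x -> rpow x^-1 z = (rpow x z)^-1.
Proof. by move=> x0; rewrite !rpowE lnV ?posrE// rmorphN mulrN cexpN. Qed.

Lemma rpowX x z n : rpow x z ^+ n = rpow x (z * n%:R).
Proof. by rewrite !rpowE cexpX mulrCA mulrA. Qed.

Lemma cmod_rpow x z : cmod (rpow x z) = expR (complex.Re z * ln x).
Proof. by rewrite !rpowE cmod_cexp cReMr. Qed.

Lemma rpowr x (y : R) : rpow x y%:C = (expR (y * ln x))%:C.
Proof. by rewrite !rpowE -rmorphM cexpr. Qed.

Lemma rpow1 x : 0 < x -> rpow x 1 = x%:C.
Proof. by move=> x0; rewrite -[1]/((1 : R)%:C) rpowr mul1r lnK. Qed.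

Lemma cpow_pos x z : 0 < x -> cpow x%:C z = rpow x z.
Proof.
move=> x0; rewrite /cpow ifF; last first.
  by rewrite eq_complex/= eqxx andbT gt_eqF.
rewrite !rpowE /cln cmodr gtr0_norm//; congr (cexp (_ * (_ +i* _))).
by rewrite /carg/= lexx cmodr gtr0_norm// divff ?gt_eqF// acos1.
Qed.

End ComplexBasics.

(** * Integrals of complex functions *)

Section ComplexIntegral.
Context d (T : measurableType d) (R : realType).
Variable mu : {measure set T -> \bar R}.
Implicit Types (D : set T) (f g : T -> R[i]) (h : T -> R).

(** Componentwise notions for an arbitrary measure: the Lebesgue measure gives
    the transforms, and the counting measure gives the series. *)
Definition cmeas D f := measurable_fun D (fun x => complex.Re (f x)) /\
  measurable_fun D (fun x => complex.Im (f x)).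

Definition cintble D f :=
  mu.-integrable D (fun x => (complex.Re (f x))%:E) /\
  mu.-integrable D (fun x => (complex.Im (f x))%:E).

Definition cint D f : R[i] :=
  (\int[mu]_(x in D) complex.Re (f x)) +i* (\int[mu]_(x in D) complex.Im (f x)).

Lemma cmeas_cst D (c : R[i]) : cmeas D (fun=> c).
Proof. by split; exact: measurable_cst. Qed.

Lemma cmeasM D f g : cmeas D f -> cmeas D g -> cmeas D (fun x => f x * g x).
Proof.
move=> [f1 f2] [g1 g2]; split.
- rewrite (_ : (fun x => _) = (fun x => complex.Re (f x) * complex.Re (g x) -
    complex.Im (f x) * complex.Im (g x))); last by apply/funext => x; rewrite cReM.
  by apply: measurable_funB; exact: measurable_funM.
- rewrite (_ : (fun x => _) = (fun x => complex.Re (f x) * complex.Im (g x) +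
    complex.Im (f x) * complex.Re (g x))); last by apply/funext => x; rewrite cImM.
  by apply: measurable_funD; exact: measurable_funM.
Qed.

Lemma cmeasZ D (c : R[i]) f : cmeas D f -> cmeas D (fun x => c * f x).
Proof. by apply: cmeasM; exact: cmeas_cst. Qed.

Lemma cmeas_real D h : measurable_fun D h -> cmeas D (fun x => (h x)%:C).
Proof. by move=> mh; split => //=; exact: measurable_cst. Qed.

Lemma measurable_cmod D f : cmeas D f -> measurable_fun D (fun x => cmod (f x)).
Proof.
move=> [f1 f2]; under eq_fun do rewrite cmodE.
apply: measurableT_comp => /=.
  by apply: continuous_measurable_fun; exact: sqrt_continuous.
by apply: measurable_funD; exact: measurable_funX.
Qed.

Lemma cmeas_cexp D f : cmeas D f -> cmeas D (fun x => cexp (f x)).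
Proof.
move=> [f1 f2]; apply: cmeasM.
  by apply: cmeas_real; exact: measurableT_comp.
split; apply: measurableT_comp => //; apply: continuous_measurable_fun.
  exact: continuous_cos.
exact: continuous_sin.
Qed.

Lemma cmeas_rpow D h (z : R[i]) : measurable_fun D h ->
  cmeas D (fun x => rpow (h x) z).
Proof.
move=> mh; under eq_fun do rewrite rpowE.
apply: cmeas_cexp; apply: cmeasZ; apply: cmeas_real.
exact: measurableT_comp.
Qed.

Lemma cmeasS (E D : set T) f : measurable E -> D `<=` E -> cmeas E f -> cmeas D f.
Proof. by move=> mE DE [f1 f2]; split; exact: measurable_funS DE _. Qed.

Lemma cmeas_if (b : T -> bool) f g : measurable_fun setT b ->
  cmeas setT f -> cmeas setT g -> cmeas setT (fun x => if b x then f x else g x).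
Proof.
move=> mb [f1 f2] [g1 g2]; split.
- rewrite (_ : (fun x => _) = (fun x => if b x then complex.Re (f x)
    else complex.Re (g x))); last by apply/funext => x; case: (b x).
  by apply: measurable_fun_ifT.
- rewrite (_ : (fun x => _) = (fun x => if b x then complex.Im (f x)
    else complex.Im (g x))); last by apply/funext => x; case: (b x).
  by apply: measurable_fun_ifT.
Qed.

Lemma cintble_meas D f : cintble D f -> cmeas D f.
Proof.
by move=> [/measurable_int/measurable_EFinP f1 /measurable_int/measurable_EFinP f2].
Qed.

Lemma cintble_le D f h : measurable D -> cmeas D f ->
  mu.-integrable D (EFin \o h) -> (forall x, D x -> cmod (f x) <= h x) ->
  cintble D f.
Proof.
move=> mD [f1 f2] ih fh; split.
- apply: le_integrable ih => //; first exact/measurable_EFinP.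
  move=> x Dx; rewrite /= lee_fin (le_trans (Re_le_cmod _))//.
  by rewrite (le_trans (fh _ Dx))// ler_norm.
- apply: le_integrable ih => //; first exact/measurable_EFinP.
  move=> x Dx; rewrite /= lee_fin (le_trans (Im_le_cmod _))//.
  by rewrite (le_trans (fh _ Dx))// ler_norm.
Qed.

Lemma integrable_cmod D f : measurable D -> cintble D f ->
  mu.-integrable D (fun x => (cmod (f x))%:E).
Proof.
move=> mD intf; have [f1 f2] := intf.
have := integrableD mD (integrable_abse f1) (integrable_abse f2).
apply: le_integrable => //.
  by apply/measurable_EFinP/measurable_cmod; exact: cintble_meas.
move=> x Dx /=; rewrite lee_fin ger0_norm ?cmod_ge0//.
by rewrite (le_trans (cmod_le_ReIm _))// ler_norm.
Qed.

Lemma cintbleP D f : measurable D -> cmeas D f ->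
  cintble D f <-> mu.-integrable D (fun x => (cmod (f x))%:E).
Proof.
move=> mD mf; split; first exact: integrable_cmod.
by move=> ?; exact: (cintble_le mD mf (h := cmod \o f)).
Qed.

Lemma eq_cintble D f g : measurable D -> {in D, f =1 g} -> cintble D f -> cintble D g.
Proof.
move=> mD fg [f1 f2].
by split; [move: f1|move: f2]; apply: eq_integrable => // x xD; rewrite fg.
Qed.

Lemma eq_cint D f g : {in D, f =1 g} -> cint D f = cint D g.
Proof.
move=> fg; rewrite /cint; congr (_ +i* _); apply: eq_Rintegral => x xD;
  by rewrite fg.
Qed.

Lemma cintbleD D f g : measurable D -> cintble D f -> cintble D g ->
  cintble D (fun x => f x + g x).
Proof.
move=> mD [f1 f2] [g1 g2]; split.
- by under eq_fun do rewrite cReD EFinD; exact: integrableD.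
- by under eq_fun do rewrite cImD EFinD; exact: integrableD.
Qed.

Lemma cintbleZ D (c : R[i]) f : measurable D -> cintble D f ->
  cintble D (fun x => c * f x).
Proof.
move=> mD [f1 f2]; split.
- under eq_fun do rewrite cReM EFinB !EFinM.
  by apply: integrableB => //; exact: integrableZl.
- under eq_fun do rewrite cImM EFinD !EFinM.
  by apply: integrableD => //; exact: integrableZl.
Qed.

Lemma cintbleB D f g : measurable D -> cintble D f -> cintble D g ->
  cintble D (fun x => f x - g x).
Proof.
move=> mD fi gi; apply: cintbleD => //.
by under eq_fun do rewrite -mulN1r; exact: cintbleZ.
Qed.

Lemma cintD D f g : measurable D -> cintble D f -> cintble D g ->
  cint D (fun x => f x + g x) = cint D f + cint D g.
Proof.
move=> mD [f1 f2] [g1 g2]; apply: complexP => /=.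
- by under eq_Rintegral do rewrite cReD; exact: RintegralD.
- by under eq_Rintegral do rewrite cImD; exact: RintegralD.
Qed.

Lemma cintZ D (c : R[i]) f : measurable D -> cintble D f ->
  cint D (fun x => c * f x) = c * cint D f.
Proof.
move=> mD [f1 f2]; have [cf1 cf2] : cintble D (fun x => c * f x).
  exact: cintbleZ.
apply: complexP; rewrite ?(cReM, cImM)/=.
- under eq_Rintegral do rewrite cReM.
  rewrite RintegralB//; try by (rewrite /comp; under eq_fun do rewrite EFinM;
    exact: integrableZl).
  by rewrite !RintegralZl.
- under eq_Rintegral do rewrite cImM.
  rewrite RintegralD//; try by (rewrite /comp; under eq_fun do rewrite EFinM;
    exact: integrableZl).
  by rewrite !RintegralZl.
Qed.

Lemma cintB D f g : measurable D -> cintble D f -> cintble D g ->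
  cint D (fun x => f x - g x) = cint D f - cint D g.
Proof.
move=> mD fi gi.
under eq_cint do rewrite -mulN1r.
by rewrite cintD// ?cintZ ?mulN1r//; exact: cintbleZ.
Qed.

Lemma cint0 D : cint D (fun=> 0) = 0.
Proof. by rewrite /cint/= /Rintegral !integral0. Qed.

Lemma cintble0 D : measurable D -> cintble D (fun=> 0).
Proof. by move=> mD; split; exact: integrable0. Qed.

Lemma cintble_sum D n (F : nat -> T -> R[i]) : measurable D ->
  (forall i, cintble D (F i)) -> cintble D (fun x => \sum_(i < n) F i x).
Proof.
move=> mD Fi; elim: n => [|n IH].
  by under eq_fun do rewrite big_ord0; exact: cintble0.
by under eq_fun do rewrite big_ord_recr/=; exact: cintbleD.
Qed.

Lemma cint_sum D n (F : nat -> T -> R[i]) : measurable D ->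
  (forall i, cintble D (F i)) ->
  cint D (fun x => \sum_(i < n) F i x) = \sum_(i < n) cint D (F i).
Proof.
move=> mD Fi; elim: n => [|n IH].
  by under eq_cint do rewrite big_ord0; rewrite big_ord0 cint0.
under eq_cint do rewrite big_ord_recr/=.
by rewrite cintD// ?big_ord_recr ?IH//; exact: cintble_sum.
Qed.

Lemma cint_real D h : cint D (fun x => (h x)%:C) = (\int[mu]_(x in D) h x)%:C.
Proof. by apply: complexP => //=; rewrite /Rintegral integral0. Qed.

(** The factor 2 comes from an estimate of each component on its own. *)
Lemma le_cmod_cint D f h : measurable D -> cintble D f ->
  mu.-integrable D (EFin \o h) -> (forall x, D x -> cmod (f x) <= h x) ->
  cmod (cint D f) <= 2 * \int[mu]_(x in D) h x.
Proof.
move=> mD [f1 f2] ih fh; rewrite (le_trans (cmod_le_ReIm _))//= mulr2n mulrDl mul1r.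
apply: lerD; rewrite (le_trans (le_normr_Rintegral _ _))//; apply: le_Rintegral => //.
- exact: (integrable_abse f1).
- by move=> x Dx; rewrite (le_trans (Re_le_cmod _))// fh.
- exact: (integrable_abse f2).
- by move=> x Dx; rewrite (le_trans (Im_le_cmod _))// fh.
Qed.

Lemma cint_mkcond D f :
  cint D f = cint setT (fun x => if x \in D then f x else 0).
Proof.
rewrite /cint; congr (_ +i* _); rewrite Rintegral_mkcond;
  by apply: eq_Rintegral => x _; rewrite patchE; case: ifP.
Qed.

Lemma cintble_mkcond D f : measurable D ->
  cintble D f <-> cintble setT (fun x => if x \in D then f x else 0).
Proof.
move=> mD; split => [[f1 f2]|[f1 f2]].
- split.
  + move: f1 => /(integrable_mkcond _ mD); apply: eq_integrable => // x _.
    by rewrite patchE; case: ifP.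
  + move: f2 => /(integrable_mkcond _ mD); apply: eq_integrable => // x _.
    by rewrite patchE; case: ifP.
- split; apply/(integrable_mkcond _ mD).
  + by move: f1; apply: eq_integrable => // x _; rewrite patchE; case: ifP.
  + by move: f2; apply: eq_integrable => // x _; rewrite patchE; case: ifP.
Qed.

End ComplexIntegral.

Section ComplexFubini.
Context d1 d2 (T1 : measurableType d1) (T2 : measurableType d2) (R : realType).
Variable m1 : {sigma_finite_measure set T1 -> \bar R}.
Variable m2 : {sigma_finite_measure set T2 -> \bar R}.

Let ae_eq_integrable d (T : measurableType d) (mu : {measure set T -> \bar R})
    (f g : T -> \bar R) : measurable_fun setT g -> ae_eq mu setT f g ->
  mu.-integrable setT f -> mu.-integrable setT g.
Proof.
move=> mg fg /integrableP[mf fi]; apply/integrableP; split => //.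
have <- : (\int[mu]_x `|f x| = \int[mu]_x `|g x|)%E; last by [].
apply: ae_eq_integral => //; [exact: measurableT_comp|exact: measurableT_comp|].
by apply: filterS fg => x /= H /H ->.
Qed.

Let RFubini (f : T1 * T2 -> R) : (m1 \x m2)%E.-integrable setT (EFin \o f) ->
  [/\ m1.-integrable setT (fun x => (\int[m2]_y f (x, y))%:E),
      m2.-integrable setT (fun y => (\int[m1]_x f (x, y))%:E) &
  \int[m1]_x \int[m2]_y f (x, y) = \int[m2]_y \int[m1]_x f (x, y)].
Proof.
move=> fi.
have iF := integrable_fubini_F fi.
have iG : m2.-integrable setT (fubini_G m1 (EFin \o f)).
  have mf : measurable_fun setT (EFin \o f) := measurable_int _ fi.
  have mfs : measurable_fun setT (EFin \o f \o (fun p : T2 * T1 => (p.2, p.1))).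
    by apply: measurableT_comp => //; exact: measurable_fun_pair.
  apply: (@integrable_fubini_F _ _ _ _ _ m2 m1 (EFin \o f \o (fun p : T2 * T1 => (p.2, p.1)))).
  by apply/integrable12ltyP => //=; have [+ _] := integrable21ltyP m1 m2 mf; exact.
have aF : ae_eq m1 setT (fubini_F m2 (EFin \o f))
    (fun x => (\int[m2]_y f (x, y))%:E).
  have := integrable_ae measurableT iF; apply: filterS => x /= H _.
  by rewrite /Rintegral fineK//; exact: H.
have aG : ae_eq m2 setT (fubini_G m1 (EFin \o f))
    (fun y => (\int[m1]_x f (x, y))%:E).
  have := integrable_ae measurableT iG; apply: filterS => x /= H _.
  by rewrite /Rintegral fineK//; exact: H.
have mF : measurable_fun setT (fun x => (\int[m2]_y f (x, y))%:E).
  apply/measurable_EFinP; apply: (measurableT_comp (fine_measurable _)) => //.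
  exact: measurable_int iF.
have mG : measurable_fun setT (fun y => (\int[m1]_x f (x, y))%:E).
  apply/measurable_EFinP; apply: (measurableT_comp (fine_measurable _)) => //.
  exact: measurable_int iG.
split.
- exact: (ae_eq_integrable mF aF iF).
- exact: (ae_eq_integrable mG aG iG).
- rewrite /Rintegral; congr fine.
  transitivity (\int[m1]_x fubini_F m2 (EFin \o f) x)%E.
    by apply/esym/ae_eq_integral => //; exact: measurable_int iF.
  transitivity (\int[m2]_y fubini_G m1 (EFin \o f) y)%E; first exact: Fubini.
  by apply/ae_eq_integral => //; exact: measurable_int iG.
Qed.

(** Absolute integrability is checked on the modulus, which dominates both
    components. *)
Lemma cFubini (f : T1 * T2 -> R[i]) : cmeas setT f ->
  (\int[m1]_x \int[m2]_y (cmod (f (x, y)))%:E < +oo)%E ->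
  [/\ cintble m1 setT (fun x => cint m2 setT (fun y => f (x, y))),
      cintble m2 setT (fun y => cint m1 setT (fun x => f (x, y))) &
      cint m1 setT (fun x => cint m2 setT (fun y => f (x, y))) =
      cint m2 setT (fun y => cint m1 setT (fun x => f (x, y)))].
Proof.
move=> mf foo.
have icf : (m1 \x m2)%E.-integrable setT (EFin \o (fun z => cmod (f z))).
  apply/integrable12ltyP; first by apply/measurable_EFinP; exact: measurable_cmod.
  rewrite (eq_integral (fun x => \int[m2]_y (cmod (f (x, y)))%:E)%E)//.
  by move=> x _; apply: eq_integral => y _ /=; rewrite ger0_norm ?cmod_ge0.
have [f1 f2] : cintble (m1 \x m2)%E setT f by exact: (cintble_le _ mf icf).
have [F1 G1 E1] := RFubini f1; have [F2 G2 E2] := RFubini f2.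
by split; [split|split|exact: complexP].
Qed.

End ComplexFubini.

(** * Limits and series *)

Section ComplexLimits.
Context {R : realType}.
Implicit Types (u v : nat -> R[i]) (l m : R[i]).

Definition ccvg u l :=
  ((fun n => complex.Re (u n)) @ \oo --> complex.Re l) /\
  ((fun n => complex.Im (u n)) @ \oo --> complex.Im l).

Lemma ccvg_unique u l m : ccvg u l -> ccvg u m -> l = m.
Proof.
by move=> [l1 l2] [m1 m2]; apply: complexP;
  [exact: (cvg_unique _ l1 m1)|exact: (cvg_unique _ l2 m2)].
Qed.

Lemma ccvg_cst l : ccvg (fun=> l) l.
Proof. by split; exact: cvg_cst. Qed.

Lemma ccvgD u v l m : ccvg u l -> ccvg v m -> ccvg (fun n => u n + v n) (l + m).
Proof.
move=> [l1 l2] [m1 m2]; split.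
- by under eq_fun do rewrite cReD; rewrite cReD; exact: cvgD.
- by under eq_fun do rewrite cImD; rewrite cImD; exact: cvgD.
Qed.

Lemma ccvgM u v l m : ccvg u l -> ccvg v m -> ccvg (fun n => u n * v n) (l * m).
Proof.
move=> [l1 l2] [m1 m2]; split.
- by under eq_fun do rewrite cReM; rewrite cReM; apply: cvgB; exact: cvgM.
- by under eq_fun do rewrite cImM; rewrite cImM; apply: cvgD; exact: cvgM.
Qed.

Lemma ccvg_cmod u l : (fun n => cmod (u n - l)) @ \oo --> (0:R) -> ccvg u l.
Proof.
move=> ul; split.
- apply/subr_cvg0; apply: norm_cvg0.
  apply: (squeeze_cvgr _ (cvg_cst 0) ul); near=> n.
  by rewrite normr_ge0 -cReN -cReD Re_le_cmod.
- apply/subr_cvg0; apply: norm_cvg0.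
  apply: (squeeze_cvgr _ (cvg_cst 0) ul); near=> n.
  by rewrite normr_ge0 -cImN -cImD Im_le_cmod.
Unshelve. all: end_near. Qed.

Lemma cvg_cmod u l : ccvg u l -> (fun n => cmod (u n - l)) @ \oo --> (0:R).
Proof.
move=> [/subr_cvg0/cvg_norm l1 /subr_cvg0/cvg_norm l2].
have l12 : (fun n => `|complex.Re (u n) - complex.Re l| +
    `|complex.Im (u n) - complex.Im l|) @ \oo --> (0 : R).
  by rewrite -[0]addr0 -(normr0 R); exact: cvgD.
apply: (squeeze_cvgr _ (cvg_cst 0) l12); near=> n.
by rewrite cmod_ge0/= (le_trans (cmod_le_ReIm _))// !(cReD, cImD, cReN, cImN).
Unshelve. all: end_near. Qed.

(** The topology of the complex numbers given by their norm is the one of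
    componentwise convergence. *)
Lemma ccvg_lim u l : ccvg u l -> limn (u : nat -> (R[i] : numFieldType)) = l.
Proof.
move=> /cvg_cmod ul; apply: cvg_lim => //.
apply/cvgrPdist_lt => e e0.
have e1 : 0 < complex.Re e by move: e0; rewrite ltcE => /andP[].
move/cvgrPdist_lt : ul => /(_ _ e1); apply: filterS => n.
rewrite sub0r normrN ger0_norm ?cmod_ge0// distrC normr_cmod => H.
move: e0; rewrite !ltcE /= => /andP[/eqP -> _]; rewrite eqxx /=.
exact: H.
Qed.

End ComplexLimits.

Section DominatedConvergence.
Context d (T : measurableType d) (R : realType).
Variable mu : {measure set T -> \bar R}.

Let Rdom D (f_ : nat -> T -> R) (f g : T -> R) : measurable D ->
  (forall n, measurable_fun D (f_ n)) -> measurable_fun D f ->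
  (forall x, D x -> f_ ^~ x @ \oo --> f x) ->
  mu.-integrable D (EFin \o g) ->
  (forall n x, D x -> `|f_ n x| <= g x) ->
  \int[mu]_(x in D) f_ n x @[n --> \oo] --> \int[mu]_(x in D) f x.
Proof.
move=> mD mf_ mf cf ig fg.
have [||||| if1 _ c] := @dominated_convergence _ _ _ mu D mD
  (fun n => EFin \o f_ n) (EFin \o f) (EFin \o g).
- by move=> n; exact/measurable_EFinP.
- exact/measurable_EFinP.
- by apply: aeW => x Dx; apply: cvg_EFin; [exact: nearW|exact: cf].
- exact: ig.
- by apply: aeW => x n Dx; rewrite lee_fin fg.
rewrite /Rintegral; apply: fine_cvg.
by rewrite fineK; [exact: c|exact: integrable_fin_num].
Qed.

Lemma cint_dominated D (f_ : nat -> T -> R[i]) f g : measurable D ->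
  (forall n, cmeas D (f_ n)) -> cmeas D f ->
  (forall x, D x -> ccvg (f_ ^~ x) (f x)) ->
  mu.-integrable D (EFin \o g) ->
  (forall n x, D x -> cmod (f_ n x) <= g x) ->
  ccvg (fun n => cint mu D (f_ n)) (cint mu D f).
Proof.
move=> mD mf_ [f1 f2] cf ig fg; split => /=.
- apply: (Rdom mD _ f1 _ ig) => [n|x Dx|n x Dx].
  + by have [] := mf_ n.
  + by have [] := cf _ Dx.
  + by rewrite (le_trans (Re_le_cmod _))// fg.
- apply: (Rdom mD _ f2 _ ig) => [n|x Dx|n x Dx].
  + by have [] := mf_ n.
  + by have [] := cf _ Dx.
  + by rewrite (le_trans (Im_le_cmod _))// fg.
Qed.

End DominatedConvergence.

Section Series.
Context {R : realType}.
Implicit Types (g : nat -> R) (a b : nat -> R[i]).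

Local Notation cnt := (@counting nat R).

(** Series are integrals for the counting measure: the theorems on integrals
    that depend on a parameter then serve for both. *)
Definition csum a : R[i] := cint cnt setT a.

Lemma measurable_nat d (T : measurableType d) (h : nat -> T) :
  measurable_fun setT h.
Proof. by []. Qed.

Lemma cmeas_nat a : cmeas setT a.
Proof. by split; exact: measurable_nat. Qed.

Lemma integrable_count_ge0 g M : (forall n, 0 <= g n) ->
  (forall n, \sum_(i < n) g i <= M) -> cnt.-integrable setT (EFin \o g).
Proof.
move=> g0 gM; apply/integrableP; split; first exact: measurable_nat.
under eq_integral do rewrite /= ger0_norm//.
rewrite ge0_integral_count//.
apply: (@le_lt_trans _ _ M%:E); last by rewrite ltry.
apply: lime_le.
  by apply: is_cvg_nneseries => n _ _; rewrite lee_fin.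
by apply: nearW => n; rewrite sumEFin lee_fin big_mkord.
Qed.

Lemma le_sum_count g n : (forall n, 0 <= g n) ->
  cnt.-integrable setT (EFin \o g) -> \sum_(i < n) g i <= \int[cnt]_i g i.
Proof.
move=> g0 gi; rewrite -lee_fin /Rintegral fineK; last exact: integrable_fin_num.
rewrite ge0_integral_count//.
apply: le_trans (nneseries_lim_ge n _); last by move=> k _; rewrite lee_fin.
by rewrite sumEFin big_mkord.
Qed.

Lemma cvg_count g : cnt.-integrable setT (EFin \o g) ->
  (fun n => \sum_(i < n) g i) @ \oo --> \int[cnt]_i g i.
Proof.
move=> gi.
have gi' : cnt.-integrable setT (EFin \o (fun n => `|g n|)) by exact: integrable_abse gi.
have cg : cvgn (series g).
  apply: normed_cvg; apply: nondecreasing_is_cvgn.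
    by apply: nondecreasing_series => n _ _; rewrite normr_ge0.
  exists (\int[cnt]_i `|g i|) => _ [n _ <-].
    apply: le_trans (le_sum_count n _ gi'); last by move=> k; rewrite normr_ge0.
  by rewrite -(big_mkord xpredT (fun i => `|g i|)).
suff -> : \int[cnt]_i g i = limn (series g).
  by move/cvg_ex : cg => [l cl]; rewrite (cvg_lim _ cl)//;
    under eq_fun do rewrite -(big_mkord xpredT).
rewrite /Rintegral integral_count; last first.
  rewrite /summable -nneseries_esumT; last first.
    by move=> *; rewrite abse_ge0.
  rewrite -ge0_integral_count; last by move=> *; rewrite abse_ge0.
  by case/integrableP : gi.
rewrite (_ : \sum_(k <oo) (g k)%:E = (limn (series g))%:E)%E//.
rewrite -EFin_lim//; congr (limn _); apply/funext => n /=.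
by rewrite sumEFin.
Qed.

Lemma ccvg_csum a : cintble cnt setT a ->
  ccvg (fun n => \sum_(i < n) a i) (csum a).
Proof.
move=> [a1 a2]; split => /=.
- under eq_fun => n.
    rewrite (big_morph _ (@cReD R) (erefl (complex.Re 0))).
    over.
  exact: cvg_count.
- under eq_fun => n.
    rewrite (big_morph _ (@cImD R) (erefl (complex.Im 0))).
    over.
  exact: cvg_count.
Qed.

Lemma cintble_count a g : (forall n, cmod (a n) <= g n) ->
  cnt.-integrable setT (EFin \o g) -> cintble cnt setT a.
Proof.
by move=> ag gi; apply: (cintble_le _ (cmeas_nat a) gi) => // n _; exact: ag.
Qed.

Lemma integrable_geometric (C q : R) : 0 <= C -> 0 <= q < 1 ->
  cnt.-integrable setT (EFin \o (fun n => C * q ^+ n)).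
Proof.
move=> C0 /andP[q0 q1].
apply: (@integrable_count_ge0 _ (C * (1 - q)^-1)) => n.
  by rewrite mulr_ge0// exprn_ge0.
rewrite -mulr_sumr ler_wpM2l//.
rewrite -[leRHS]mul1r ler_pdivlMr ?subr_gt0//.
by rewrite mulrC -opprB mulNr -subrX1 opprB lerBlDr lerDl exprn_ge0.
Qed.

(** The ratio test, with a bound that is valid from the first term on. *)
Lemma ratio_geometric g (q : R) (m : nat) : 0 < q -> (forall n, 0 <= g n) ->
  (forall n, (m <= n)%N -> g n.+1 <= q * g n) ->
  exists2 C, 0 <= C & forall n, g n <= C * q ^+ n.
Proof.
move=> q0 g0 gq; pose C := \sum_(i < m.+1) g i / q ^+ i.
have C0 : 0 <= C by apply: sumr_ge0 => i _; rewrite divr_ge0// exprn_ge0// ltW.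
exists C => //.
have small n : (n <= m)%N -> g n <= C * q ^+ n.
  move=> nm; rewrite -ler_pdivrMr ?exprn_gt0// /C.
  rewrite (bigD1 (Ordinal (nm : (n < m.+1)%N)))//= lerDl sumr_ge0// => i _.
  by rewrite divr_ge0// exprn_ge0// ltW.
elim=> [|n IH]; first exact: small.
have [nm|mn] := leqP n.+1 m; first exact: small.
by rewrite (le_trans (gq _ mn))// exprS mulrCA ler_wpM2l// ltW.
Qed.

End Series.

(** * Binomial series with complex exponent *)

Section ComplexDerivative.
Context {R : realType}.
Implicit Types (F G : R -> R[i]) (t : R) (l m z : R[i]).

Definition cder F t l :=
  is_derive t 1 (fun x => complex.Re (F x)) (complex.Re l) /\
  is_derive t 1 (fun x => complex.Im (F x)) (complex.Im l).

Lemma is_deriveMf (f g : R -> R) t (df dg : R) : is_derive t 1 f df ->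
  is_derive t 1 g dg ->
  is_derive t 1 (fun x => f x * g x) (f t * dg + g t * df).
Proof. exact: is_deriveM. Qed.

Lemma is_derive_affine (c e t : R) : is_derive t 1 (fun x => c + x * e) e.
Proof.
have H := is_deriveD (is_derive_cst c t 1) (is_deriveMf (is_derive_id t 1) (is_derive_cst e t 1)).
by apply: (is_derive_eq H); rewrite mulr0 mulr1 !add0r.
Qed.

Lemma cderM F G t l m : cder F t l -> cder G t m ->
  cder (fun x => F x * G x) t (l * G t + F t * m).
Proof.
move=> [F1 F2] [G1 G2]; split.
- rewrite (_ : (fun x => _) = (fun x => complex.Re (F x) * complex.Re (G x)) \-
    (fun x => complex.Im (F x) * complex.Im (G x))); last first.
    by apply/funext => x; rewrite cReM.
  have H1 := is_deriveMf F1 G1; have H2 := is_deriveMf F2 G2.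
  apply: (is_derive_eq (is_deriveB H1 H2)).
  by rewrite !(cReD, cReM); ring.
- rewrite (_ : (fun x => _) = (fun x => complex.Re (F x) * complex.Im (G x)) \+
    (fun x => complex.Im (F x) * complex.Re (G x))); last first.
    by apply/funext => x; rewrite cImM.
  have H1 := is_deriveMf F1 G2; have H2 := is_deriveMf F2 G1.
  apply: (is_derive_eq (is_deriveD H1 H2)).
  by rewrite !(cImD, cImM); ring.
Qed.

Lemma cderZ (c : R[i]) F t l : cder F t l -> cder (fun x => c * F x) t (c * l).
Proof.
move=> H; have H0 : cder (fun=> c) t 0 by split; exact: is_derive_cst.
by have := cderM H0 H; rewrite mul0r add0r.
Qed.

Lemma cder_cexp F t l : cder F t l -> cder (fun x => cexp (F x)) t (l * cexp (F t)).
Proof.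
move=> [F1 F2].
have E := @is_derive1_comp _ _ _ _ _ _ (is_derive_expR _) F1.
have C := @is_derive1_comp _ _ _ _ _ _ (is_derive_cos _) F2.
have S := @is_derive1_comp _ _ _ _ _ _ (is_derive_sin _) F2.
have HE : cder (fun x => (expR (complex.Re (F x)))%:C) t
    (expR (complex.Re (F t)) * complex.Re l)%:C.
  by split; [exact: E|exact: is_derive_cst].
have HC : cder (fun x => cos (complex.Im (F x)) +i* sin (complex.Im (F x))) t
    ((- sin (complex.Im (F t)) * complex.Im l) +i*
     (cos (complex.Im (F t)) * complex.Im l)).
  by split.
have := cderM HE HC; rewrite /cexp; set A := (X in cder _ _ X -> _).
suff -> : A = l * cexp (F t) by [].
by rewrite /A /cexp; apply: complexP; rewrite !(cReD, cReM, cImD, cImM)/=; ring.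
Qed.

(** The mean value theorem, applied to both components. *)
Lemma cder0_eq F : (forall t, 0 <= t <= 1 -> cder F t 0) -> F 1 = F 0.
Proof.
move=> H.
have aux (f : R -> R) : (forall t, 0 <= t <= 1 -> is_derive t 1 f 0) -> f 1 = f 0.
  move=> Hf; have c t : 0 <= t <= 1 -> {for t, continuous f}.
    move=> /Hf; move=> [+ _].
    by move=> /derivable1_diffP; exact: differentiable_continuous.
  have [|||x _] := @MVT R f (fun=> 0) 0 1.
  - exact: ltr01.
  - by move=> x /[!in_itv]/= /andP[x0 x1]; apply: Hf; rewrite !ltW.
  - apply: continuous_in_subspaceT => x /[!inE]/= /[!in_itv]/=; exact: c.
  - by rewrite mul0r => /eqP; rewrite subr_eq0 => /eqP.
by apply: complexP;
  [apply: (aux (fun x => complex.Re (F x)))|apply: (aux (fun x => complex.Im (F x)))]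
  => t /H[].
Qed.

Lemma carg_Re_gt0 z : 0 < complex.Re z -> carg z = atan (complex.Im z / complex.Re z).
Proof.
move=> x0; rewrite /carg; set x := complex.Re z in x0 *; set y := complex.Im z.
have c0 : 0 < cmod z.
  by rewrite (lt_le_trans x0)// (le_trans _ (Re_le_cmod _))// ler_norm.
have -> : x / cmod z = cos (atan (y / x)).
  rewrite cos_atan.
  have -> : cmod z = x * Num.sqrt (1 + (y / x) ^+ 2).
    rewrite -{1}(gtr0_norm x0) -sqrtr_sqr -sqrtrM ?sqr_ge0// cmodE -/x -/y.
    by congr Num.sqrt; field; rewrite gt_eqF.
  by rewrite invfM mulrA divff ?mul1r// gt_eqF.
have pi0 : 0 < pi :> R := pi_gt0 R.
have lo := atan_gtNpi2 (y / x); have up := atan_ltpi2 (y / x).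
case: ifPn => y0.
  have t0 : 0 <= atan (y / x) by rewrite -atan0 le_atan// divr_ge0// ltW.
  by rewrite cosK// in_itv/= t0/=; move: up pi0; set a := atan _; lra.
have t0 : atan (y / x) <= 0.
  by rewrite -atan0 le_atan// pmulr_lle0 ?invr_gt0// ltW// ltNge.
rewrite -cosN cosK ?opprK// in_itv/= oppr_ge0 t0/=.
by move: lo pi0; set a := atan _; lra.
Qed.

Lemma cln_Re_gt0 z : 0 < complex.Re z -> cln z =
  (ln (complex.Re z ^+ 2 + complex.Im z ^+ 2) / 2) +i*
  atan (complex.Im z / complex.Re z).
Proof.
move=> x0; rewrite /cln carg_Re_gt0//; congr (_ +i* _).
have c0 : 0 < cmod z.
  by rewrite (lt_le_trans x0)// (le_trans _ (Re_le_cmod _))// ler_norm.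
have -> : complex.Re z ^+ 2 + complex.Im z ^+ 2 = cmod z ^+ 2.
  by rewrite cmodE sqr_sqrtr// addr_ge0// sqr_ge0.
by rewrite lnXn// mulr2n; lra.
Qed.

End ComplexDerivative.

Lemma ccvgS (R : realType) (u : nat -> R[i]) l :
  ccvg u l -> ccvg (fun n => u n.+1) l.
Proof.
move=> [a b]; split.
- by rewrite (cvg_shiftS (fun n => complex.Re (u n))).
- by rewrite (cvg_shiftS (fun n => complex.Im (u n))).
Qed.

Section Binomial.
Context {R : realType}.
Implicit Types (g h w z : R[i]) (x q t : R).

Local Notation cnt := (@counting nat R).

(** The coefficients of the series of (1 - w) ^ (- g). *)
Definition nbin g n : R[i] := \prod_(i < n) ((g + i%:R) / i.+1%:R).

(** The real case, which majorises the complex one (cmod_nbin). *)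
Definition rnbin x n : R := \prod_(i < n) ((x + i%:R) / i.+1%:R).

Lemma nbinS g n : nbin g n.+1 = nbin g n * ((g + n%:R) / n.+1%:R).
Proof. by rewrite /nbin big_ord_recr. Qed.

Lemma nbin0 g : nbin g 0 = 1.
Proof. by rewrite /nbin big_ord0. Qed.

Lemma rnbinS x n : rnbin x n.+1 = rnbin x n * ((x + n%:R) / n.+1%:R).
Proof. by rewrite /rnbin big_ord_recr. Qed.

Lemma rnbin_ge0 x n : 0 <= x -> 0 <= rnbin x n.
Proof. by move=> x0; rewrite prodr_ge0// => i _; rewrite divr_ge0// addr_ge0. Qed.

Lemma rnbin_nbin x n : (rnbin x n)%:C = nbin x%:C n.
Proof.
rewrite /rnbin /nbin rmorph_prod; apply: eq_bigr => i _.
by rewrite rmorphM fmorphV rmorphD !rmorph_nat.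
Qed.

Lemma cmod_nbin g n x : cmod g <= x -> cmod (nbin g n) <= rnbin x n.
Proof.
move=> gx; have x0 : 0 <= x by rewrite (le_trans _ gx)// cmod_ge0.
elim: n => [|n IH]; first by rewrite nbin0 cmod1 /rnbin big_ord0.
rewrite nbinS rnbinS !cmodM cmodV cmod_nat !mulrA.
rewrite ler_pM ?mulr_ge0 ?cmod_ge0// ler_pM ?cmod_ge0//.
by rewrite (le_trans (cmodD _ _))// cmod_nat lerD2r.
Qed.

(** The quotient of consecutive terms is q (x + n) / (n + 1), which tends to q
    and so ends up below q'. *)
Lemma rnbin_geometric x q q' : 0 <= x -> 0 <= q < q' ->
  exists2 C, 0 <= C & forall n, rnbin x n * q ^+ n <= C * q' ^+ n.
Proof.
move=> x0 /andP[q0 qq']; have q'0 : 0 < q' by exact: le_lt_trans qq'.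
pose m := (Num.truncn (x * q / (q' - q))).+1.
apply: (@ratio_geometric _ (fun n => rnbin x n * q ^+ n) q' m) => // n.
  by rewrite mulr_ge0 ?exprn_ge0// rnbin_ge0.
move=> mn; rewrite rnbinS exprS.
rewrite (_ : _ * _ = ((x + n%:R) * q / n.+1%:R) * (rnbin x n * q ^+ n)); last by ring.
rewrite ler_wpM2r ?mulr_ge0 ?exprn_ge0 ?rnbin_ge0// ler_pdivrMr ?ltr0n//.
have /ltW : x * q / (q' - q) < m%:R by exact: truncnS_gt.
rewrite ler_pdivrMr ?subr_gt0// => H.
have {}H : x * q <= n%:R * (q' - q).
  by apply: (le_trans H); rewrite ler_wpM2r ?ler_nat// subr_ge0 ltW.
rewrite -natr1; move: H q'0; set N := n%:R; nra.
Qed.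

Lemma rnbin_summable x q : 0 <= x -> 0 <= q < 1 ->
  cnt.-integrable setT (EFin \o (fun n => rnbin x n * q ^+ n)).
Proof.
move=> x0 /andP[q0 q1].
have [C C0 H] : exists2 C, 0 <= C & forall n, rnbin x n * q ^+ n <= C * ((1 + q) / 2) ^+ n.
  by apply: rnbin_geometric => //; rewrite q0/=; lra.
apply: le_integrable (integrable_geometric C0 (q := (1 + q) / 2) _) => //.
- move=> n _ /=; rewrite lee_fin !ger0_norm ?mulr_ge0 ?exprn_ge0 ?rnbin_ge0//.
  by lra.
- by apply/andP; split; lra.
Qed.

Lemma nbin_summable g w : cmod w < 1 -> cintble cnt setT (fun n => nbin g n * w ^+ n).
Proof.
move=> w1; have H : 0 <= cmod w < 1 by rewrite cmod_ge0.
apply: cintble_count (rnbin_summable (cmod_ge0 g) H) => n.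
by rewrite cmodM cmodX ler_wpM2r ?exprn_ge0 ?cmod_ge0// cmod_nbin.
Qed.

Lemma nbinSl g n : n.+1%:R * nbin g n.+1 = g * nbin (g + 1) n.
Proof.
elim: n => [|n IH].
  by rewrite nbinS !nbin0 !mul1r addr0 divr1 mulr1.
rewrite nbinS [in RHS]nbinS [RHS]mulrA -IH -addrA nat1r.
have n1 : n.+1%:R != 0 :> R[i] by rewrite pnatr_eq0.
have n2 : n.+2%:R != 0 :> R[i] by rewrite pnatr_eq0.
move: (nbin g n.+1) (n.+1%:R : R[i]) (n.+2%:R : R[i]) n1 n2 => c a b a0 b0.
by field; rewrite a0 b0.
Qed.

Lemma nbin_pascal g n : nbin (g + 1) n.+1 - nbin (g + 1) n = nbin g n.+1.
Proof.
have n0 : n.+1%:R != 0 :> R[i] by rewrite pnatr_eq0.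
apply: (mulfI n0); rewrite nbinSl nbinS -natr1; field.
by rewrite natr1 pnatr_eq0.
Qed.

Definition bser g w : R[i] := csum (fun n => nbin g n * w ^+ n).

(** By the rule of Pascal, multiplication by 1 - w takes differences of
    consecutive coefficients. *)
Lemma bser_rec g w : cmod w < 1 -> (1 - w) * bser (g + 1) w = bser g w.
Proof.
move=> w1.
have c1 := ccvg_csum (nbin_summable (g + 1) w1).
have c1S : ccvg (fun n => \sum_(i < n.+1) nbin (g + 1) i * w ^+ i) (bser (g + 1) w).
  exact: (ccvgS c1).
have c0S : ccvg (fun n => \sum_(i < n.+1) nbin g i * w ^+ i) (bser g w).
  exact: (ccvgS (ccvg_csum (nbin_summable g w1))).
have := ccvgD c1S (ccvgM (ccvg_cst (- w)) c1); rewrite -/(bser _ _) => c.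
rewrite mulrBl mul1r -mulNr; apply: (ccvg_unique c).
rewrite (_ : (fun _ => _) = (fun n => \sum_(i < n.+1) nbin g i * w ^+ i))//.
apply/funext => n; rewrite !big_ord_recl/= !nbin0 expr0 -addrA; congr (_ + _).
rewrite mulr_sumr -big_split/=; apply: eq_bigr => i _.
by rewrite /bump/= add1n -(nbin_pascal g) exprS; ring.
Qed.

(** Along the ray through w the series is a pair of real power series, which
    can be differentiated term by term. *)
Lemma bser_pseries h g w t : cmod w * `|t| < 1 ->
  (pseries (fun n => complex.Re (h * (nbin g n * w ^+ n))) t @ \oo -->
    complex.Re (h * bser g (w * t%:C))) /\
  (pseries (fun n => complex.Im (h * (nbin g n * w ^+ n))) t @ \oo -->
    complex.Im (h * bser g (w * t%:C))).
Proof.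
move=> wt; have wt1 : cmod (w * t%:C) < 1 by rewrite cmodM cmodr.
have := ccvgM (ccvg_cst h) (ccvg_csum (nbin_summable g wt1)); rewrite -/(bser _ _).
have E n : h * (\sum_(i < n) nbin g i * (w * t%:C) ^+ i) =
    \sum_(0 <= i < n) (h * (nbin g i * w ^+ i)) * (t ^+ i)%:C.
  rewrite big_mkord mulr_sumr; apply: eq_bigr => i _.
  by rewrite exprMn rmorphXn/=; ring.
move=> [c1 c2]; split.
- suff <- : (fun n => complex.Re (h * \sum_(i < n) nbin g i * (w * t%:C) ^+ i)) =
    pseries (fun n => complex.Re (h * (nbin g n * w ^+ n))) t by [].
  apply/funext => n; rewrite /pseries/series/=.
  rewrite E (big_morph _ (@cReD R) (erefl (complex.Re 0))).
  by apply: eq_bigr => i _; rewrite cReMr.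
- suff <- : (fun n => complex.Im (h * \sum_(i < n) nbin g i * (w * t%:C) ^+ i)) =
    pseries (fun n => complex.Im (h * (nbin g n * w ^+ n))) t by [].
  apply/funext => n; rewrite /pseries/series/=.
  rewrite E (big_morph _ (@cImD R) (erefl (complex.Im 0))).
  by apply: eq_bigr => i _; rewrite cImMr.
Qed.

Let yser h g w t : R[i] :=
  limn (pseries (fun n => complex.Re (h * (nbin g n * w ^+ n))) t) +i*
  limn (pseries (fun n => complex.Im (h * (nbin g n * w ^+ n))) t).

Let yserE h g w t : cmod w * `|t| < 1 -> yser h g w t = h * bser g (w * t%:C).
Proof.
move=> /(bser_pseries h g)[a b]; apply: complexP => /=; exact: cvg_lim.
Qed.

Let yser_der g w t : cmod w < 1 -> 0 <= t <= 1 ->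
  cder (yser 1 g w) t (yser (g * w) (g + 1) w t).
Proof.
move=> w1 t01; have w0 := cmod_ge0 w.
pose K : R := 2 / (1 + cmod w).
have K1 : 1 < K by rewrite /K ltr_pdivlMr; lra.
have wK : cmod w * `|K| < 1.
  rewrite gtr0_norm ?(lt_trans _ K1)// /K mulrA ltr_pdivrMr; lra.
have tK : `|t| < `|K| by rewrite !ger0_norm//; lra.
have dif h g' n : (n.+1%:R)%:C * (h * (nbin g' n.+1 * w ^+ n.+1)) =
    (h * (g' * w)) * (nbin (g' + 1) n * w ^+ n).
  rewrite rmorph_nat; transitivity (h * (n.+1%:R * nbin g' n.+1) * (w * w ^+ n)).
    by rewrite exprS; ring.
  by rewrite nbinSl; ring.
have dRe h g' : pseries_diffs (fun n => complex.Re (h * (nbin g' n * w ^+ n))) =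
    (fun n => complex.Re ((h * (g' * w)) * (nbin (g' + 1) n * w ^+ n))).
  by apply/funext => n; rewrite /pseries_diffs -dif mulrC -cReMr mulrC.
have dIm h g' : pseries_diffs (fun n => complex.Im (h * (nbin g' n * w ^+ n))) =
    (fun n => complex.Im ((h * (g' * w)) * (nbin (g' + 1) n * w ^+ n))).
  by apply/funext => n; rewrite /pseries_diffs -dif mulrC -cImMr mulrC.
have cv h g' := bser_pseries h g' wK.
split => /=; rewrite -[g * w]mul1r -?dRe -?dIm; apply: (@pseries_snd_diffs _ _ K).
- by apply/cvg_ex; eexists; exact: (cv _ _).1.
- by rewrite dRe; apply/cvg_ex; eexists; exact: (cv _ _).1.
- by rewrite !dRe; apply/cvg_ex; eexists; exact: (cv _ _).1.
- exact: tK.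
- by apply/cvg_ex; eexists; exact: (cv _ _).2.
- by rewrite dIm; apply/cvg_ex; eexists; exact: (cv _ _).2.
- by rewrite !dIm; apply/cvg_ex; eexists; exact: (cv _ _).2.
- exact: tK.
Qed.

Let Re1_gt0 w t : cmod w < 1 -> 0 <= t <= 1 -> 0 < 1 - t * complex.Re w.
Proof.
move=> w1 t01; have := Re_le_cmod w; set a := complex.Re w; rewrite ler_norml => aw.
have [a0|a0] := leP 0 a; nra.
Qed.

(** The logarithm of 1 - t w, in a form that can be differentiated in t. *)
Let lg w t : R[i] :=
  (ln ((1 - t * complex.Re w) ^+ 2 + (t * complex.Im w) ^+ 2) / 2) +i*
  atan (- (t * complex.Im w) / (1 - t * complex.Re w)).

Let lg_der w t : cmod w < 1 -> 0 <= t <= 1 ->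
  cder (lg w) t (- w / (1 - t%:C * w)).
Proof.
move=> w1 t01; have p0 := Re1_gt0 w1 t01.
set N := (1 - t * complex.Re w) ^+ 2 + (t * complex.Im w) ^+ 2.
have N0 : 0 < N by rewrite ltr_pwDl ?sqr_ge0// exprn_gt0.
have -> : - w / (1 - t%:C * w) =
    ((- complex.Re w * (1 - t * complex.Re w) + t * complex.Im w ^+ 2) / N) +i*
    (- complex.Im w / N).
  have z0 : 1 - t%:C * w != 0.
    rewrite eq_complex negb_and; apply/orP; left.
    by move: p0; case: (w) => a b /= p0; rewrite mul0r subr0 gt_eqF.
  apply: (mulIf z0); rewrite divfK//.
  move: N0; rewrite /N; case: (w) => a b /= N0.
  by apply: complexP => /=; field; rewrite gt_eqF.
have du := is_derive_affine 1 (- complex.Re w) t.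
have dv := is_derive_affine 0 (complex.Im w) t.
pose P (x : R) : R := (1 + x * - complex.Re w) * (1 + x * - complex.Re w) +
  (0 + x * complex.Im w) * (0 + x * complex.Im w).
have dP : is_derive t 1 P _ := is_deriveD (is_deriveMf du du) (is_deriveMf dv dv).
have PN : P t = N by rewrite /P /N; ring.
split => /=.
- have L : is_derive (P t) 1 (@ln R) N^-1 by rewrite -PN; apply: is_derive1_ln; rewrite PN.
  have H := is_deriveMf (is_derive1_comp L dP) (is_derive_cst (2^-1 : R) t 1).
  rewrite (_ : (fun x => _) = (fun x => (@ln R \o P) x * 2^-1)); last first.
    by apply/funext => x /=; rewrite /P; congr (ln _ / 2); ring.
  by apply: (is_derive_eq H); rewrite /cst /= mulr0 add0r; field; rewrite gt_eqF.
- have dn := is_derive_affine 0 (- complex.Im w) t.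
  have u0 : 1 + t * - complex.Re w != 0 by rewrite mulrN gt_eqF.
  pose Q (x : R) : R := (0 + x * - complex.Im w) * (1 + x * - complex.Re w)^-1.
  have dV := @is_deriveV R (fun x : R => 1 + x * - complex.Re w) t _ 1 u0 du.
  have dQ : is_derive t 1 Q _ := is_deriveMf dn dV.
  rewrite (_ : (fun x => _) = (@atan R \o Q)); last first.
    by apply/funext => x /=; rewrite /Q; congr (atan (_ / _)); ring.
  apply: (is_derive_eq (is_derive1_comp (is_derive1_atan (Q t)) dQ)).
  have Q2 : 1 + Q t ^+ 2 = N / (1 - t * complex.Re w) ^+ 2.
    by rewrite /Q /N mulrN; field; rewrite gt_eqF.
  rewrite Q2 /GRing.scale/=; field.
  by rewrite (gt_eqF N0) u0.
Qed.

(** Newton's binomial theorem for complex exponents. Along the segment from 0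
    to w, the series y solves (1 - t w) y' = g w y, hence its product with
    (1 - t w) ^ g is constant. *)
Lemma binomial_series g w : cmod w < 1 ->
  csum (fun n => nbin g n * w ^+ n) = cpow (1 - w) (- g).
Proof.
move=> w1; rewrite -/(bser g w).
have wt t : 0 <= t <= 1 -> cmod w * `|t| < 1.
  move=> t01; have := cmod_ge0 w; rewrite ger0_norm; nra.
pose F t := cexp (g * lg w t) * yser 1 g w t.
have : F 1 = F 0.
  apply: cder0_eq => t t01.
  have := cderM (cder_cexp (cderZ g (lg_der w1 t01))) (yser_der g w1 t01).
  rewrite !yserE ?wt// mul1r -(@bser_rec g (w * t%:C)) ?cmodM ?cmodr ?wt//.
  set A := (X in cder _ _ X -> _); suff -> : A = 0 by [].
  rewrite /A; have z0 : 1 - t%:C * w != 0.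
    rewrite eq_complex negb_and; apply/orP; left.
    by move: (Re1_gt0 w1 t01); case: (w) => a b /= p0; rewrite mul0r subr0 gt_eqF.
  by field.
have E0 : F 0 = 1.
  rewrite /F yserE ?wt ?lexx ?ler01// mul1r mulr0 /bser.
  have -> : lg w 0 = 0.
    rewrite /lg !mul0r subr0 oppr0 mul0r atan0 expr1n expr0n addr0 ln1 mul0r.
    by [].
  rewrite mulr0 cexp0 mul1r; apply: (ccvg_unique (ccvg_csum _)).
    by apply: nbin_summable; rewrite cmod0.
  rewrite (_ : (fun n => _) = fun n => (n != 0%N)%:R); last first.
    apply/funext => -[|n]; first by rewrite big_ord0.
    rewrite big_ord_recl/= nbin0 expr0 mulr1 big1 ?addr0// => i _.
    by rewrite expr0n mulr0.
  by split; apply: cvg_near_cst; exists 1%N => // -[|n].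
rewrite E0 /F yserE ?wt ?lexx ?ler01// mul1r mulr1.
have -> : lg w 1 = cln (1 - w).
  rewrite cln_Re_gt0; last first.
    by have := @Re1_gt0 w 1 w1; rewrite mul1r cReD cReN; apply; rewrite lexx ler01.
  by rewrite cReD cImD cReN cImN /lg/= !mul1r sub0r sqrrN.
have w0 : 1 - w != 0.
  by rewrite subr_eq0; apply: contraTneq w1 => <-; rewrite cmod1 ltxx.
rewrite /cpow (negbTE w0) mulNr cexpN => H.
by apply: (mulfI (cexp_neq0 (g * cln (1 - w)))); rewrite H mulfV// cexp_neq0.
Qed.

End Binomial.

(** * Power series expansions of functions of a real variable *)

Section Expansions.
Context {R : realType}.
Implicit Types (D E : R -> R[i]) (a b : nat -> R[i]) (r M h : R).

Let le_of_eq (x y : R) : x = y -> x <= y. Proof. by move->. Qed.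

(** Analyticity at 0, in a form that involves finite sums only: the Taylor
    polynomials of all orders approximate D with a geometric rate. *)
Definition psexp D a r M := forall N h, `|h| <= r ->
  cmod (D h - \sum_(j < N) a j * h%:C ^+ j) <= M * (`|h| / r) ^+ N.

Lemma psexp_le D a r M h : psexp D a r M -> `|h| <= r -> cmod (D h) <= M.
Proof. by move=> H /(H 0); rewrite big_ord0 subr0 expr0 mulr1. Qed.

Lemma psexp_ge0 D a r M : 0 < r -> psexp D a r M -> 0 <= M.
Proof.
move=> r0 H; apply: le_trans (psexp_le (h := 0) H _); first exact: cmod_ge0.
by rewrite normr0 ltW.
Qed.

Lemma eq_psexp E D a r M : (forall h, `|h| <= r -> D h = E h) ->
  psexp D a r M -> psexp E a r M.
Proof. by move=> DE H N h hr; rewrite -DE//; exact: H. Qed.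

Lemma psexp_shrink r' D a r M : 0 < r' <= r -> psexp D a r M -> psexp D a r' M.
Proof.
move=> /andP[r'0 r'r] H N h hr'; have r0 := lt_le_trans r'0 r'r.
apply: le_trans (H N h _) _.
  exact: le_trans hr' _.
have M0 : 0 <= M by exact: psexp_ge0 (lt_le_trans r'0 r'r) H.
rewrite ler_wpM2l// lerXn2r ?nnegrE ?divr_ge0 ?(ltW r0) ?(ltW r'0)//.
by rewrite ler_wpM2l// lef_pV2 ?posrE.
Qed.

(** The term of order j is the difference of two consecutive remainders. *)
Lemma psexp_coef D a r M j : 0 < r -> psexp D a r M ->
  cmod (a j) * r ^+ j <= 2 * M.
Proof.
move=> r0 H; have rr : `|r| <= r by rewrite gtr0_norm.
have := lerD (H j _ rr) (H j.+1 _ rr).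
rewrite gtr0_norm// divff ?gt_eqF// !expr1n !mulr1 => H2.
rewrite mulr_natl mulr2n; apply: le_trans H2.
rewrite -[X in _ <= _ + X]cmodN -[r in r ^+ j]gtr0_norm// -cmodr -cmodX -cmodM.
apply: le_trans (cmodD _ _); apply: le_of_eq.
by rewrite big_ord_recr/=; congr cmod; ring.
Qed.

Lemma psexpB D E a b r M M' : psexp D a r M -> psexp E b r M' ->
  psexp (fun h => D h - E h) (fun j => a j - b j) r (M + M').
Proof.
move=> H H' N h hr; rewrite mulrDl; apply: le_trans (lerD (H N h hr) (H' N h hr)).
apply: le_trans (cmodB _ _); apply: le_of_eq; congr cmod.
under eq_bigr do rewrite mulrBl.
by rewrite sumrB; ring.
Qed.

Lemma psexpZ (c : R[i]) D a r M : psexp D a r M ->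
  psexp (fun h => c * D h) (fun j => c * a j) r (cmod c * M).
Proof.
move=> H N h hr; rewrite -mulrA; apply: le_trans (ler_wpM2l (cmod_ge0 c) (H N h hr)).
rewrite -cmodM; apply: le_of_eq; congr cmod; rewrite mulrBr mulr_sumr; congr (_ - _).
by apply: eq_bigr => i _; rewrite mulrA.
Qed.

Definition cauchy_prod a b n := \sum_(i < n.+1) a i * b (n - i)%N.

Let cauchy_prodE a b (z : R[i]) N :
  \sum_(n < N) cauchy_prod a b n * z ^+ n =
  \sum_(i < N) a i * z ^+ i * \sum_(j < N - i) b j * z ^+ j.
Proof.
elim: N => [|N IH]; first by rewrite !big_ord0.
rewrite big_ord_recr/= IH [in RHS]big_ord_recr/= subSnn big_ord1.
rewrite /cauchy_prod big_ord_recr/= subnn mulrDl addrA; congr (_ + _); last first.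
  by rewrite expr0 mulr1; ring.
rewrite mulr_suml -big_split/=; apply: eq_bigr => i _.
rewrite subSn ?(ltnW (ltn_ord i))// big_ord_recr/= mulrDr; congr (_ + _).
have -> : z ^+ N = z ^+ i * z ^+ (N - i) by rewrite -exprD subnKC// ltnW.
ring.
Qed.

(** The N-th remainder of a product has N terms of order N: the factor N is
    absorbed by halving the radius. *)
Lemma psexpM D E a b r M M' : 0 < r -> psexp D a r M -> psexp E b r M' ->
  psexp (fun h => D h * E h) (cauchy_prod a b) (r / 2) (3 * (M * M')).
Proof.
move=> r0 H H' N h hr2; have hr : `|h| <= r by apply: (le_trans hr2); lra.
have M0 := psexp_ge0 r0 H; have M'0 := psexp_ge0 r0 H'.
pose q := `|h| / r; have q0 : 0 <= q by rewrite divr_ge0// ltW.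
have -> : `|h| / (r / 2) = 2 * q by rewrite /q; field; rewrite gt_eqF.
rewrite cauchy_prodE.
have -> : D h * E h - \sum_(i < N) a i * h%:C ^+ i * \sum_(j < N - i) b j * h%:C ^+ j =
   (D h - \sum_(i < N) a i * h%:C ^+ i) * E h + \sum_(i < N) (a i * h%:C ^+ i *
     (E h - \sum_(j < N - i) b j * h%:C ^+ j)).
  rewrite (_ : \sum_(i < N) a i * h%:C ^+ i * (E h - _) =
    (\sum_(i < N) a i * h%:C ^+ i) * E h -
    \sum_(i < N) a i * h%:C ^+ i * \sum_(j < N - i) b j * h%:C ^+ j).
    by ring.
  by rewrite mulr_suml -sumrB; apply: eq_bigr => i _; rewrite mulrBr.
apply: (@le_trans _ _ (M * q ^+ N * M' + \sum_(i < N) (2 * M * M' * q ^+ N))).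
  apply: le_trans (cmodD _ _) _; apply: lerD.
    rewrite cmodM ler_pM ?cmod_ge0//; first exact: H.
    exact: psexp_le H' hr.
  apply: le_trans (@cmod_sum _ N (fun i => a i * h%:C ^+ i * (E h - \sum_(j < N - i) b j * h%:C ^+ j))) _.
  apply: ler_sum => i _; rewrite !cmodM cmodX cmodr.
  rewrite (_ : 2 * M * M' * q ^+ N = (2 * M * q ^+ i) * (M' * q ^+ (N - i))); last first.
    have -> : q ^+ N = q ^+ i * q ^+ (N - i) by rewrite -exprD subnKC// ltnW.
    ring.
  rewrite ler_pM ?mulr_ge0 ?cmod_ge0 ?exprn_ge0//; last exact: H'.
  have -> : `|h| = r * q by rewrite /q; field; rewrite gt_eqF.
  by rewrite exprMn mulrA ler_wpM2r ?exprn_ge0//; exact: psexp_coef H.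
rewrite sumr_const card_ord -[_ *+ N]mulr_natr (exprMn _ 2 q).
have N2 : 1 + 2 * N%:R <= 3 * 2 ^+ N :> R.
  elim: (N) => [|n IH]; first by rewrite expr0; lra.
  rewrite exprS -natr1; have : 1 <= (2 : R) ^+ n by rewrite exprn_ege1// ler1n.
  by move: IH; lra.
rewrite (_ : _ + _ = (M * M' * q ^+ N) * (1 + 2 * N%:R)); last by ring.
rewrite (_ : 3 * _ * _ = (M * M' * q ^+ N) * (3 * 2 ^+ N)); last by ring.
by rewrite ler_wpM2l// !mulr_ge0// exprn_ge0.
Qed.

(** If the coefficients before a_n vanish, then the remainder of order n + 1
    bounds |a_n| by a multiple of h, for arbitrarily small h. *)
Lemma psexp_coef0 D a r M : 0 < r -> psexp D a r M ->
  (forall h, 0 < h <= r -> D h = 0) -> forall j, a j = 0.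
Proof.
move=> r0 H D0; have M0 := psexp_ge0 r0 H.
elim/ltn_ind => n IH; apply/eqP; rewrite -cmod_eq0; apply/eqP/le_anti.
rewrite cmod_ge0 andbT; apply/ler_addgt0Pr => e e0; rewrite add0r.
pose h := Num.min r (e * r ^+ n.+1 / (M + 1)).
have h0 : 0 < h by rewrite lt_min r0 divr_gt0 ?mulr_gt0 ?exprn_gt0 ?ltr_wpDl.
have hr : h <= r by rewrite ge_min lexx.
have hr' : `|h| <= r by rewrite gtr0_norm.
have := H n.+1 h hr'; rewrite D0 ?h0// sub0r cmodN big_ord_recr/= big1 ?add0r; last first.
  by move=> i _; rewrite IH ?mul0r.
rewrite cmodM cmodX cmodr gtr0_norm// exprMn exprVn exprS.
rewrite (_ : M * _ = (M * h / r ^+ n.+1) * h ^+ n); last by ring.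
rewrite ler_pM2r ?exprn_gt0// => /le_trans; apply.
rewrite ler_pdivrMr ?exprn_gt0//.
have : h <= e * r ^+ n.+1 / (M + 1) by rewrite ge_min lexx orbT.
rewrite ler_pdivlMr ?ltr_wpDl//; apply: le_trans.
by rewrite mulrDr mulr1 mulrC lerDl ltW.
Qed.

Lemma psexp_unique D a b r M M' : 0 < r -> psexp D a r M -> psexp D b r M' ->
  forall j, a j = b j.
Proof.
move=> r0 H H' j; apply/eqP; rewrite -subr_eq0; apply/eqP.
by apply: (psexp_coef0 r0 (psexpB H H')) => h _; rewrite subrr.
Qed.

(** All Taylor polynomials vanish, and the remainders tend to zero inside the
    interval, on both sides of the origin. *)
Lemma psexp_eq0 D a r M : 0 < r -> psexp D a r M ->
  (forall h, 0 < h <= r -> D h = 0) -> forall h, `|h| < r -> D h = 0.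
Proof.
move=> r0 H D0 h hr; have a0 := psexp_coef0 r0 H D0; have M0 := psexp_ge0 r0 H.
apply/eqP; rewrite -cmod_eq0; apply/eqP/le_anti; rewrite cmod_ge0 andbT.
have q1 : `|(`|h| / r)| < 1.
  by rewrite ger0_norm ?divr_ge0 ?(ltW r0)// ltr_pdivrMr ?mul1r.
have c : (M * (`|h| / r) ^+ n) @[n --> \oo] --> (0 : R).
  by rewrite -(mulr0 M); apply: cvgMr; exact: cvg_expr.
rewrite -(cvg_lim _ c)//; apply: limr_ge; first by apply/cvg_ex; exists 0.
apply: nearW => n; have := H n h (ltW hr).
by rewrite big1 ?subr0// => i _; rewrite a0 mul0r.
Qed.

(** The remainders of the integral are the integrals of the remainders, which
    are dominated by G at all orders. *)
Lemma psexp_cint d (T : measurableType d) (mu : {measure set T -> \bar R})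
    (X : set T) (F : T -> R -> R[i]) (A : T -> nat -> R[i]) (G : T -> R) r :
  measurable X -> 0 < r ->
  (forall h, cmeas X (F ^~ h)) -> (forall j, cmeas X (A ^~ j)) ->
  mu.-integrable X (EFin \o G) ->
  (forall x, X x -> psexp (F x) (A x) r (G x)) ->
  psexp (fun h => cint mu X (F ^~ h)) (fun j => cint mu X (A ^~ j)) r
    (2 * \int[mu]_(x in X) G x).
Proof.
move=> mX r0 mF mA iG H N h hr.
have iF : cintble mu X (F ^~ h).
  by apply: (cintble_le mX (mF h) iG) => x Xx; exact: psexp_le (H x Xx) hr.
have iA j : cintble mu X (A ^~ j).
  apply: (cintble_le mX (mA j) (h := fun x => (2 / r ^+ j) * G x)).
    by rewrite /comp; under eq_fun do rewrite EFinM; exact: integrableZl.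
  move=> x Xx; rewrite mulrAC ler_pdivlMr ?exprn_gt0//.
  exact: psexp_coef r0 (H x Xx).
have iAh j : cintble mu X (fun x => A x j * h%:C ^+ j).
  by under eq_fun do rewrite mulrC; exact: cintbleZ.
have -> : cint mu X (F ^~ h) - \sum_(j < N) cint mu X (A ^~ j) * h%:C ^+ j =
    cint mu X (fun x => F x h - \sum_(j < N) A x j * h%:C ^+ j).
  rewrite cintB//; last exact: (@cintble_sum _ _ _ mu X N (fun j x => A x j * h%:C ^+ j)).
  rewrite (@cint_sum _ _ _ mu X N (fun j x => A x j * h%:C ^+ j))//.
  congr (_ - _); apply: eq_bigr => j _.
  by under [in RHS]eq_cint do rewrite mulrC; rewrite cintZ// mulrC.
rewrite -mulrA -RintegralZr//; apply: le_cmod_cint => //.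
- apply: cintbleB => //.
  exact: (@cintble_sum _ _ _ mu X N (fun j x => A x j * h%:C ^+ j)).
- by rewrite /comp; under eq_fun do rewrite EFinM; exact: integrableZr.
- by move=> x Xx; exact: H.
Qed.

Local Notation cnt := (@counting nat R).

Lemma csum_delta (c : R[i]) j : csum (fun i => if i == j then c else 0) = c.
Proof.
have ic : cintble cnt setT (fun i => if i == j then c else 0).
  apply: (@cintble_count _ _ (fun i => cmod c * (i == j)%:R)).
    by move=> n; case: ifP => _; rewrite ?mulr1 ?mulr0 ?cmod0.
  apply: (@integrable_count_ge0 _ _ (cmod c)).
    by move=> n; rewrite mulr_ge0// cmod_ge0.
  move=> n; rewrite -mulr_sumr ler_piMr ?cmod_ge0//.
  have [jn|nj] := ltnP j n.
    rewrite (bigD1 (Ordinal jn))//= eqxx big1 ?addr0// => i ij.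
    rewrite (_ : (_ == _) = false)//; apply: contraNF ij => /eqP ij.
    exact/eqP/val_inj.
  rewrite big1// => i _; rewrite (_ : (_ == _) = false)//; apply/negbTE.
  by rewrite neq_ltn (leq_trans (ltn_ord i)).
apply: (ccvg_unique (ccvg_csum ic)).
have E n : (j < n)%N -> \sum_(i < n) (if (i : nat) == j then c else 0) = c.
  move=> jn; rewrite (bigD1 (Ordinal jn))//= eqxx big1 ?addr0// => i ij.
  by rewrite ifF//; apply: contraNF ij => /eqP ij; apply/eqP/val_inj.
by split; apply: cvg_near_cst; exists j.+1 => // n jn; rewrite E.
Qed.

Lemma psexp_monomial (c : R[i]) i r : 0 < r ->
  psexp (fun h => c * h%:C ^+ i) (fun j => if i == j then c else 0) r
    (cmod c * r ^+ i).
Proof.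
move=> r0 N h hr; have [iN|Ni] := ltnP i N.
  rewrite (bigD1 (Ordinal iN))//= eqxx big1 ?addr0 ?subrr ?cmod0; last first.
    move=> j ij; rewrite ifF ?mul0r//.
    by apply: contraNF ij => /eqP ij; apply/eqP/val_inj.
  by rewrite !mulr_ge0 ?cmod_ge0 ?exprn_ge0 ?divr_ge0 ?(ltW r0).
rewrite big1 ?subr0; last first.
  move=> j _; rewrite ifF ?mul0r//; apply/negbTE; rewrite neq_ltn orbC.
  by rewrite (leq_trans (ltn_ord j)).
rewrite cmodM cmodX cmodr -mulrA ler_wpM2l ?cmod_ge0//.
have {1}-> : `|h| = r * (`|h| / r) by field; rewrite gt_eqF.
rewrite exprMn ler_wpM2l ?exprn_ge0 ?(ltW r0)//.
by rewrite ler_wiXn2l ?divr_ge0 ?(ltW r0)// ler_pdivrMr ?mul1r.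
Qed.

(** A power series is an integral of monomials for the counting measure. *)
Lemma psexp_series D a r : 0 < r ->
  cnt.-integrable setT (EFin \o (fun j => cmod (a j) * r ^+ j)) ->
  (forall h, `|h| <= r -> D h = csum (fun j => a j * h%:C ^+ j)) ->
  psexp D a r (2 * \int[cnt]_j (cmod (a j) * r ^+ j)).
Proof.
move=> r0 ia Dh.
have := @psexp_cint _ _ cnt setT (fun i h => a i * h%:C ^+ i)
  (fun i j => if i == j then a i else 0) (fun i => cmod (a i) * r ^+ i) r measurableT r0.
move=> /(_ (fun=> cmeas_nat _) (fun=> cmeas_nat _) ia) H.
have {}H := H (fun i _ => psexp_monomial (a i) i r0).
apply: (eq_psexp (D := fun h => csum (fun j => a j * h%:C ^+ j))).
  by move=> h /Dh.
move=> N h hr; have := H N h hr; congr (cmod (_ - _) <= _).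
apply: eq_bigr => j _; congr (_ * _).
transitivity (csum (fun i => if i == j :> nat then a j else 0)); last exact: csum_delta.
by congr csum; apply/funext => i; case: eqP => // ->.
Qed.

End Expansions.

(** * Expansions of powers, exponentials and Laplace transforms *)

Section BasicExpansions.
Context {R : realType}.
Implicit Types (c h q r s t x : R) (z : R[i]) (g : R -> R[i]).

Local Notation cnt := (@counting nat R).
Local Notation mu := (@lebesgue_measure R).

Lemma psexp_leM D (a : nat -> R[i]) r M M' : 0 < r -> M <= M' ->
  psexp D a r M -> psexp D a r M'.
Proof.
move=> r0 MM H N h hr; apply: le_trans (H N h hr) _.
by rewrite ler_wpM2r// exprn_ge0// divr_ge0// ltW.
Qed.

(** The total mass of the majorising series, which is the bound in psexp_rpow. *)
Lemma sum_rnbin x q : 0 <= x -> 0 <= q < 1 ->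
  \int[cnt]_j (rnbin x j * q ^+ j) = expR (- x * ln (1 - q)).
Proof.
move=> x0 /andP[q0 q1].
have := @binomial_series R x%:C q%:C; rewrite cmodr ger0_norm// => /(_ q1).
rewrite -(rmorph1 (real_complex R)) -rmorphB cpow_pos ?subr_gt0//.
rewrite (_ : - x%:C = (- x)%:C); last by rewrite rmorphN.
rewrite rpowr => H; apply: complexI.
transitivity (csum (fun n => nbin x%:C n * q%:C ^+ n)).
  rewrite -cint_real; congr csum; apply/funext => n.
  by rewrite rmorphM rmorphXn/= rnbin_nbin.
by [].
Qed.

(** Binomial series of c ^ z (1 + h / c) ^ z. The bound is explicit in z since
    a whole series of powers will be expanded at once. *)
Lemma psexp_rpow c q z : 0 < c -> 0 < q < 1 ->
  psexp (fun h => rpow (c + h) z)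
    (fun j => rpow c z * nbin (- z) j * ((- c^-1) ^+ j)%:C) (q * c)
    (2 * (expR (complex.Re z * ln c) * expR (- cmod z * ln (1 - q)))).
Proof.
move=> c0 /andP[q0 q1]; have qc0 : 0 < q * c by rewrite mulr_gt0.
have q01 : 0 <= q < 1 by rewrite (ltW q0).
have le j : cmod (rpow c z * nbin (- z) j * ((- c^-1) ^+ j)%:C) * (q * c) ^+ j <=
    expR (complex.Re z * ln c) * (rnbin (cmod z) j * q ^+ j).
  rewrite !cmodM cmod_rpow (cmodr ((- c^-1) ^+ j)) normrX normrN gtr0_norm ?invr_gt0//.
  rewrite exprMn exprVn.
  rewrite (_ : _ * _ * _ * _ = expR (complex.Re z * ln c) * (cmod (nbin (- z) j) * q ^+ j)).
    rewrite ler_wpM2l ?expR_ge0// ler_wpM2r ?exprn_ge0 ?(ltW q0)//.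
    by apply: cmod_nbin; rewrite cmodN.
  by field; rewrite expf_neq0// gt_eqF.
have irnbin : cnt.-integrable setT (EFin \o (fun j =>
    expR (complex.Re z * ln c) * (rnbin (cmod z) j * q ^+ j))).
  rewrite /comp; under eq_fun do rewrite EFinM; apply: integrableZl => //.
  by apply: rnbin_summable => //; exact: cmod_ge0.
have ia : cnt.-integrable setT (EFin \o (fun j =>
    cmod (rpow c z * nbin (- z) j * ((- c^-1) ^+ j)%:C) * (q * c) ^+ j)).
  apply: le_integrable irnbin => //.
  move=> j _; rewrite /= lee_fin ger0_norm ?mulr_ge0 ?cmod_ge0 ?exprn_ge0 ?(ltW qc0)//.
  by rewrite (le_trans (le j))// ler_norm.
apply: (psexp_leM qc0 _ (psexp_series qc0 ia _)).
  rewrite ler_wpM2l// -sum_rnbin ?cmod_ge0// -RintegralZl//.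
    by apply: le_Rintegral => // j _; exact: le.
  by apply: rnbin_summable => //; exact: cmod_ge0.
move=> h hr; have hc : `|h / c| < 1.
  rewrite normrM normfV (gtr0_norm c0) ltr_pdivrMr// mul1r.
  by rewrite (le_lt_trans hr)// -[ltRHS]mul1r ltr_pM2r.
have p1 : 0 < 1 + h / c by move: hc; rewrite ltr_norml; lra.
have -> : c + h = c * (1 + h / c) by field; rewrite gt_eqF.
rewrite rpowMl// -(cpow_pos z p1) -[z in cpow _ z]opprK.
have -> : (1 + h / c)%:C = 1 - (- (h / c))%:C :> R[i].
  by rewrite rmorphN opprK rmorphD rmorph1.
rewrite -binomial_series; last by rewrite cmodr normrN.
rewrite -cintZ//; last by apply: nbin_summable; rewrite cmodr normrN.
congr csum; apply/funext => j; rewrite -!mulrA; congr (_ * (_ * _)).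
by rewrite -!rmorphXn -rmorphM -exprMn; congr ((_ ^+ _)%:C); rewrite mulNr mulrC.
Qed.

Lemma exp_coeff_summable x : 0 <= x ->
  cnt.-integrable setT (EFin \o exp_coeff x) /\ \int[cnt]_j (exp_coeff x j) = expR x.
Proof.
move=> x0; have e0 n : 0 <= exp_coeff x n by exact: exp_coeff_ge0.
have ie : cnt.-integrable setT (EFin \o exp_coeff x).
  apply: (@integrable_count_ge0 _ _ (expR x)) => // n.
  rewrite -(big_mkord xpredT); apply: (@nondecreasing_cvgn_le _ (series (exp_coeff x))).
    by apply: nondecreasing_series => k _ _; exact: e0.
  exact: is_cvg_series_exp_coeff.
split => //; have := cvg_count ie; rewrite /expR => /(cvg_lim _) <- //.
by congr (limn _); apply/funext => n; rewrite -(big_mkord xpredT).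
Qed.

Lemma sum_exp x : csum (fun j => (exp_coeff x j)%:C) = (expR x)%:C.
Proof.
have [i1 _] := exp_coeff_summable (normr_ge0 x).
have ie : cintble cnt setT (fun j => (exp_coeff x j)%:C).
  apply: cintble_count i1 => n.
  by rewrite cmodr /exp_coeff/= normrM normfV normrX normr_nat.
apply: (ccvg_unique (ccvg_csum ie)); split => /=; last first.
  under eq_fun do rewrite (big_morph _ (@cImD R) (erefl (complex.Im 0))) big1//.
  exact: cvg_cst.
under eq_fun do rewrite (big_morph _ (@cReD R) (erefl (complex.Re 0)))/=.
have := is_cvg_series_exp_coeff x; rewrite /expR.
have <- : (fun n => \sum_(i < n) exp_coeff x i) = series (exp_coeff x).
  by apply/funext => n; rewrite /series/= big_mkord.
by [].
Qed.

Lemma psexp_expR t r : 0 < r ->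
  psexp (fun h => (expR (h * t))%:C) (fun j => (exp_coeff t j)%:C) r
    (2 * expR (r * `|t|)).
Proof.
move=> r0; have rt0 : 0 <= r * `|t| by rewrite mulr_ge0// ltW.
have [ie <-] := exp_coeff_summable rt0.
have E j : cmod (exp_coeff t j)%:C * r ^+ j = exp_coeff (r * `|t|) j.
  rewrite cmodr /exp_coeff/= normrM normfV normrX normr_nat exprMn.
  by rewrite mulrC mulrA.
have -> : exp_coeff (r * `|t|) = (fun j => cmod (exp_coeff t j)%:C * r ^+ j).
  by apply/funext => j; rewrite E.
apply: psexp_series => //.
  by move: ie; congr integrable; apply/funext => j; rewrite /= E.
move=> h hr; rewrite -sum_exp; congr csum; apply/funext => j.
by rewrite -rmorphXn -rmorphM /exp_coeff/= exprMn; congr (_ %:C); ring.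
Qed.

(** The domain X is the open half-line for powers, and the closed one for the
    functions whose Sumudu transform is taken. *)
Definition lap (X : set R) g s : R[i] :=
  cint mu X (fun t => (expR (- (s * t)))%:C * g t).

Lemma cmeas_lap X g s : cmeas X g -> cmeas X (fun t => (expR (- (s * t)))%:C * g t).
Proof.
move=> mg; apply: cmeasM => //; apply: cmeas_real; apply: measurable_funTS.
apply: measurableT_comp => //; apply: measurableT_comp => //.
Qed.

(** Expanding exp (- h t) for |h| <= r costs the factor exp (r t), so that the
    expansion at c holds up to the abscissa c - r of integrability. *)
Lemma psexp_lap X g c r : measurable X -> (forall t, X t -> 0 <= t) -> 0 < r ->
  cmeas X g ->
  mu.-integrable X (fun t => (expR (- ((c - r) * t)) * cmod (g t))%:E) ->
  psexp (fun h => lap X g (c + h))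
    (fun j => lap X (fun t => (exp_coeff (- t) j)%:C * g t) c) r
    (4 * \int[mu]_(t in X) (expR (- ((c - r) * t)) * cmod (g t))).
Proof.
move=> mX X0 r0 mg ig.
have mu1 j : measurable_fun X (fun t => exp_coeff (- t) j).
  by apply: measurable_funM => //; apply: measurable_funX; exact: measurable_funTS.
rewrite (_ : 4 = 2 * 2); last by ring.
rewrite -mulrA -RintegralZl//.
apply: (@psexp_cint _ _ _ mu X (fun t h => (expR (- ((c + h) * t)))%:C * g t)
  (fun t j => (expR (- (c * t)))%:C * ((exp_coeff (- t) j)%:C * g t))) => //.
- by move=> h; exact: cmeas_lap.
- by move=> j; apply: cmeas_lap; apply: cmeasM => //; exact: cmeas_real.
- by rewrite /comp; under eq_fun do rewrite EFinM; exact: integrableZl.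
move=> t Xt; have t0 := X0 t Xt.
have := psexpZ ((expR (- (c * t)))%:C * g t) (psexp_expR (- t) r0).
rewrite normrN (ger0_norm t0) cmodM cmodr ger0_norm ?expR_ge0//.
rewrite (_ : _ * _ * (2 * _) = 2 * (expR (- ((c - r) * t)) * cmod (g t))); last first.
  rewrite (_ : - ((c - r) * t) = - (c * t) + r * t); last by ring.
  by rewrite expRD; ring.
move=> H N h hr; have := H N h hr; congr (cmod (_ - _) <= _).
  rewrite mulrAC -rmorphM -expRD; congr ((expR _)%:C * _); ring.
by apply: eq_bigr => j _; ring.
Qed.

End BasicExpansions.

(** * Substitution of powers *)

Section PowerSubstitution.
Context {R : realType}.
Implicit Types (G : R -> R) (k d t x : R).

Local Notation mu := (@lebesgue_measure R).

Let bigcup_expR k d : 0 < k ->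
  \bigcup_n `[expR (d - k * n%:R), expR (d + k * n%:R)]%classic = `]0, +oo[%classic.
Proof.
move=> k0; apply/seteqP; split => x /=.
  by move=> [n _] /=; rewrite !in_itv/= andbT => /andP[+ _]; apply: lt_le_trans; exact: expR_gt0.
rewrite in_itv/= andbT => x0.
exists (Num.truncn (`|ln x - d| / k)).+1 => //=.
have /ltW := truncnS_gt (`|ln x - d| / k).
rewrite ler_pdivrMr// mulrC ler_norml in_itv/=; set a := k * _ => /andP[h1 h2].
by apply/andP; split; rewrite -ler_ln ?posrE ?expR_gt0// expRK; lra.
Qed.

Section Powers.
Variables (k d : R).
Hypothesis k0 : 0 < k.

Let F t := expR (k * ln t + d).
Let H t := k / t * F t.

Let derF t : 0 < t -> is_derive t 1 F (H t).
Proof.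
move=> t0.
have L : is_derive t 1 (@ln R) t^-1 by exact: is_derive1_ln.
have A := is_derive_affine d k (ln t).
have C := @is_derive1_comp _ expR _ _ _ _ (is_derive_expR _) (is_derive1_comp A L).
rewrite (_ : F = expR \o ((fun x => d + x * k) \o @ln R)); last first.
  by apply/funext => x; rewrite /F/= addrC mulrC.
apply: (is_derive_eq C); rewrite /H /F /= [RHS]mulrC.
by congr (expR _ * _); rewrite addrC mulrC.
Qed.

Let contF t : 0 < t -> {for t, continuous F}.
Proof.
by move=> /derF[+ _]; move=> /derivable1_diffP; exact: differentiable_continuous.
Qed.

Let contH t : 0 < t -> {for t, continuous H}.
Proof.
move=> t0; apply: cvgM; last exact: contF.
by apply: cvgM; [exact: cvg_cst|apply: cvgV; rewrite ?gt_eqF].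
Qed.

Let derF1 t : 0 < t -> derive1 F t = H t.
Proof. by move=> /derF[_]; rewrite derive1E. Qed.

Let cvgF1 t : 0 < t -> derive1 F x @[x --> t] --> H t.
Proof.
move=> t0; apply: cvg_trans (contH t0); apply: near_eq_cvg.
by move: (lt_nbhsr t0); apply: filterS => x x0; rewrite derF1.
Qed.

Let H_ge0 t : 0 < t -> 0 <= H t.
Proof. by move=> t0; rewrite mulr_ge0 ?expR_ge0// divr_ge0// ltW. Qed.

Let measG G : (forall x, 0 < x -> {for x, continuous G}) ->
  measurable_fun (`]0, +oo[%classic : set R) G.
Proof.
move=> cG; apply: subspace_continuous_measurable_fun => //.
by apply: continuous_in_subspaceT => x /[!inE]/= /[!in_itv]/= /[!andbT]; exact: cG.
Qed.

(** The substitution x = e ^ d t ^ k combines a power and a scaling. It is made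
    on compact intervals that exhaust the half-line. *)
Lemma ge0_power_substitution G : (forall x, 0 < x -> {for x, continuous G}) ->
  (forall x, 0 < x -> 0 <= G x) ->
  (\int[mu]_(x in `]0%R, +oo[) (G x)%:E =
   \int[mu]_(t in `]0%R, +oo[)
     (G (expR (k * ln t + d)) * (k / t * expR (k * ln t + d)))%:E)%E.
Proof.
move=> cG G0.
pose U n : set R := `[expR (0 - 1 * n%:R), expR (0 + 1 * n%:R)]%classic.
pose V n : set R := `[expR (d - k * n%:R), expR (d + k * n%:R)]%classic.
have UT : \bigcup_n U n = `]0, +oo[%classic by exact: bigcup_expR.
have VT : \bigcup_n V n = `]0, +oo[%classic by exact: bigcup_expR.
have Upos n x : U n x -> 0 < x.
  by rewrite /U/= in_itv/= => /andP[+ _]; apply: lt_le_trans; exact: expR_gt0.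
have Vpos n x : V n x -> 0 < x.
  by rewrite /V/= in_itv/= => /andP[+ _]; apply: lt_le_trans; exact: expR_gt0.
have nd (b e : R) : 0 < b -> nondecreasing_seq
    (fun n : nat => `[expR (e - b * n%:R), expR (e + b * n%:R)]%classic : set R).
  move=> b0 m n mn; apply/subsetPset => x /=; rewrite !in_itv/= => /andP[x1 x2].
  have bmn : b * m%:R <= b * n%:R by rewrite ler_wpM2l ?ler_nat// ltW.
  apply/andP; split.
    by apply: le_trans x1; rewrite ler_expR lerD2l lerN2.
  by apply: (le_trans x2); rewrite ler_expR lerD2l.
have cGF x : 0 < x -> {for x, continuous (fun t => G (F t) * H t)}.
  move=> x0; apply: cvgM; last exact: contH.
  by apply: continuous_comp; [exact: contF|apply: cG; exact: expR_gt0].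
have step n : (\int[mu]_(x in V n) (G x)%:E = \int[mu]_(t in U n) (G (F t) * H t)%:E)%E.
  have -> : V n = `[F (expR (0 - 1 * n%:R)), F (expR (0 + 1 * n%:R))]%classic.
    by rewrite /V /F !expRK !mul1r sub0r add0r mulrN ![_ + d]addrC.
  rewrite integration_by_substitution_increasing.
  - apply: eq_integral => x; rewrite inE => /Upos x0; congr EFin.
    by rewrite /= -derF1.
  - by rewrite ler_expR; have : 0 <= n%:R :> R by []; lra.
  - move=> x y /[!in_itv]/= /andP[x1 _] /andP[y1 _] xy.
    rewrite /F ltr_expR ltrD2r ltr_pM2l// ltr_ln ?posrE//.
      by apply: lt_le_trans x1; exact: expR_gt0.
    by apply: lt_le_trans y1; exact: expR_gt0.
  - move=> x /[!in_itv]/= /andP[x1 _].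
    have x0 : 0 < x by apply: lt_trans x1; exact: expR_gt0.
    by rewrite /continuous_at derF1//; exact: cvgF1.
  - by apply/cvg_ex; eexists; apply: cvg_at_right_filter; apply: cvgF1; exact: expR_gt0.
  - by apply/cvg_ex; eexists; apply: cvg_at_left_filter; apply: cvgF1; exact: expR_gt0.
  - split.
    + move=> x /[!in_itv]/= /andP[x1 _].
      have x0 : 0 < x by apply: lt_trans x1; exact: expR_gt0.
      by have [] := derF x0.
    + by apply: cvg_at_right_filter; apply: contF; exact: expR_gt0.
    + by apply: cvg_at_left_filter; apply: contF; exact: expR_gt0.
  - apply: continuous_in_subspaceT => x /[!inE]/= /[!in_itv]/= /andP[x1 _].
    by apply: cG; apply: lt_le_trans x1; exact: expR_gt0.
have c1 : (\int[mu]_(x in V n) (G x)%:E @[n --> \oo] -->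
    \int[mu]_(x in \bigcup_n V n) (G x)%:E)%E.
  apply: ge0_nondecreasing_set_cvg_integral => //.
  - exact: nd.
  - by move=> n; exact: measurable_itv.
  - move=> n; apply/measurable_EFinP; apply: measurable_funS (measG cG) => //.
    by rewrite -VT; exact: bigcup_sup.
  - by move=> n x /Vpos x0; rewrite lee_fin G0.
have c2 : (\int[mu]_(x in U n) (G (F x) * H x)%:E @[n --> \oo] -->
    \int[mu]_(x in \bigcup_n U n) (G (F x) * H x)%:E)%E.
  apply: ge0_nondecreasing_set_cvg_integral => //.
  - exact: nd.
  - by move=> n; exact: measurable_itv.
  - move=> n; apply/measurable_EFinP; apply: measurable_funS (measG cGF) => //.
    by rewrite -UT; exact: bigcup_sup.
  - by move=> n x /Upos x0; rewrite lee_fin mulr_ge0 ?G0 ?expR_gt0 ?H_ge0.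
rewrite VT in c1; rewrite UT in c2.
rewrite -(cvg_lim _ c1)// -[RHS](cvg_lim _ c2)//.
by congr (limn _); apply/funext => n; exact: step.
Qed.

Lemma power_substitution G : (forall x, 0 < x -> {for x, continuous G}) ->
  (\int[mu]_(x in `]0%R, +oo[) (G x)%:E =
   \int[mu]_(t in `]0%R, +oo[)
     (G (expR (k * ln t + d)) * (k / t * expR (k * ln t + d)))%:E)%E.
Proof.
move=> cG.
rewrite integralE [RHS]integralE; congr (_ - _)%E.
- transitivity (\int[mu]_(x in `]0%R, +oo[) (Num.max (G x) 0)%:E)%E.
    by apply: eq_integral => x _; rewrite funeposE EFin_max.
  rewrite ge0_power_substitution; last 2 first.
  + by move=> x x0; apply: continuous_max; [exact: cG|exact: cst_continuous].
  + by move=> x _; rewrite le_max lexx orbT.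
  apply: eq_integral => x; rewrite inE/= in_itv/= andbT => x0.
  by rewrite funeposE -EFin_max -/(F x) -/(H x) maxr_pMl ?mul0r// H_ge0.
- transitivity (\int[mu]_(x in `]0%R, +oo[) (Num.max (- G x) 0)%:E)%E.
    by apply: eq_integral => x _; rewrite funenegE EFin_max.
  rewrite ge0_power_substitution; last 2 first.
  + move=> x x0; apply: continuous_max; last exact: cst_continuous.
    by apply: cvgN; exact: cG.
  + by move=> x _; rewrite le_max lexx orbT.
  apply: eq_integral => x; rewrite inE/= in_itv/= andbT => x0.
  by rewrite funenegE -EFinN -EFin_max -/(F x) -/(H x) maxr_pMl ?mul0r ?mulNr// H_ge0.
Qed.

End Powers.

End PowerSubstitution.

(** * The k-gamma function *)

Section KGamma.
Context {R : realType}.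
Implicit Types (k s t x a : R) (z w : R[i]).

Local Notation mu := (@lebesgue_measure R).
Local Notation pos := (`]0%R, +oo[%classic : set R).

Lemma measurable_pos : measurable pos.
Proof. exact: measurable_itv. Qed.
#[local] Hint Resolve measurable_pos : core.

Lemma posE t : t \in pos -> 0 < t.
Proof. by rewrite inE/= in_itv/= andbT. Qed.

Lemma posP t : pos t -> 0 < t.
Proof. by rewrite /= in_itv/= andbT. Qed.

Lemma continuous_expR_at (f : R -> R) x : {for x, continuous f} ->
  {for x, continuous (fun t => expR (f t))}.
Proof. by move=> cf; apply: continuous_comp => //; exact: continuous_expR. Qed.

Lemma continuousM_at (f g : R -> R) x : {for x, continuous f} ->
  {for x, continuous g} -> {for x, continuous (fun t => f t * g t)}.
Proof. by move=> cf cg; exact: (cvgM cf cg). Qed.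

Lemma continuous_ln_at x : 0 < x -> {for x, continuous (@ln R)}.
Proof. exact: continuous_ln. Qed.

Lemma continuous_scale_at (c : R) (f : R -> R) x : {for x, continuous f} ->
  {for x, continuous (fun t => c * f t)}.
Proof. by move=> cf; apply: cvgM => //; exact: cvg_cst. Qed.

Lemma continuous_expRN_at s x : {for x, continuous (fun t => expR (- (s * t)))}.
Proof.
rewrite (_ : (fun t => _) = (fun t => expR (- s * t))); last first.
  by apply/funext => t; rewrite mulNr.
by apply: continuous_expR_at; exact: continuous_scale_at.
Qed.

Lemma continuous_Re_rpow z x : 0 < x -> {for x, continuous (fun t => complex.Re (rpow t z))}.
Proof.
move=> x0.
rewrite (_ : (fun t => _) = (fun t => expR (complex.Re z * ln t) * cos (complex.Im z * ln t))).
  apply: continuousM_at.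
    by apply: continuous_expR_at; apply: continuous_scale_at; exact: continuous_ln_at.
  apply: continuous_comp; last exact: continuous_cos.
  by apply: continuous_scale_at; exact: continuous_ln_at.
by apply/funext => t; rewrite rpowE /cexp cReM cReMr cImMr/=; ring.
Qed.

Lemma continuous_Im_rpow z x : 0 < x -> {for x, continuous (fun t => complex.Im (rpow t z))}.
Proof.
move=> x0.
rewrite (_ : (fun t => _) = (fun t => expR (complex.Re z * ln t) * sin (complex.Im z * ln t))).
  apply: continuousM_at.
    by apply: continuous_expR_at; apply: continuous_scale_at; exact: continuous_ln_at.
  apply: continuous_comp; last exact: continuous_sin.
  by apply: continuous_scale_at; exact: continuous_ln_at.
by apply/funext => t; rewrite rpowE /cexp cImM cReMr cImMr/=; ring.
Qed.

Lemma measurable_lnM (c : R) D : measurable_fun D (fun t => expR (c * ln t)).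
Proof.
apply: measurable_funTS; apply: measurableT_comp => //.
by apply: measurableT_comp => //; exact: measurable_ln.
Qed.

(** The exponential of t ^ (1 / a) grows faster than any power of t, which
    allows a comparison with 1 / (1 + t ^ 2). *)
Let integrable_expR_root s a : 0 < s -> 0 < a ->
  mu.-integrable pos (EFin \o (fun t => expR (- (s * expR (a^-1 * ln t + 0))))).
Proof.
move=> s0 a0.
(* Beyond 1, y ^ N dominates t ^ 2 for y = s t ^ (1 / a); C bounds both parts. *)
pose N := (Num.truncn (2 * a)).+1.
have N2 : 2 <= N%:R / a by rewrite ler_pdivlMr// ltW// truncnS_gt.
pose C : R := 2 + 2 * N`!%:R / s ^+ N.
have C0 : 0 <= C by rewrite addr_ge0// divr_ge0 ?mulr_ge0// exprn_ge0// ltW.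
have i0 : mu.-integrable (`[0%R, +oo[%classic : set R)
    (fun t : R => ((oneDsqr t)^-1)%:E).
  apply/integrableP; split.
    apply/measurable_EFinP; apply: measurable_funTS.
    by apply: continuous_measurable_fun; exact: continuous_oneDsqrV.
  under eq_integral do rewrite /= ger0_norm ?invr_ge0 ?oneDsqr_ge0//.
  by rewrite integral0y_oneDsqr ltry.
have i1 : mu.-integrable pos (fun t : R => C%:E * ((oneDsqr t)^-1)%:E)%E.
  apply: integrableZl => //; apply: integrableS i0 => //.
  by apply: subset_itvr; rewrite bnd_simp.
apply: le_integrable i1 => //.
  apply/measurable_EFinP; apply: measurable_funTS; apply: measurableT_comp => //.
  apply: measurableT_comp => //; apply: measurableT_comp => //.
  by apply: measurableT_comp => //; under eq_fun do rewrite addr0; apply: measurableT_comp => //; exact: measurable_ln.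
move=> t /posP t0; rewrite /= lee_fin ger0_norm ?expR_ge0// ger0_norm; last first.
  by rewrite mulr_ge0// invr_ge0 oneDsqr_ge0.
rewrite addr0 /oneDsqr ler_pdivlMr ?ltr_pwDl ?sqr_ge0//.
have [t1|t1] := leP t 1.
  apply: (@le_trans _ _ (1 * 2)); last first.
    by rewrite mul1r /C lerDl divr_ge0 ?mulr_ge0// exprn_ge0// ltW.
  apply: ler_pM; rewrite ?expR_ge0 ?addr_ge0 ?sqr_ge0//.
    by rewrite -expR0 ler_expR oppr_le0 mulr_ge0 ?expR_ge0// ltW.
  by rewrite (_ : 2 = 1 + 1)// lerD2l expr_le1// ltW.
pose y := s * expR (a^-1 * ln t).
have y0 : 0 < y by rewrite mulr_gt0 ?expR_gt0.
have yN : y ^+ N / N`!%:R <= expR y.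
  by apply: le_trans (expR_ge1Dxn (Num.truncn (2 * a)) (ltW y0)); rewrite lerDr.
have tN : s ^+ N * t ^+ 2 <= y ^+ N.
  rewrite exprMn ler_wpM2l ?exprn_ge0 ?(ltW s0)// -expRM_natl.
  rewrite -[t in leLHS]lnK ?posrE// -expRM_natl ler_expR mulrA ler_wpM2r ?ln_ge0 ?(ltW t1)//.
rewrite -/y expRN mulrC ler_pdivrMr ?expR_gt0//.
apply: (@le_trans _ _ (2 * t ^+ 2)).
  by rewrite mulr2n mulrDl mul1r lerD2r exprn_ege1// ltW.
apply: (@le_trans _ _ (2 * N`!%:R / s ^+ N * expR y)); last first.
  by rewrite ler_wpM2r ?expR_ge0// /C lerDr.
have -> : 2 * t ^+ 2 = 2 / s ^+ N * (s ^+ N * t ^+ 2).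
  by field; rewrite expf_neq0// gt_eqF.
rewrite (_ : 2 * N`!%:R / s ^+ N * expR y = 2 / s ^+ N * (N`!%:R * expR y)); last by ring.
rewrite ler_wpM2l ?divr_ge0 ?exprn_ge0 ?(ltW s0)// (le_trans tN)//.
by rewrite mulrC -ler_pdivrMr// ltr0n fact_gt0.
Qed.

(** The substitution of t ^ (1 / a) for x removes the power of x. *)
Lemma integrable_expR_power s a : 0 < s -> 0 < a ->
  mu.-integrable pos (EFin \o (fun x => expR (- (s * x)) * expR ((a - 1) * ln x))).
Proof.
move=> s0 a0; have a1 : 0 < a^-1 by rewrite invr_gt0.
have /integrableP[_ fin] := integrable_expR_root s0 a0.
apply/integrableP; split.
  apply/measurable_EFinP; apply: measurable_funM; last exact: measurable_lnM.
  by apply: measurable_funTS; apply: measurableT_comp => //; apply: measurableT_comp.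
under eq_integral do rewrite /= ger0_norm ?mulr_ge0 ?expR_ge0//.
rewrite (ge0_power_substitution 0 a1); last 2 first.
- move=> x x0; apply: continuousM_at.
    exact: continuous_expRN_at.
  by apply: continuous_expR_at; apply: continuous_scale_at; exact: continuous_ln_at.
- by move=> x _; rewrite mulr_ge0 ?expR_ge0.
set I := (X in (X < _)%E).
have -> : I = (\int[mu]_(t in pos) ((a^-1)%:E *
    `|(expR (- (s * expR (a^-1 * ln t + 0))))%:E|))%E; last first.
  rewrite ge0_integralZl//; last 2 first.
  + by apply: measurableT_comp => //; exact: measurable_int (integrable_expR_root s0 a0).
  + by rewrite lee_fin ltW.
  by rewrite lte_mul_pinfty// lee_fin ltW.
apply: eq_integral.
move=> t /posE t0; rewrite /= ger0_norm ?expR_ge0// -EFinM; congr EFin.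
rewrite !addr0 expRK -[in t^-1](lnK t0) -expRN.
rewrite (_ : expR _ * expR _ * _ = a^-1 * (expR (- (s * expR (a^-1 * ln t))) *
  (expR ((a - 1) * (a^-1 * ln t)) * expR (- ln t) * expR (a^-1 * ln t)))); last by ring.
have -> : expR ((a - 1) * (a^-1 * ln t)) * expR (- ln t) * expR (a^-1 * ln t) = 1.
  rewrite -!expRD -[RHS]expR0; congr expR.
  by field; rewrite gt_eqF.
by rewrite mulr1.
Qed.

(** The factor exp (- t ^ k / k) of the k-gamma integral. *)
Definition weight k t := expR (- (expR (k * ln t) / k)).

(** The k-gamma function on the positive reals. *)
Definition rGamma k a : R := \int[mu]_(t in pos) (weight k t * expR ((a - 1) * ln t)).

Lemma measurable_weight k D : measurable_fun D (weight k).
Proof.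
apply: measurable_funTS; apply: measurableT_comp => //; apply: measurableT_comp => //.
by apply: measurable_funM => //; apply: measurable_lnM.
Qed.

(** The substitution of t ^ k for x turns the previous case into this one. *)
Lemma integrable_weight k a : 0 < k -> 0 < a ->
  mu.-integrable pos (EFin \o (fun t => weight k t * expR ((a - 1) * ln t))).
Proof.
move=> k0 a0; have kV : 0 < k^-1 by rewrite invr_gt0.
have ak : 0 < a / k by rewrite divr_gt0.
have mw : measurable_fun pos (fun t => weight k t * expR ((a - 1) * ln t)).
  by apply: measurable_funM; [exact: measurable_weight|exact: measurable_lnM].
have /integrableP[_] := integrable_expR_power kV ak.
under eq_integral do rewrite /= ger0_norm ?mulr_ge0 ?expR_ge0//.
rewrite (ge0_power_substitution 0 k0); last 2 first.
- move=> x x0; apply: continuousM_at; first exact: continuous_expRN_at.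
  by apply: continuous_expR_at; apply: continuous_scale_at; exact: continuous_ln_at.
- by move=> x _; rewrite mulr_ge0 ?expR_ge0.
set I := (X in (X < _)%E).
have -> : I = (\int[mu]_(t in pos)
    (k%:E * (weight k t * expR ((a - 1) * ln t))%:E))%E.
  apply: eq_integral => t /posE t0; rewrite -EFinM; congr EFin.
  rewrite !addr0 expRK /weight -[in t^-1](lnK t0) -expRN (mulrC k^-1).
  have E : expR ((a / k - 1) * (k * ln t)) * expR (- ln t) * expR (k * ln t) =
      expR ((a - 1) * ln t).
    rewrite -!expRD; congr expR.
    by field; rewrite gt_eqF.
  by rewrite -E; ring.
rewrite ge0_integralZl//; last 3 first.
- exact/measurable_EFinP.
- by move=> t _; rewrite lee_fin mulr_ge0 ?expR_ge0.
- by rewrite lee_fin ltW.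
move=> fin; apply/integrableP; split; first exact/measurable_EFinP.
under eq_integral do rewrite /= ger0_norm ?mulr_ge0 ?expR_ge0//.
rewrite ltey; apply: contraTneq fin => ->.
by rewrite gt0_muley ?lte_fin.
Qed.

Lemma kGammaE k z :
  kGamma k z = cint mu pos (fun t => (weight k t)%:C * rpow t (z - 1)).
Proof.
have e t : 0 < t -> t `^ k = expR (k * ln t) by move=> t0; rewrite /powR gt_eqF.
apply: eq_cint => t /posE t0; rewrite /weight -(e _ t0) -(cpow_pos _ t0).
by [].
Qed.

Lemma cmod_weight k z t :
  cmod ((weight k t)%:C * rpow t z) = weight k t * expR (complex.Re z * ln t).
Proof. by rewrite cmodM cmodr cmod_rpow ger0_norm ?expR_ge0. Qed.

Lemma cmeas_weight k z D : cmeas D (fun t => (weight k t)%:C * rpow t z).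
Proof.
apply: cmeasM; last exact: cmeas_rpow.
by apply: cmeas_real; exact: measurable_weight.
Qed.

Lemma cintble_kGamma k z : 0 < k -> 0 < complex.Re z ->
  cintble mu pos (fun t => (weight k t)%:C * rpow t (z - 1)).
Proof.
move=> k0 z0; apply: (cintble_le _ _ (integrable_weight k0 z0)) => //.
  exact: cmeas_weight.
by move=> t _; rewrite cmod_weight cReD cReN.
Qed.

Lemma kGamma_real k a : kGamma k a%:C = (rGamma k a)%:C.
Proof.
rewrite kGammaE /rGamma -cint_real; apply: eq_cint => t _.
by rewrite -(rmorph1 (real_complex R)) -rmorphB rpowr -rmorphM.
Qed.

Lemma cmeas_power z D : cmeas D (fun x => rpow x z).
Proof. exact: cmeas_rpow. Qed.

Lemma integrable_lap_power s z : 0 < s -> 0 < complex.Re z ->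
  mu.-integrable pos (fun x => (expR (- (s * x)) * cmod (rpow x (z - 1)))%:E).
Proof.
move=> s0 z0; have := integrable_expR_power s0 z0.
by apply: eq_integrable => // x _; rewrite /= cmod_rpow cReD cReN.
Qed.

Lemma cintble_lap_power s z : 0 < s -> 0 < complex.Re z ->
  cintble mu pos (fun x => (expR (- (s * x)))%:C * rpow x (z - 1)).
Proof.
move=> s0 z0; apply: (@cintble_le _ _ _ mu _ _ _ measurable_pos
  (cmeas_lap s (cmeas_power _ _)) (integrable_lap_power s0 z0)).
by move=> x _; rewrite cmodM cmodr ger0_norm ?expR_ge0.
Qed.

(** The substitution s x = t ^ k / k. *)
Lemma lap_power k s z : 0 < k -> 0 < s -> 0 < complex.Re z ->
  lap pos (fun x => rpow x (z / k%:C - 1)) s =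
  k%:C * rpow (s * k) (- (z / k%:C)) * kGamma k z.
Proof.
move=> k0 s0 z0; have sk0 : 0 < s * k by rewrite mulr_gt0.
rewrite kGammaE -cintZ//; last exact: cintble_kGamma.
pose G (x : R) : R[i] := (expR (- (s * x)))%:C * rpow x (z / k%:C - 1).
pose d := - ln (s * k).
have E t : 0 < t -> G (expR (k * ln t + d)) * (k / t * expR (k * ln t + d))%:C =
    k%:C * rpow (s * k) (- (z / k%:C)) * ((weight k t)%:C * rpow t (z - 1)).
  move=> t0; rewrite /G /weight.
  have -> : s * expR (k * ln t + d) = expR (k * ln t) / k.
    rewrite expRD /d expRN lnK ?posrE//; field.
    by rewrite !gt_eqF.
  have tE : (k / t * expR (k * ln t + d))%:C = k%:C * rpow (expR (k * ln t + d)) 1 * rpow t (- 1).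
    rewrite rpowN !rpow1 ?expR_gt0// -fmorphV -!rmorphM; congr (_ %:C); ring.
  have core : rpow (expR (k * ln t + d)) (z / k%:C - 1) *
      rpow (expR (k * ln t + d)) 1 * rpow t (- 1) =
      rpow (s * k) (- (z / k%:C)) * rpow t (z - 1).
    rewrite !rpowE -!cexpD; congr cexp; rewrite expRK rmorphD rmorphM.
    have kC : k%:C != 0 by rewrite (inj_eq (@complexI R)) gt_eqF.
    by rewrite /d rmorphN/=; field.
  rewrite tE; set w := (expR (- (_ / _)))%:C; set r := rpow _ (z / k%:C - 1) in core *.
  transitivity (k%:C * w * (r * rpow (expR (k * ln t + d)) 1 * rpow t (- 1))); first by ring.
  by rewrite core; ring.
have S (P : R[i] -> R) (PG : forall x, 0 < x -> {for x, continuous (fun t => P (G t))})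
    (PM : forall w y, P (w * y%:C) = P w * y) :
  \int[mu]_(t in pos) P (G t) = \int[mu]_(t in pos)
    P (k%:C * rpow (s * k) (- (z / k%:C)) * ((weight k t)%:C * rpow t (z - 1))).
  rewrite /Rintegral (power_substitution d k0)//; congr fine; apply: eq_integral => t /posE t0.
  by rewrite -PM E.
have cG x : 0 < x -> {for x, continuous (fun t => expR (- (s * t)) *
    complex.Re (rpow t (z / k%:C - 1)))}.
  move=> x0; apply: continuousM_at; first exact: continuous_expRN_at.
  exact: continuous_Re_rpow.
have cG' x : 0 < x -> {for x, continuous (fun t => expR (- (s * t)) *
    complex.Im (rpow t (z / k%:C - 1)))}.
  move=> x0; apply: continuousM_at; first exact: continuous_expRN_at.
  exact: continuous_Im_rpow.
apply: complexP => /=.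
- apply: (S (@complex.Re R)); last exact: cReMr.
  move=> x x0; rewrite (_ : (fun t => _) = (fun t => expR (- (s * t)) *
    complex.Re (rpow t (z / k%:C - 1)))); first exact: cG.
  by apply/funext => t; rewrite /G mulrC cReMr mulrC.
- apply: (S (@complex.Im R)); last exact: cImMr.
  move=> x x0; rewrite (_ : (fun t => _) = (fun t => expR (- (s * t)) *
    complex.Im (rpow t (z / k%:C - 1)))); first exact: cG'.
  by apply/funext => t; rewrite /G mulrC cImMr mulrC.
Qed.

Lemma integral_expR_power k s a : 0 < k -> 0 < s -> 0 < a ->
  \int[mu]_(x in pos) (expR (- (s * x)) * expR ((a / k - 1) * ln x)) =
  k * expR (- (a / k) * ln (s * k)) * rGamma k a.
Proof.
move=> k0 s0 a0; apply: complexI.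
have e1 : a%:C / k%:C = (a / k)%:C by rewrite fmorph_div.
have := @lap_power k s a%:C k0 s0 a0; rewrite kGamma_real e1.
have -> : - (a / k)%:C = (- (a / k))%:C by rewrite rmorphN.
rewrite rpowr -!rmorphM => <-; rewrite -cint_real; apply: eq_cint => x _.
have -> : (a / k)%:C - 1 = (a / k - 1)%:C by rewrite rmorphB rmorph1.
by rewrite rpowr -rmorphM.
Qed.

(** The Laplace transform of t ^ (z / k - 1) is a multiple of s ^ (- z / k), and
    its derivative is the transform of the function multiplied by - t. The
    functional equation compares the coefficients of order 1 in two expansions
    of this transform at s = 1 / k. *)
Lemma kGammaS k z : 0 < k -> 0 < complex.Re z ->
  kGamma k (z + k%:C) = z * kGamma k z.
Proof.
move=> k0 z0; have kC : k%:C != 0 by rewrite (inj_eq (@complexI R)) gt_eqF.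
pose c := k^-1; have c0 : 0 < c by rewrite invr_gt0.
have ck : c * k = 1 by rewrite mulVf// gt_eqF.
have hc0 : 0 < 2^-1 * c by rewrite mulr_gt0.
have zk0 : 0 < complex.Re (z / k%:C) by rewrite -fmorphV cReMr divr_gt0.
have zk1 : 0 < complex.Re (z + k%:C) by rewrite cReD addr_gt0.
have I1 : mu.-integrable pos
    (fun t => (expR (- ((c - 2^-1 * c) * t)) * cmod (rpow t (z / k%:C - 1)))%:E).
  apply: integrable_lap_power => //; rewrite -{1}[c]mul1r -mulrBl.
  by rewrite mulr_gt0//; lra.
have H1 := psexp_lap measurable_pos (fun t pt => ltW (posP pt)) hc0
  (cmeas_power _ _) I1.
have h01 : 0 < (2^-1 : R) < 1 by apply/andP; split; lra.
have H2 := psexpZ (k%:C * kGamma k z * rpow k (- (z / k%:C)))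
  (psexp_rpow (- (z / k%:C)) c0 h01).
have ext h : `|h| <= 2^-1 * c -> k%:C * kGamma k z * rpow k (- (z / k%:C)) *
    rpow (c + h) (- (z / k%:C)) = lap pos (fun x => rpow x (z / k%:C - 1)) (c + h).
  move=> hr; have ch : 0 < c + h by move: hr; rewrite ler_norml; lra.
  rewrite lap_power// rpowMl//; ring.
have := psexp_unique hc0 H1 (eq_psexp ext H2) 1.
rewrite /nbin big_ord1 opprK addr0 divr1 expr1 rmorphN/= => E.
have L1 : lap pos (fun t => (exp_coeff (- t) 1)%:C * rpow t (z / k%:C - 1)) c =
    - (k%:C * kGamma k (z + k%:C)).
  transitivity (lap pos (fun t => -1 * rpow t ((z + k%:C) / k%:C - 1)) c).
    apply: eq_cint => t /posE t0; congr (_ * _).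
    rewrite mulrDl divff// -addrAC [rpow t (_ + 1)]rpowD rpow1//.
    by rewrite /exp_coeff/= expr1 factS fact0 divr1 rmorphN; ring.
  rewrite /lap; under eq_cint do rewrite mulrCA.
  rewrite cintZ//; last first.
    by apply: cintble_lap_power => //; rewrite -fmorphV cReMr divr_gt0.
  rewrite -/(lap _ _ _) lap_power// ck mulN1r.
  by rewrite rpowE ln1 mulr0 cexp0 mulr1.
move: E; rewrite L1 => E.
have kk : rpow k (- (z / k%:C)) * rpow c (- (z / k%:C)) = 1.
  by rewrite -rpowMl// mulrC ck rpowE ln1 mulr0 cexp0.
apply: (mulfI kC); apply: oppr_inj; rewrite E /c invrK.
rewrite (_ : _ * _ = (rpow k (- (z / k%:C)) * rpow k^-1 (- (z / k%:C))) *
  (- (k%:C * kGamma k z * (z / k%:C) * k%:C))); last by ring.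
by rewrite kk mul1r; field.
Qed.

Lemma rGammaS k a : 0 < k -> 0 < a -> rGamma k (a + k) = a * rGamma k a.
Proof.
move=> k0 a0; apply: complexI; rewrite rmorphM/= -!kGamma_real rmorphD.
exact: kGammaS.
Qed.

End KGamma.

(** * Lower bound for the k-gamma function *)

Section GammaLowerBound.
Context {R : realType}.
Implicit Types (k t x y a : R) (z : R[i]).

Local Notation mu := (@lebesgue_measure R).
Local Notation pos := (`]0%R, +oo[%classic : set R).
#[local] Hint Resolve measurable_pos : core.

Lemma cos_ge t : 1 - t ^+ 2 <= cos t.
Proof.
wlog t0 : t / 0 < t => [H|].
  have [|t0|<-] := ltgtP 0 t; first exact: H.
    by rewrite -cosN -sqrrN H// oppr_gt0.
  by rewrite cos0 expr0n subr0.
have cs (x : R) : {for x, continuous (@sin R)} by exact: continuous_sin.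
have cc (x : R) : {for x, continuous (@cos R)} by exact: continuous_cos.
have [c] : exists2 c, c \in `]0, t[ & cos t - cos 0 = - sin c * (t - 0).
  apply: (@MVT R (@cos R) (fun x => - sin x)) => //.
  by apply: continuous_subspaceT => x; exact: cc.
rewrite in_itv/= => /andP[c0 ct]; rewrite subr0 cos0 => E.
have [e _] : exists2 e, e \in `]0, c[ & sin c - sin 0 = cos e * (c - 0).
  apply: (@MVT R (@sin R) (@cos R)) => //.
  by apply: continuous_subspaceT => x; exact: cs.
rewrite subr0 sin0 subr0 => E2.
have sc : sin c <= t by rewrite E2; have := cos_le1 e; nra.
have : cos t = 1 - sin c * t by lra.
by move=> ->; rewrite lerD2l lerN2 expr2 ler_wpM2r// ltW.
Qed.

(** The right-hand side is 16 sinh (v / 2) ^ 2. It expresses a square in terms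
    of exponentials, hence of shifted powers of t in the k-gamma integral. *)
Lemma sqr_le_expR (v : R) : v ^+ 2 <= 4 * (expR v - 2 + expR (- v)).
Proof.
wlog v0 : v / 0 <= v => [H|].
  have [|v0] := leP 0 v; first exact: H.
  have := H (- v); rewrite sqrrN opprK => H'.
  by apply: (le_trans (H' _)); [rewrite oppr_ge0 ltW|rewrite ler_wpM2l//; lra].
pose w := v / 2; have w0 : 0 <= w by rewrite divr_ge0.
have vE : v = w + w by rewrite /w; lra.
have E1 := expR_ge1Dx w.
have E2 : expR (- w) <= 1 by rewrite expR_le1 oppr_le0.
have E3 : expR (- w) * expR w = 1 by rewrite -expRD addNr expR0.
rewrite vE (opprD w w) !expRD; move: E1 E2 E3 (expR_gt0 (- w)).
set e := expR w; set f := expR (- w) => E1 E2 E3 f0.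
have -> : e * e - 2 + f * f = (e - f) ^+ 2 by rewrite sqrrB expr2 [e * f]mulrC E3; ring.
have : w <= e - f by lra.
by move=> H; rewrite !expr2; nra.
Qed.

(** The part of the integral over [Y, Y + 1]. As Y is arbitrary, k-gamma grows
    faster than any geometric sequence. *)
Lemma rGamma_ge k a Y : 0 < k -> 0 < a -> 0 < Y ->
  weight k (Y + 1) / (Y + 1) * expR (a * ln Y) <= rGamma k a.
Proof.
move=> k0 a0 Y0; have Y1 : 0 < Y + 1 by rewrite addr_gt0.
pose J : set R := `[Y, Y + 1]%classic.
have mJ : measurable J by exact: measurable_itv.
have JY t : J t -> Y <= t <= Y + 1 by rewrite /J/= in_itv.
have Jpos : J `<=` pos.
  by move=> t /JY/andP[Yt _]; rewrite /= in_itv/= andbT (lt_le_trans Y0).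
have muJ : mu J = 1%:E.
  rewrite /J lebesgue_measure_itv/= lte_fin ltrDl ltr01 -EFinB.
  by congr EFin; ring.
have muJoo : (mu J < +oo)%E by rewrite muJ ltry.
have iw := integrable_weight k0 a0.
have iwJ : mu.-integrable J (EFin \o (fun t => weight k t * expR ((a - 1) * ln t))).
  exact: (@integrableS _ _ _ mu pos J _ measurable_pos mJ Jpos iw).
apply: (@le_trans _ _ (\int[mu]_(t in J) (weight k t * expR ((a - 1) * ln t)))).
  have <- : \int[mu]_(t in J) (weight k (Y + 1) / (Y + 1) * expR (a * ln Y)) =
      weight k (Y + 1) / (Y + 1) * expR (a * ln Y).
    have := @Rintegral_cst _ _ _ mu J mJ (weight k (Y + 1) / (Y + 1) * expR (a * ln Y)).
    by rewrite (congr1 fine muJ : fine _ = 1) mulr1.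
  apply: le_Rintegral => //.
    apply: (@measurable_bounded_integrable _ _ _ mu) => //.
    exact: bounded_cst.
  move=> t /JY/andP[Yt tY]; have t0 := lt_le_trans Y0 Yt.
  rewrite -mulrA mulrDl mulN1r expRD expRN lnK ?posrE// [_^-1 * _]mulrC.
  apply: ler_pM; rewrite ?expR_ge0 ?mulr_ge0 ?invr_ge0 ?(ltW Y1)//.
    rewrite /weight ler_expR lerN2 ler_wpM2r ?invr_ge0 ?(ltW k0)// ler_expR ler_wpM2l ?(ltW k0)//.
    by rewrite ler_ln ?posrE.
  apply: ler_pM; rewrite ?expR_ge0 ?invr_ge0 ?(ltW Y1)//.
    by rewrite ler_expR ler_wpM2l ?(ltW a0)// ler_ln ?posrE.
  by rewrite lef_pV2 ?posrE.
rewrite /rGamma /Rintegral; apply: fine_le.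
- exact: integrable_fin_num.
- exact: integrable_fin_num.
apply: ge0_subset_integral => //; first exact: measurable_int iw.
by move=> t _; rewrite lee_fin mulr_ge0 ?expR_ge0.
Qed.

Lemma rGamma_gt0 k a : 0 < k -> 0 < a -> 0 < rGamma k a.
Proof.
move=> k0 a0; apply: lt_le_trans (rGamma_ge k0 a0 (@ltr01 R)).
by rewrite mulr_gt0 ?expR_gt0// divr_gt0 ?expR_gt0// addr_gt0.
Qed.

(** The measure with density weight k t * t ^ (a - 1) has its mass where t ^ k
    is close to a, and there t ^ (i y) is close to the constant a ^ (i y / k).
    The deviation is controlled by the moments of t ^ k and t ^ (- k), which
    the functional equation provides. *)
Lemma kGamma_concentration k a y : 0 < k -> k < a ->
  rGamma k a * (1 - 4 * y ^+ 2 / (k * (a - k))) <= cmod (kGamma k (a +i* y)).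
Proof.
move=> k0 ka; have a0 := lt_trans k0 ka; have ak0 : 0 < a - k by rewrite subr_gt0.
pose c := cexp (0 +i* (- (y / k * ln a))).
have -> : cmod (kGamma k (a +i* y)) = cmod (c * kGamma k (a +i* y)).
  by rewrite cmodM cmod_cexp/= expR0 mul1r.
rewrite kGammaE -cintZ//; last by apply: cintble_kGamma.
apply: le_trans (le_trans (ler_norm _) (Re_le_cmod _)); rewrite /cint/=.
pose W b t := weight k t * expR ((b - 1) * ln t).
have iW b : 0 < b -> mu.-integrable pos (EFin \o W b) by move=> b0; exact: integrable_weight.
have iZ (r b : R) : 0 < b -> mu.-integrable pos (EFin \o (fun t => r * W b t)).
  by move=> b0; exact: (@integrableZl _ _ _ mu pos measurable_pos r _ (iW b b0)).
pose K := 4 * (y / k) ^+ 2.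
have ak1 : 0 < a + k by rewrite addr_gt0.
pose P t := W a t - (K / a * W (a + k) t - 2 * K * W a t + K * a * W (a - k) t).
have i1 : mu.-integrable pos (EFin \o (fun t => K / a * W (a + k) t - 2 * K * W a t)).
  by apply: (@integrableB _ _ _ mu pos measurable_pos _ _ (iZ _ _ _) (iZ _ _ _)).
have i2 : mu.-integrable pos
    (EFin \o (fun t => K / a * W (a + k) t - 2 * K * W a t + K * a * W (a - k) t)).
  by apply: (@integrableD _ _ _ mu pos measurable_pos _ _ i1 (iZ _ _ _)).
have iP : mu.-integrable pos (EFin \o P).
  exact: (@integrableB _ _ _ mu pos measurable_pos _ _ (iW _ a0) i2).
have -> : rGamma k a * (1 - 4 * y ^+ 2 / (k * (a - k))) = \int[mu]_(t in pos) P t.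
  rewrite /P RintegralB//; last exact: iW.
  rewrite RintegralD//; [|exact: iZ]; rewrite RintegralB//; [|exact: iZ|exact: iZ].
  rewrite !RintegralZl//; [|exact: iW|exact: iW|exact: iW].
  rewrite -![\int[mu]_(x in _) W _ x]/(rGamma k _).
  have e1 : rGamma k a = (a - k) * rGamma k (a - k) by rewrite -(rGammaS k0 ak0) subrK.
  rewrite rGammaS// e1 /K; move: (rGamma k (a - k)) => g; field.
  by rewrite !gt_eqF.
have [j1 _] : cintble mu pos (fun t => c * ((weight k t)%:C * rpow t ((a +i* y) - 1))).
  by apply: cintbleZ => //; exact: cintble_kGamma.
apply: le_Rintegral => // t /posP t0.
have -> : complex.Re (c * ((weight k t)%:C * rpow t ((a +i* y) - 1))) =
    W a t * cos (y / k * (k * ln t - ln a)).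
  rewrite mulrCA cReM/= mul0r subr0 /W -mulrA; congr (_ * _).
  have cexpE z : complex.Re (cexp z) = expR (complex.Re z) * cos (complex.Im z).
    by rewrite /cexp cReM/= mul0r subr0.
  rewrite rpowE -cexpD cexpE cReD cImD cReMr cImMr/= add0r subr0.
  by congr (_ * cos _); field; rewrite gt_eqF.
set v := k * ln t - ln a.
have Wp : W (a + k) t = W a t * (a * expR v).
  rewrite /W /v expRD expRN lnK ?posrE// -mulrA -[in LHS]addrA.
  rewrite (_ : (a + (k - 1)) = (a - 1) + k); last by ring.
  by rewrite mulrDl expRD; field; rewrite gt_eqF.
have Wm : W (a - k) t = W a t * (a^-1 * expR (- v)).
  rewrite /W /v opprB expRD expRN lnK ?posrE// -mulrA.
  rewrite (_ : (a - k - 1) = (a - 1) - k); last by ring.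
  by rewrite mulrBl expRD expRN; field; rewrite !gt_eqF// expR_gt0.
have -> : P t = W a t * (1 - (y / k) ^+ 2 * (4 * (expR v - 2 + expR (- v)))).
  by rewrite /P Wp Wm /K; field; rewrite !gt_eqF.
rewrite ler_wpM2l ?mulr_ge0 ?expR_ge0//; apply: le_trans (cos_ge _).
by rewrite lerD2l lerN2 exprMn ler_wpM2l ?sqr_ge0// sqr_le_expR.
Qed.

(** One use of the functional equation costs |z| / Re z, and
    |z| / x = sqrt (1 + y ^ 2 / x ^ 2) <= exp (y ^ 2 / (2 x ^ 2)). *)
Let kGamma_step k z (B : R) : 0 < k -> 0 < complex.Re z ->
  rGamma k (complex.Re z + k) <= B * cmod (kGamma k (z + k%:C)) ->
  rGamma k (complex.Re z) <=
  B * expR (complex.Im z ^+ 2 / (2 * complex.Re z ^+ 2)) * cmod (kGamma k z).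
Proof.
move=> k0; set x := complex.Re z; set y := complex.Im z => x0.
rewrite (rGammaS k0 x0) (kGammaS k0 x0) cmodM => H.
have G0 := rGamma_gt0 k0 x0.
have g0 := cmod_ge0 (kGamma k z); have z0 := cmod_ge0 z.
have B0 : 0 <= B.
  have : 0 < B * (cmod z * cmod (kGamma k z)) by apply: lt_le_trans H; rewrite mulr_gt0.
  by apply: contraTT; rewrite -ltNge -leNgt => B0; rewrite nmulr_rle0// mulr_ge0.
have zx : cmod z <= x * expR (y ^+ 2 / (2 * x ^+ 2)).
  rewrite -ler_sqr ?nnegrE ?mulr_ge0 ?expR_ge0 ?(ltW x0)// exprMn -expRM_natl.
  rewrite cmodE sqr_sqrtr ?addr_ge0 ?sqr_ge0// -/x -/y.
  rewrite (_ : 2%:R * _ = y ^+ 2 / x ^+ 2); last by field; rewrite gt_eqF.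
  apply: le_trans (ler_wpM2l (sqr_ge0 x) (expR_ge1Dx _)).
  by rewrite mulrDr mulr1 mulrCA divff ?mulr1// expf_neq0// gt_eqF.
rewrite -(ler_pM2l x0); apply: (le_trans H).
rewrite (_ : x * _ = B * ((x * expR (y ^+ 2 / (2 * x ^+ 2))) * cmod (kGamma k z))); last by ring.
by rewrite ler_wpM2l// ler_wpM2r.
Qed.

(** The exponents y ^ 2 / (2 (x + j k) ^ 2) of the N steps are summed by
    comparison with a telescoping series, since
    1 / (k (x - k)) - 1 / (k x) = 1 / (x (x - k)) >= 1 / x ^ 2. *)
Let kGamma_descent k z (B : R) N : 0 < k -> k < complex.Re z ->
  rGamma k (complex.Re z + N%:R * k) <= B * cmod (kGamma k (z + (N%:R * k)%:C)) ->
  rGamma k (complex.Re z) <=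
  B * expR (complex.Im z ^+ 2 / (2 * k * (complex.Re z - k))) * cmod (kGamma k z).
Proof.
move=> k0; elim: N z => [|N IH] z kz.
  rewrite mul0r addr0 addr0 => H; apply: (le_trans H).
  have := cmod_ge0 (kGamma k z); have := rGamma_gt0 k0 (lt_trans k0 kz) => G0 g0.
  have E1 : 1 <= expR (complex.Im z ^+ 2 / (2 * k * (complex.Re z - k))).
    rewrite -expR0 ler_expR divr_ge0 ?sqr_ge0// !mulr_ge0// ?(ltW k0)//.
    by rewrite subr_ge0 ltW.
  have Bg : 0 < B * cmod (kGamma k z) by exact: lt_le_trans H.
  by rewrite mulrAC ler_peMr// ltW.
move=> H; have z0 : 0 < complex.Re z := lt_trans k0 kz.
have := IH (z + k%:C); rewrite cReD cImD/= addr0 => IH'.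
have {IH'} : rGamma k (complex.Re z + k) <= B *
    expR (complex.Im z ^+ 2 / (2 * k * complex.Re z)) * cmod (kGamma k (z + k%:C)).
  rewrite -{2}(addrK k (complex.Re z)); apply: IH'; first by rewrite ltrDr.
  move: H; rewrite -natr1 mulrDl mul1r -addrA (addrC k) -!addrA -rmorphD.
  by rewrite [k + _]addrC.
move=> /(kGamma_step k0 z0) H2; apply: (le_trans H2).
have B0 : 0 <= B.
  have Bg : 0 < B * cmod (kGamma k (z + (N.+1%:R * k)%:C)).
    apply: lt_le_trans H; apply: rGamma_gt0 => //.
    by rewrite ltr_wpDr// mulr_ge0// ltW.
  move: Bg; apply: contraTT; rewrite -ltNge -leNgt => B0.
  by rewrite nmulr_rle0// cmod_ge0.
rewrite ler_wpM2r ?cmod_ge0// -mulrA ler_wpM2l// -expRD ler_expR.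
move: kz z0; set x := complex.Re z; set y := complex.Im z => kx x0.
have xk0 : 0 < x - k by rewrite subr_gt0.
have -> : y ^+ 2 / (2 * k * x) + y ^+ 2 / (2 * x ^+ 2) =
    y ^+ 2 / 2 * ((k * x)^-1 + (x ^+ 2)^-1) by field; rewrite !gt_eqF.
have -> : y ^+ 2 / (2 * k * (x - k)) =
    y ^+ 2 / 2 * ((k * x)^-1 + (x * (x - k))^-1) by field; rewrite !gt_eqF.
rewrite ler_wpM2l ?divr_ge0 ?sqr_ge0// lerD2l.
rewrite lef_pV2 ?posrE ?exprn_gt0 ?mulr_gt0// expr2 ler_wpM2l ?(ltW x0)//.
by rewrite lerBlDr lerDl ltW.
Qed.

(** The functional equation moves z far to the right, where the concentration
    estimate applies; the factors |z + j k| / (x + j k) that this costs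
    are those of a convergent product. In particular k-gamma has no zero with
    positive real part. *)
Lemma rGamma_le_cmod k z (L : R) : 0 < k -> 0 < complex.Re z -> 0 <= L ->
  `|complex.Im z| <= L * complex.Re z ->
  rGamma k (complex.Re z) <=
  2 * expR (L ^+ 2 / 2 * (1 + complex.Re z / k)) * cmod (kGamma k z).
Proof.
move=> k0; set x := complex.Re z; set y := complex.Im z => x0 L0 yL.
have y2 : y ^+ 2 <= L ^+ 2 * x ^+ 2.
  by rewrite -exprMn -[y ^+ 2]real_normK ?num_real// ler_sqr ?nnegrE ?mulr_ge0 ?(ltW x0).
(* N steps to the right, the error in kGamma_concentration is at most 1 / 2. *)
pose N := (Num.truncn (8 * y ^+ 2 / k / k)).+1.
have xk : k < complex.Re (z + k%:C) by rewrite cReD/= ltrDr.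
have zN : z + k%:C + (N%:R * k)%:C = (x + k + N%:R * k) +i* y.
  by apply: complexP; rewrite !cReD || rewrite !cImD/= !addr0.
have big : 8 * y ^+ 2 / k <= N%:R * k.
  by rewrite -ler_pdivrMr// ltW// truncnS_gt.
have far : rGamma k (complex.Re (z + k%:C) + N%:R * k) <=
    2 * cmod (kGamma k (z + k%:C + (N%:R * k)%:C)).
  have Nk : 0 <= N%:R * k by rewrite mulr_ge0// ltW.
  have xNk : k < x + k + N%:R * k by lra.
  have := @kGamma_concentration k _ y k0 xNk; rewrite -zN cReD/= -/x.
  have G0 : 0 < rGamma k (x + k + N%:R * k) by apply: rGamma_gt0 => //; lra.
  set g := rGamma _ _ in G0 *; set q := _ / _ => H.
  have q2 : q <= 2^-1.
    rewrite /q ler_pdivrMr; last by rewrite mulr_gt0// subr_gt0.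
    have : 8 * y ^+ 2 <= N%:R * k * k by move: big; rewrite ler_pdivrMr.
    have : k * (N%:R * k) <= k * (x + k + N%:R * k - k) by rewrite ler_wpM2l ?(ltW k0)//; lra.
    by lra.
  have : g * 2^-1 <= g * (1 - q) by rewrite ler_wpM2l ?(ltW G0)//; lra.
  by lra.
have := kGamma_descent k0 xk far; rewrite cReD cImD/= addr0 addrK -/x -/y.
move=> /(kGamma_step k0 x0) H; apply: (le_trans H).
rewrite ler_wpM2r ?cmod_ge0// -mulrA ler_wpM2l// -expRD ler_expR -/x -/y.
have -> : y ^+ 2 / (2 * k * x) + y ^+ 2 / (2 * x ^+ 2) =
    y ^+ 2 * ((2 * k * x)^-1 + (2 * x ^+ 2)^-1) by rewrite mulrDr.
apply: le_trans (ler_wpM2r _ y2) _.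
  by rewrite addr_ge0// invr_ge0 !mulr_ge0 ?exprn_ge0 ?(ltW k0) ?(ltW x0).
rewrite le_eqVlt; apply/orP; left; apply/eqP; field.
by rewrite !gt_eqF.
Qed.

End GammaLowerBound.

(** * Convolution *)

Lemma cmeas_comp d1 d2 (T1 : measurableType d1) (T2 : measurableType d2)
    (R : realType) (phi : T1 -> T2) (g : T2 -> R[i]) :
  measurable_fun setT phi -> cmeas setT g -> cmeas setT (fun x => g (phi x)).
Proof.
by move=> mphi [g1 g2]; split; [exact: (measurableT_comp g1 mphi)|
  exact: (measurableT_comp g2 mphi)].
Qed.

Section Convolution.
Context {R : realType}.
Implicit Types (g : R -> R[i]) (c t x : R).

Local Notation mu := (@lebesgue_measure R).

Lemma lebesgue_measure_translation c (A : set R) : measurable A ->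
  pushforward mu ((fun x => x + c) : _ -> measurableTypeR R) A = mu A.
Proof.
move=> mA; apply/esym/lebesgue_measure_unique => //=.
  by apply: measurable_funD; [exact: measurable_id|exact: measurable_cst].
move=> _ _ [[a b]] _ <-.
rewrite /pushforward.
rewrite (_ : _ @^-1` _ = `]a - c, b - c]%classic); last first.
  by apply/seteqP; split => x /=; rewrite !in_itv/= lerBrDr ltrBlDr.
rewrite !lebesgue_measure_itv/= !lte_fin ltrD2r.
by case: ifP => // _; rewrite -!EFinB; congr EFin; ring.
Qed.

Let ge0_translation (h : R -> \bar R) c : measurable_fun setT h ->
  (forall x, (0 <= h x)%E) -> (\int[mu]_x h (x - c)%R = \int[mu]_x h x)%E.
Proof.
move=> mh h0.
pose phi : measurableTypeR R -> measurableTypeR R := (fun x => x - c).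
have mphi : measurable_fun setT phi.
  by apply: measurable_funB; [exact: measurable_id|exact: measurable_cst].
transitivity (\int[mu]_(x in phi @^-1` setT) (h \o phi) x)%E.
  by rewrite preimage_setT.
rewrite -(@ge0_integral_pushforward _ _ _ _ _ phi mphi mu setT h)//.
by apply: eq_measure_integral => //= A mA _; exact: lebesgue_measure_translation.
Qed.

Lemma integral_translation (h : R -> \bar R) c : measurable_fun setT h ->
  (\int[mu]_x h (x - c)%R = \int[mu]_x h x)%E.
Proof.
move=> mh; rewrite integralE [RHS]integralE; congr (_ - _)%E.
- transitivity (\int[mu]_x (h^\+ (x - c)%R))%E; first by apply: eq_integral => x _; rewrite !(funeposE, funenegE).
  by apply: ge0_translation => //; exact: measurable_funepos.
- transitivity (\int[mu]_x (h^\- (x - c)%R))%E; first by apply: eq_integral => x _; rewrite !(funeposE, funenegE).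
  by apply: ge0_translation => //; exact: measurable_funeneg.
Qed.

Lemma cint_translation g c : cmeas setT g ->
  cint mu setT (fun x => g (x - c)) = cint mu setT g.
Proof.
move=> [g1 g2]; rewrite /cint /Rintegral.
rewrite (integral_translation c (h := fun x => (complex.Re (g x))%:E)); last exact/measurable_EFinP.
by rewrite (integral_translation c (h := fun x => (complex.Im (g x))%:E)); last exact/measurable_EFinP.
Qed.

(** Fubini's theorem and the invariance of the measure under translations. *)
Lemma convolution g1 g2 : cintble mu setT g1 -> cintble mu setT g2 ->
  cint mu setT (fun x => cint mu setT (fun t => g1 (x - t) * g2 t)) =
  cint mu setT g1 * cint mu setT g2.
Proof.
move=> i1 i2; have m1 := cintble_meas i1; have m2 := cintble_meas i2.
have n1 := integrable_cmod measurableT i1; have n2 := integrable_cmod measurableT i2.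
pose T := measurableTypeR R.
pose f (p : T * T) : R[i] := g1 (p.2 - p.1) * g2 p.1.
have mf : cmeas setT f.
  apply: cmeasM; last by apply: (cmeas_comp (phi := fst)).
  apply: (cmeas_comp (phi := fun p : T * T => p.2 - p.1 : T)) => //.
  exact: measurable_funB.
have mB (t : T) : measurable_fun setT (fun x : T => x - t : T).
  by apply: measurable_funB; [exact: measurable_id|exact: measurable_cst].
have fin : (\int[mu]_t \int[mu]_x (cmod (f (t, x)))%:E < +oo)%E.
  have E t : (\int[mu]_x (cmod (f (t, x)))%:E =
      (\int[mu]_x (cmod (g1 x))%:E) * (cmod (g2 t))%:E)%E.
    rewrite /f/=; under eq_integral do rewrite cmodM EFinM.
    rewrite ge0_integralZr//; last 3 first.
    - by apply/measurable_EFinP; exact: (measurableT_comp (measurable_cmod m1) (mB t)).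
    - by move=> x _; rewrite lee_fin cmod_ge0.
    - by rewrite lee_fin cmod_ge0.
    congr (_ * _)%E; apply: (integral_translation t (h := fun x => (cmod (g1 x))%:E)).
    by apply/measurable_EFinP; exact: measurable_cmod.
  under eq_integral do rewrite E.
  have fin1 : (\int[mu]_x (cmod (g1 x))%:E)%E \is a fin_num by exact: integrable_fin_num.
  rewrite -(fineK fin1) ge0_integralZl//; last 3 first.
  - by apply/measurable_EFinP; exact: measurable_cmod.
  - by move=> x _; rewrite lee_fin cmod_ge0.
  - by rewrite lee_fin; apply: fine_ge0; apply: integral_ge0 => x _; rewrite lee_fin cmod_ge0.
  have fin2 : (\int[mu]_x (cmod (g2 x))%:E)%E \is a fin_num by exact: integrable_fin_num.
  by rewrite -(fineK fin2) -EFinM ltry.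
have [_ _] := cFubini mf fin.
rewrite /f/= => <-; transitivity (cint mu setT (fun t => cint mu setT g1 * g2 t)); last first.
  by rewrite cintZ.
apply: eq_cint => t _; under eq_cint do rewrite mulrC.
have m1t : cmeas setT (fun x => g1 (x - t)).
  exact: (cmeas_comp (mB t) m1).
rewrite cintZ//; first by rewrite cint_translation// mulrC.
apply/cintbleP => //; apply/integrableP; split.
  by apply/measurable_EFinP; exact: measurable_cmod.
rewrite (integral_translation t (h := fun x => `|(cmod (g1 x))%:E|%E)); last first.
  by apply: measurableT_comp => //; apply/measurable_EFinP; exact: measurable_cmod.
by case/integrableP : n1.
Qed.

End Convolution.

(** * The kernel and its Laplace transform *)

Lemma measurable_nat_prod d d' (T : measurableType d) (T' : measurableType d')
    (F : nat * T -> T') :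
  (forall n, measurable_fun setT (fun x => F (n, x))) -> measurable_fun setT F.
Proof.
move=> mF _ Y mY; rewrite setTI.
have -> : F @^-1` Y = \bigcup_n ([set n] `*` ((fun x => F (n, x)) @^-1` Y)).
  apply/seteqP; split => [[n x] /= Yx|[n x] [m _ [/= -> Yx]]] //.
  by exists n.
apply: bigcupT_measurable => n; apply: measurableX => //.
by rewrite -[X in measurable X]setTI; exact: mF.
Qed.

(** Sigma-finite measures are declared as a subclass of the s-finite ones; this
    makes the counting measure an instance to which cFubini applies. *)
HB.instance Definition _ (R : realType) :=
  @isSFinite.Build _ nat R (@counting nat R)
    (sfinite_measure_sigma_finite (sigma_finite_counting R)).

Section Kernel.
Context {R : realType}.
Variables (k : R) (alpha nu omega gamma : R[i]).
Hypothesis k0 : 0 < k.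
Hypothesis alpha0 : 0 < complex.Re alpha.
Hypothesis nu0 : 0 < complex.Re nu.

Local Notation cnt := (@counting nat R).
Local Notation mu := (@lebesgue_measure R).
Local Notation pos := (`]0%R, +oo[%classic : set R).
#[local] Hint Resolve measurable_pos : core.

(** In this section nu is the parameter mu of the k-Prabhakar integral; ml_order
    and ml_coef are the numbers z_n and kappa_n of the introduction. *)
Definition ml_order n : R[i] := alpha * n%:R + nu.
Let a := complex.Re alpha.
Let m := complex.Re nu.

Let Re_z n : complex.Re (ml_order n) = a * n%:R + m.
Proof. by rewrite /ml_order cReD -(rmorph_nat (real_complex R)) cReMr. Qed.

Let Re_z_gt0 n : 0 < complex.Re (ml_order n).
Proof. by rewrite Re_z ltr_wpDl// mulr_ge0// ltW. Qed.

Let kC : k%:C != 0 :> R[i].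
Proof. by rewrite (inj_eq (@complexI R)) gt_eqF. Qed.

Let kpochhammer_nbin n : kpochhammer k gamma n / n`!%:R = nbin (gamma / k%:C) n * k%:C ^+ n.
Proof.
rewrite /kpochhammer; elim: n => [|n IH].
  by rewrite big_ord0 nbin0 expr0 fact0 divr1 mulr1.
rewrite big_ord_recr/= nbinS exprS factS natrM.
have n0 : n.+1%:R != 0 :> R[i] by rewrite pnatr_eq0.
have f0 : n`!%:R != 0 :> R[i] by rewrite pnatr_eq0 -lt0n fact_gt0.
rewrite (_ : _ / _ = (\prod_(i < n) (gamma + i%:R * k%:C) / n`!%:R) *
  (gamma + n%:R * k%:C) / n.+1%:R); last first.
  by rewrite invfM; ring.
by rewrite IH; move: n0; move: (n.+1%:R : R[i]) => p p0; field; rewrite p0 kC.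
Qed.

Definition ml_coef n : R[i] := kpochhammer k gamma n / kGamma k (ml_order n) / n`!%:R * omega ^+ n.

Let kappaE n :
  ml_coef n = nbin (gamma / k%:C) n * k%:C ^+ n / kGamma k (ml_order n) * omega ^+ n.
Proof. by rewrite -kpochhammer_nbin /ml_coef; ring. Qed.

Let L := `|complex.Im alpha| / a + `|complex.Im nu| / m.

Let L_ge0 : 0 <= L.
Proof. by rewrite addr_ge0// divr_ge0// ltW. Qed.

Let Im_z n : `|complex.Im (ml_order n)| <= L * complex.Re (ml_order n).
Proof.
rewrite Re_z /ml_order cImD -(rmorph_nat (real_complex R)) cImMr.
rewrite (le_trans (ler_normD _ _))// normrM normr_nat mulrDr lerD//.
  rewrite mulrA ler_wpM2r// /L mulrDl divfK ?gt_eqF// lerDl.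
  by rewrite !mulr_ge0 ?invr_ge0 ?(ltW nu0) ?(ltW alpha0).
rewrite /L mulrDl divfK ?gt_eqF// lerDr.
by rewrite !mulr_ge0 ?invr_ge0 ?(ltW nu0) ?(ltW alpha0).
Qed.

Let E := expR (L ^+ 2 / 2 * (a / k)).
Let A := 2 * k * E * cmod omega.

Let E_ge1 : 1 <= E.
Proof.
by rewrite /E -expR0 ler_expR mulr_ge0 ?divr_ge0 ?sqr_ge0 ?(ltW alpha0) ?(ltW k0).
Qed.

Let A_ge0 : 0 <= A.
Proof. by rewrite !mulr_ge0 ?cmod_ge0 ?(ltW k0) ?expR_ge0. Qed.

Let kGamma_neq0 n : kGamma k (ml_order n) != 0.
Proof.
rewrite -cmod_eq0; apply/eqP => H.
have := rGamma_le_cmod k0 (Re_z_gt0 n) L_ge0 (Im_z n).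
by rewrite H mulr0 leNgt rGamma_gt0.
Qed.

(** With L bounding |Im z_n| / Re z_n, the loss in rGamma_le_cmod is at most
    geometric in n, and so are the binomial coefficients and the powers of
    omega and k. *)
Let kappa_bound : exists2 C, 0 <= C &
  forall n, cmod (ml_coef n) * rGamma k (complex.Re (ml_order n)) <= C * A ^+ n.
Proof.
have x0 := cmod_ge0 (gamma / k%:C).
have h01 : 0 <= (2^-1 : R) < 1 by apply/andP; split; lra.
have [C C0 HC] := rnbin_geometric x0 h01.
pose C' := 2 * expR (L ^+ 2 / 2 * (1 + m / k)).
exists (C * C'); first by rewrite !mulr_ge0 ?expR_ge0.
move=> n; have G := rGamma_le_cmod k0 (Re_z_gt0 n) L_ge0 (Im_z n).
have g0 : 0 < cmod (kGamma k (ml_order n)) by rewrite lt_def cmod_eq0 kGamma_neq0 cmod_ge0.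
have -> : cmod (ml_coef n) = cmod (nbin (gamma / k%:C) n) * k ^+ n * cmod omega ^+ n /
    cmod (kGamma k (ml_order n)).
  rewrite kappaE !cmodM cmodV !cmodX cmodr gtr0_norm//; ring.
have rbC : cmod (nbin (gamma / k%:C) n) <= C * 2 ^+ n.
  apply: le_trans (cmod_nbin _ (lexx _)) _; have := HC n.
  by rewrite expr1n mulr1 exprVn ler_pdivrMr ?exprn_gt0.
rewrite mulrAC ler_pdivrMr//.
apply: (@le_trans _ _ ((C * 2 ^+ n * k ^+ n * cmod omega ^+ n) *
  (2 * expR (L ^+ 2 / 2 * (1 + complex.Re (ml_order n) / k)) * cmod (kGamma k (ml_order n))))).
  apply: ler_pM => //.
  - by rewrite !mulr_ge0 ?exprn_ge0 ?cmod_ge0 ?(ltW k0).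
  - by rewrite ltW// rGamma_gt0.
  - rewrite ler_wpM2r ?exprn_ge0 ?cmod_ge0// ler_wpM2r ?exprn_ge0 ?(ltW k0)//.
rewrite Re_z (_ : L ^+ 2 / 2 * (1 + (a * n%:R + m) / k) =
  n%:R * (L ^+ 2 / 2 * (a / k)) + L ^+ 2 / 2 * (1 + m / k)); last by ring.
rewrite expRD expRM_natl -/E /C' /A !exprMn le_eqVlt; apply/orP; left; apply/eqP; ring.
Qed.

(** The Mittag-Leffler series converges everywhere, since the gamma function
    grows faster than any geometric sequence. *)
Let kappa_summable r : 0 <= r ->
  cnt.-integrable setT (EFin \o (fun n => cmod (ml_coef n) * r ^+ n)).
Proof.
move=> r0; have [C C0 HC] := kappa_bound.
have Ar0 : 0 <= A * r := mulr_ge0 A_ge0 r0.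
(* With Y ^ a = B, the lower bound at Y outweighs (A r) ^ n by the factor 2 ^ n. *)
pose B := 2 * (A * r + 1); have B0 : 0 < B by rewrite /B; lra.
pose Y := expR (ln B / a).
have Y0 : 0 < Y := expR_gt0 _.
pose c := weight k (Y + 1) / (Y + 1).
have c0 : 0 < c by rewrite divr_gt0 ?expR_gt0// addr_gt0.
have aE n : expR ((a * n%:R + m) * ln Y) = B ^+ n * expR (m * ln Y).
  rewrite mulrDl expRD mulrAC mulrC (_ : a * ln Y = ln B); last first.
    by rewrite /Y expRK mulrC divfK// gt_eqF.
  by rewrite expRM_natr lnK ?posrE// mulrC.
pose D := C / (c * expR (m * ln Y)).
have D0 : 0 <= D by rewrite divr_ge0// mulr_ge0 ?expR_ge0// (ltW c0).
apply: le_integrable (integrable_geometric D0 (q := 2^-1) _) => //; last first.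
  by apply/andP; split; lra.
move=> n _; have hp : 0 <= (2^-1 : R) ^+ n by rewrite exprn_ge0.
have kp : 0 <= cmod (ml_coef n) * r ^+ n := mulr_ge0 (cmod_ge0 _) (exprn_ge0 n r0).
rewrite /= lee_fin (ger0_norm kp) (ger0_norm (mulr_ge0 D0 hp)).
have lo := rGamma_ge k0 (Re_z_gt0 n) Y0; rewrite -/c Re_z aE in lo.
have hi := HC n; rewrite Re_z in hi.
have cm : 0 < c * expR (m * ln Y) by rewrite mulr_gt0// expR_gt0.
rewrite /D mulrAC ler_pdivlMr// -(ler_pM2r (exprn_gt0 n B0)).
apply: (@le_trans _ _ (C * A ^+ n * r ^+ n)).
  rewrite (_ : _ * _ * _ * _ = cmod (ml_coef n) * (c * (B ^+ n * expR (m * ln Y))) * r ^+ n); last by ring.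
  rewrite ler_wpM2r ?exprn_ge0//; apply: le_trans hi.
  by rewrite ler_wpM2l ?cmod_ge0.
have hB : 0 <= 2^-1 * B by rewrite /B; lra.
rewrite -mulrA -exprMn -[leRHS]mulrA -exprMn ler_wpM2l// lerXn2r ?nnegrE//.
by rewrite /B; lra.
Qed.

(** The convolution kernel of the k-Prabhakar operator, extended by zero to
    the negative half-line. *)
Definition prabhakar_ker x : R[i] :=
  if 0 < x then csum (fun n => ml_coef n / k%:C * rpow x (ml_order n / k%:C - 1)) else 0.

Let rpow_z x n : rpow x (ml_order n / k%:C - 1) =
  rpow x (alpha / k%:C) ^+ n * rpow x (nu / k%:C - 1).
Proof. by rewrite rpowX -rpowD; congr (rpow _ _); rewrite /ml_order; ring. Qed.

Let kappa_rpow_summable x :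
  cintble cnt setT (fun n => ml_coef n * rpow x (alpha / k%:C) ^+ n).
Proof.
apply: cintble_count (kappa_summable (cmod_ge0 (rpow x (alpha / k%:C)))) => n.
by rewrite cmodM cmodX.
Qed.

Lemma prabhakar_kerE x : 0 < x ->
  cpow x%:C (nu / k%:C - 1) / k%:C *
    kMittagLeffler k alpha nu gamma (omega * cpow x%:C (alpha / k%:C)) = prabhakar_ker x.
Proof.
move=> x0; rewrite /prabhakar_ker x0 !cpow_pos//.
set X := rpow x (alpha / k%:C); set Y := rpow x (nu / k%:C - 1).
have -> : kMittagLeffler k alpha nu gamma (omega * X) =
    csum (fun n => ml_coef n * X ^+ n).
  apply: ccvg_lim; have := ccvg_csum (kappa_rpow_summable x); rewrite -/X.
  congr (ccvg _ _); apply/funext => n; rewrite seriesEord/=.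
  by apply: eq_bigr => i _; rewrite /ml_coef /ml_order exprMn; ring.
rewrite /csum -cintZ//; last exact: kappa_rpow_summable.
by apply: eq_cint => n _; rewrite rpow_z -/X -/Y; ring.
Qed.

Let Q s := expR (- (a / k) * ln (s * k)).
Let w s : R[i] := omega * k%:C * rpow (s * k) (- (alpha / k%:C)).

(** Closed form of the Laplace transform of the kernel at s. *)
Definition ker_transform s : R[i] :=
  rpow (s * k) (- (nu / k%:C)) *
  cpow (1 - omega * k%:C * rpow (s * k) (- (alpha / k%:C))) (- (gamma / k%:C)).

Let term s (p : nat * measurableTypeR R) : R[i] :=
  if (0 < p.2)%R then (expR (- (s * p.2)))%:C *
    (ml_coef p.1 / k%:C * rpow p.2 (ml_order p.1 / k%:C - 1)) else 0.

Let cmeas_term s : cmeas setT (term s).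
Proof.
have H n : cmeas setT (fun x : measurableTypeR R => term s (n, x)).
  apply: cmeas_if.
  - by rewrite /=; apply: measurable_fun_ltr; [exact: measurable_cst|exact: measurable_id].
  - have H : cmeas setT (fun x : R => (expR (- (s * x)))%:C * (ml_coef n / k%:C * rpow x (ml_order n / k%:C - 1))).
      by apply: cmeas_lap; apply: cmeasZ; exact: cmeas_power.
    exact: H.
  - exact: cmeas_cst.
by split; apply: measurable_nat_prod => n; have [] := H n.
Qed.

Let cint_term s n : 0 < s -> cint mu setT (fun x => term s (n, x)) =
  ml_coef n * rpow (s * k) (- (ml_order n / k%:C)) * kGamma k (ml_order n).
Proof.
move=> s0.
have zk : 0 < complex.Re (ml_order n / k%:C).
  by rewrite -fmorphV cReMr divr_gt0.
transitivity (cint mu pos (fun x => ml_coef n / k%:C *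
    ((expR (- (s * x)))%:C * rpow x (ml_order n / k%:C - 1)))).
  rewrite [RHS]cint_mkcond; apply: eq_cint => x _.
  rewrite /term/= mem_setE in_itv/= andbT; case: ifP => // _; ring.
rewrite cintZ//; last exact: cintble_lap_power.
have := lap_power k0 s0 (Re_z_gt0 n); rewrite /lap => ->.
by field.
Qed.

Let integral_cmod_term s n : 0 < s ->
  (\int[mu]_x (cmod (term s (n, x)))%:E =
   (cmod (ml_coef n) * (expR (- (complex.Re (ml_order n) / k) * ln (s * k)) *
     rGamma k (complex.Re (ml_order n))))%:E)%E.
Proof.
move=> s0.
have zk : 0 < complex.Re (ml_order n / k%:C) by rewrite -fmorphV cReMr divr_gt0.
pose g x := expR (- (s * x)) * expR ((complex.Re (ml_order n) / k - 1) * ln x).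
have ig : mu.-integrable pos (EFin \o g).
  by apply: integrable_expR_power => //; rewrite divr_gt0.
have ck : 0 <= cmod (ml_coef n) / k by rewrite divr_ge0 ?cmod_ge0 ?(ltW k0).
transitivity (\int[mu]_(x in pos) ((cmod (ml_coef n) / k)%:E * (g x)%:E))%E.
  rewrite [RHS]integral_mkcond; apply: eq_integral => x _.
  rewrite /term/= patchE mem_setE in_itv/= andbT; case: ifP => [x0|_]; last first.
    by rewrite cmod0.
  have -> : cmod ((expR (- (s * x)))%:C * (ml_coef n / k%:C * rpow x (ml_order n / k%:C - 1))) =
      expR (- (s * x)) * (cmod (ml_coef n) / k * expR ((complex.Re (ml_order n) / k - 1) * ln x)).
    rewrite (cmodM (expR _)%:C) (cmodM (ml_coef n / _)) (cmodM (ml_coef n)) cmodV.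
    rewrite (cmodr k) (cmodr (expR _)) (gtr0_norm k0) ger0_norm ?expR_ge0//.
    by rewrite cmod_rpow cReD cReN -fmorphV cReMr.
  by rewrite -EFinM; congr (_%:E); rewrite /g; ring.
rewrite ge0_integralZl//=; first last.
- by move=> x _; rewrite lee_fin mulr_ge0 ?expR_ge0.
- exact: (measurable_int _ ig).
have -> : (\int[mu]_(x in pos) (g x)%:E)%E = (\int[mu]_(x in pos) g x)%:E.
  by rewrite /Rintegral fineK//; exact: integrable_fin_num ig.
rewrite integral_expR_power// -EFinM; congr (_%:E).
by field; rewrite gt_eqF.
Qed.

Let w_lt1 s : A * Q s < 1 -> cmod (w s) < 1.
Proof.
move=> AQ; rewrite /w !cmodM (cmodr k) gtr0_norm// cmod_rpow.
rewrite cReN -fmorphV cReMr -/(Q s); apply: le_lt_trans AQ.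
rewrite ler_wpM2r ?expR_ge0// /A.
rewrite (_ : _ * cmod omega = (cmod omega * k) * (2 * E)); last by ring.
rewrite ler_peMr ?mulr_ge0 ?cmod_ge0 ?(ltW k0)//.
by rewrite (le_trans E_ge1)// ler_peMl ?expR_ge0// ler1n.
Qed.

(** Termwise integration is justified for large s only, where the geometric
    bound on the coefficients leaves an absolutely convergent double integral. *)
Let lap_ker_large s : 0 < s -> A * Q s < 1 ->
  cintble mu setT (fun x => (expR (- (s * x)))%:C * prabhakar_ker x) /\
  cint mu setT (fun x => (expR (- (s * x)))%:C * prabhakar_ker x) = ker_transform s.
Proof.
move=> s0 AQ; have [C C0 HC] := kappa_bound.
have Q0 : 0 <= Q s := expR_ge0 _.
have AQ0 : 0 <= A * Q s := mulr_ge0 A_ge0 Q0.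
pose D := C * expR (- (m / k) * ln (s * k)).
have D0 : 0 <= D by rewrite mulr_ge0 ?expR_ge0.
have fin : (\int[cnt]_n \int[mu]_x (cmod (term s (n, x)))%:E < +oo)%E.
  have h : 0 <= A * Q s < 1 by rewrite AQ0 AQ.
  have := integrable_geometric D0 h => /integrableP[_]; apply: le_lt_trans.
  apply: ge0_le_integral => //.
    by move=> n _; apply: integral_ge0 => x _; rewrite lee_fin cmod_ge0.
  move=> n _; rewrite integral_cmod_term//= lee_fin.
  rewrite (le_trans _ (ler_norm _))// /D exprMn.
  rewrite Re_z (_ : - ((a * n%:R + m) / k) * ln (s * k) =
    n%:R * (- (a / k) * ln (s * k)) + - (m / k) * ln (s * k)); last by ring.
  rewrite expRD expRM_natl -/(Q s) -Re_z.
  rewrite (_ : cmod _ * _ = (cmod (ml_coef n) * rGamma k (complex.Re (ml_order n))) *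
    (Q s ^+ n * expR (- (m / k) * ln (s * k)))); last by ring.
  rewrite (_ : C * _ * _ = (C * A ^+ n) * (Q s ^+ n * expR (- (m / k) * ln (s * k)))); last by ring.
  by rewrite ler_wpM2r// mulr_ge0 ?exprn_ge0 ?expR_ge0.
have [_ i2 e12] := @cFubini _ _ nat (measurableTypeR R) R cnt mu _ (cmeas_term s) fin.
have kerE : (fun y : R => cint cnt setT (fun n => term s (n, y))) =
    (fun x => (expR (- (s * x)))%:C * prabhakar_ker x).
  apply/funext => x; rewrite /prabhakar_ker /term/=; case: ifP => x0; last by rewrite cint0 mulr0.
  rewrite /csum -cintZ//.
  apply: (@eq_cintble _ _ _ cnt setT (fun n =>
    (rpow x (nu / k%:C - 1) / k%:C) * (ml_coef n * rpow x (alpha / k%:C) ^+ n))) => //.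
    by move=> n _; rewrite rpow_z; ring.
  by apply: cintbleZ.
rewrite kerE in i2 e12; split => //.
rewrite -e12 /ker_transform -binomial_series -/(w s); last exact: w_lt1.
rewrite /csum -cintZ//; last by apply: nbin_summable; exact: w_lt1.
apply: eq_cint => n _; rewrite cint_term//.
rewrite (_ : - (ml_order n / k%:C) = - (alpha / k%:C) * n%:R + - (nu / k%:C)); last first.
  by rewrite /ml_order; ring.
rewrite rpowD -rpowX kappaE /w !exprMn mulrC; field.
exact: kGamma_neq0.
Qed.

(** Q s tends to zero as s grows, because Re alpha > 0. *)
Lemma lap_prabhakar_ker : exists2 s1, 0 < s1 & forall s, s1 <= s ->
  cintble mu setT (fun x => (expR (- (s * x)))%:C * prabhakar_ker x) /\
  cint mu setT (fun x => (expR (- (s * x)))%:C * prabhakar_ker x) = ker_transform s.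
Proof.
(* ln (s k) > b means that (A + 1) * Q s < 1. *)
pose b := ln (A + 1) / (a / k).
have ak : 0 < a / k by rewrite divr_gt0.
have A1 : 0 < A + 1 by rewrite ltr_wpDl// A_ge0.
exists (expR (b + 1) / k); first by rewrite divr_gt0// expR_gt0.
move=> s s1; have s0 : 0 < s by apply: lt_le_trans s1; rewrite divr_gt0// expR_gt0.
apply: lap_ker_large => //; rewrite ler_pdivrMr// in s1.
have sk : 0 < s * k by rewrite mulr_gt0.
have ls : b + 1 <= ln (s * k) by rewrite -[leLHS]expRK ler_ln ?posrE ?expR_gt0.
apply: (@le_lt_trans _ _ (A / (A + 1))); last by rewrite ltr_pdivrMr// mul1r ltrDl.
rewrite ler_wpM2l ?A_ge0// /Q -[leRHS]lnK ?posrE ?invr_gt0// lnV ?posrE//.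
rewrite ler_expR mulNr lerN2 (_ : ln (A + 1) = a / k * b).
  by rewrite ler_pM2l//; lra.
by rewrite /b mulrC divfK// gt_eqF.
Qed.

End Kernel.

(** * Analyticity of the transformed kernel *)

Section TransformExpansion.
Context {R : realType}.
Variables (k : R) (alpha nu omega gamma : R[i]).
Hypothesis k0 : 0 < k.
Hypothesis alpha0 : 0 < complex.Re alpha.
Hypothesis nu0 : 0 < complex.Re nu.

Local Notation cnt := (@counting nat R).

Let a := complex.Re alpha.
Let m := complex.Re nu.
Let b := cmod alpha / k.
Let w s : R[i] := omega * k%:C * rpow (s * k) (- (alpha / k%:C)).
Let rho n := alpha / k%:C * n%:R + nu / k%:C.

Let kC : k%:C != 0 :> R[i].
Proof. by rewrite (inj_eq (@complexI R)) gt_eqF. Qed.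

Let b_gt0 : 0 < b.
Proof. by rewrite divr_gt0// (lt_le_trans alpha0)// (le_trans (ler_norm _))// Re_le_cmod. Qed.

Let cmod_div z : cmod (z / k%:C) = cmod z / k.
Proof. by rewrite cmodM cmodV (cmodr k) gtr0_norm. Qed.

Let Re_div z : complex.Re (z / k%:C) = complex.Re z / k.
Proof. by rewrite -fmorphV cReMr. Qed.

Let cmod_w s : cmod (w s) = cmod omega * k * expR (- (a / k) * ln (s * k)).
Proof. by rewrite /w !cmodM (cmodr k) gtr0_norm// cmod_rpow cReN Re_div. Qed.

(** This keeps the whole half-line to the right of 1 / u inside the domain of
    the binomial series. *)
Lemma cmod_w_antitone s t : 0 < s -> s <= t -> cmod (w t) <= cmod (w s).
Proof.
move=> s0 st; rewrite !cmod_w ler_wpM2l ?mulr_ge0 ?cmod_ge0 ?(ltW k0)//.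
rewrite ler_expR !mulNr lerN2 ler_wpM2l ?divr_ge0 ?(ltW k0) ?(ltW alpha0)//.
have t0 := lt_le_trans s0 st.
by rewrite ler_ln ?posrE ?mulr_gt0// ler_pM2r.
Qed.

(** Room for a small relative perturbation of s inside the disc of convergence. *)
Let margin (p : R) : 0 <= p < 1 ->
  exists2 q, 0 < q < 1 & p * expR (- b * ln (1 - q)) < 1.
Proof.
move=> /andP[p0 p1]; pose p' := (1 + p) / 2.
have p'0 : 0 < p' by rewrite /p'; lra.
have p'1 : p' < 1 by rewrite /p'; lra.
have lp : ln p' / b < 0 by rewrite pmulr_llt0 ?invr_gt0// ln_lt0// p'0.
exists (1 - expR (ln p' / b)).
  by rewrite subr_gt0 expR_lt1 lp ltrBlDr ltrDl expR_gt0.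
rewrite subKr expRK (_ : - b * (ln p' / b) = - ln p'); last by field; rewrite gt_eqF.
rewrite -lnV ?posrE// lnK ?posrE ?invr_gt0//.
by rewrite ltr_pdivrMr// /p'; lra.
Qed.

(** The transform is a sum of powers of s, all of which are expanded at c with
    the same relative radius q; the margin makes the sum of the bounds finite. *)
Lemma psexp_ker_transform c : 0 < c -> cmod (w c) < 1 ->
  exists r coef M, 0 < r /\
    psexp (fun h => ker_transform k alpha nu omega gamma (c + h)) coef r M.
Proof.
move=> c0 w1; have ck : 0 < c * k by rewrite mulr_gt0.
have [|q q01 wq] := margin (p := cmod (w c)); first by rewrite cmod_ge0.
have /andP[q0 q1] := q01.
set y := expR _ in wq.
pose g := gamma / k%:C.
pose C n : R[i] := nbin g n * (omega * k%:C) ^+ n * rpow k (- rho n).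
pose F n h : R[i] := C n * rpow (c + h) (- rho n).
pose co n j : R[i] := C n * (rpow c (- rho n) * nbin (rho n) j * ((- c^-1) ^+ j)%:C).
pose K := 2 * expR (- (m / k) * ln (c * k)) * expR (- (cmod nu / k) * ln (1 - q)).
pose G n := K * (rnbin (cmod g) n * (cmod (w c) * y) ^+ n).
have K0 : 0 <= K by rewrite !mulr_ge0 ?expR_ge0.
have lq : ln (1 - q) <= 0 by apply: ln_le0; lra.
exists (q * c), (fun j => csum (co ^~ j)), (2 * \int[cnt]_n G n).
split; first by rewrite mulr_gt0.
have term n : psexp (F n) (co n) (q * c) (G n).
  have := psexpZ (C n) (psexp_rpow (- rho n) c0 q01).
  rewrite opprK; apply: psexp_leM; first by rewrite mulr_gt0.
  have rhoE : complex.Re (- rho n) = - (n%:R * (a / k) + m / k).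
    rewrite cReN /rho cReD -(rmorph_nat (real_complex R)) cReMr !Re_div -/a -/m; ring.
  have rho_le : cmod (- rho n) <= n%:R * b + cmod nu / k.
    rewrite cmodN /rho (le_trans (cmodD _ _))// cmodM !cmod_div cmod_nat mulrC lerD//.
  rewrite /C (cmodM (_ * _)) (cmodM (nbin _ _)) cmodX cmod_rpow rhoE.
  rewrite (_ : cmod (omega * k%:C) = cmod omega * k); last by rewrite cmodM (cmodr k) gtr0_norm.
  apply: (@le_trans _ _ (rnbin (cmod g) n * (cmod omega * k) ^+ n *
     expR (- (n%:R * (a / k) + m / k) * ln k) * (2 *
     (expR (- (n%:R * (a / k) + m / k) * ln c) *
      expR (- (n%:R * b + cmod nu / k) * ln (1 - q)))))).
    apply: ler_pM.
    - by rewrite !mulr_ge0 ?exprn_ge0 ?cmod_ge0 ?expR_ge0 ?mulr_ge0 ?cmod_ge0 ?(ltW k0).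
    - by rewrite !mulr_ge0 ?expR_ge0.
    - rewrite ler_wpM2r ?expR_ge0// ler_wpM2r ?exprn_ge0 ?mulr_ge0 ?cmod_ge0 ?(ltW k0)//.
      exact: cmod_nbin.
    - rewrite ler_wpM2l// ler_wpM2l ?expR_ge0// ler_expR !mulNr lerN2.
      by rewrite ler_wnM2r.
  rewrite /G /K cmod_w /y lnM ?posrE// le_eqVlt; apply/orP; left; apply/eqP.
  rewrite !exprMn -!expRM_natl.
  rewrite (_ : - (n%:R * (a / k) + m / k) * ln k =
    n%:R * (- (a / k) * ln k) + - (m / k) * ln k); last by ring.
  rewrite (_ : - (n%:R * (a / k) + m / k) * ln c =
    n%:R * (- (a / k) * ln c) + - (m / k) * ln c); last by ring.
  rewrite (_ : - (n%:R * b + cmod nu / k) * ln (1 - q) =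
    n%:R * (- b * ln (1 - q)) + - (cmod nu / k) * ln (1 - q)); last by ring.
  rewrite 2!(mulrDr (- (_ / k))) (mulrDr n%:R) !expRD; ring.
have iG : cnt.-integrable setT (EFin \o G).
  have h : 0 <= cmod (w c) * y < 1 by rewrite wq andbT mulr_ge0 ?cmod_ge0 ?expR_ge0.
  rewrite /comp /G; under eq_fun do rewrite EFinM.
  by apply: integrableZl => //; exact: rnbin_summable (cmod_ge0 g) h.
apply: eq_psexp (psexp_cint (A := co) measurableT _ _ _ iG _); last 4 first.
- by rewrite mulr_gt0.
- by move=> h; exact: cmeas_nat.
- by move=> j; exact: cmeas_nat.
- by move=> n _; exact: term.
move=> h hq; have /andP[h1 h2] : - (q * c) <= h <= q * c by rewrite -ler_norml.
have ch : 0 < c + h.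
  have : 0 < (1 - q) * c by rewrite mulr_gt0// subr_gt0.
  lra.
have wh : cmod (w (c + h)) < 1.
  apply: le_lt_trans wq; rewrite !cmod_w -[leRHS]mulrA ler_wpM2l ?mulr_ge0 ?cmod_ge0 ?(ltW k0)//.
  rewrite /y -expRD ler_expR.
  have lch : ln (c * k) + ln (1 - q) <= ln ((c + h) * k).
    rewrite -lnM ?posrE ?subr_gt0// ler_ln ?posrE ?mulr_gt0 ?subr_gt0//.
    rewrite mulrAC ler_pM2r//; lra.
  apply: (@le_trans _ _ (- (a / k) * (ln (c * k) + ln (1 - q)))).
    by rewrite !mulNr lerN2 ler_wpM2l// divr_ge0 ?(ltW k0) ?(ltW alpha0).
  rewrite mulrDr lerD2l !mulNr lerN2 ler_wnM2r// ler_wpM2r ?invr_ge0 ?(ltW k0)//.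
  by rewrite (le_trans (ler_norm _))// Re_le_cmod.
rewrite /ker_transform -binomial_series -/(w (c + h))//.
rewrite /csum -cintZ//; last exact: nbin_summable.
apply: eq_cint => n _; rewrite /F /C -/g /w.
rewrite (_ : - rho n = - (alpha / k%:C) * n%:R + - (nu / k%:C)); last by rewrite /rho; ring.
rewrite !rpowD -!rpowX !rpowMl// !exprMn; ring.
Qed.

End TransformExpansion.

(** * Analytic continuation of a factorisation *)

Section Continuation.
Context {R : realType}.
Implicit Types (c h r s t x : R) (g f : R -> R[i]).

Local Notation mu := (@lebesgue_measure R).
Local Notation nonneg := (`[0%R, +oo[%classic : set R).

(** The zero set contains a maximal half-line ]T, +oo[; an expansion at T would
    extend it to the left if T were larger than s0. *)
Lemma psexp_continuation (D : R -> R[i]) s0 s1 :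
  (forall c, s0 < c -> exists r a M, 0 < r /\ psexp (fun h => D (c + h)) a r M) ->
  (forall s, s1 <= s -> D s = 0) -> forall s, s0 < s -> D s = 0.
Proof.
move=> anD D1.
pose S := [set T | s0 < T /\ forall s, T <= s -> D s = 0].
have lbS : lbound S s0 by move=> T [/ltW].
have S1 : S (Num.max s1 (s0 + 1)).
  split; first by rewrite lt_max ltrDl ltr01 orbT.
  by move=> s; rewrite ge_max => /andP[s1s _]; exact: D1.
have hS : has_inf S by split; [exists (Num.max s1 (s0 + 1))|exists s0].
have D_above s : inf S < s -> D s = 0.
  rewrite -subr_gt0 => Ss; have [T [_ TD]] := inf_adherent Ss hS.
  by rewrite addrC subrK => /ltW; exact: TD.
suff infS : inf S <= s0.
  by move=> s s0s; apply: D_above; exact: le_lt_trans s0s.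
rewrite leNgt; apply/negP => s0S.
have [r [a [M [r0 H]]]] := anD _ s0S.
have D0 : forall h, `|h| < r -> D (inf S + h) = 0.
  by apply: psexp_eq0 r0 H _ => h /andP[h0 _]; apply: D_above; rewrite ltrDl.
pose e := Num.min r (inf S - s0) / 2.
have m0 : 0 < Num.min r (inf S - s0) by rewrite lt_min r0 subr_gt0.
have mr : Num.min r (inf S - s0) <= r by rewrite ge_min lexx.
have ms : Num.min r (inf S - s0) <= inf S - s0 by rewrite ge_min lexx orbT.
have e0 : 0 < e by rewrite divr_gt0.
have er : e < r by rewrite /e; lra.
have es : s0 < inf S - e by rewrite /e; lra.
have Se : S (inf S - e).
  split => // s es1; have [sS|Ss] := leP s (inf S); last exact: D_above.
  have -> : s = inf S + (s - inf S) by ring.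
  by apply: D0; rewrite ler0_norm ?subr_le0//; lra.
have := ge_inf hS.2 Se; lra.
Qed.

Lemma psexp_cvg_right (D : R -> R[i]) c a r M : 0 < r ->
  psexp (fun h => D (c + h)) a r M ->
  ccvg (fun n => D (c + n.+1%:R^-1)) (D c).
Proof.
move=> r0 H; have M0 := psexp_ge0 r0 H.
have H1 h : `|h| <= r -> cmod (D (c + h) - a 0%N) <= M / r * `|h|.
  by move=> hr; have := H 1%N h hr; rewrite big_ord1 expr0 mulr1 expr1 mulrAC mulrA.
have a0 : a 0%N = D c.
  have := H1 0; rewrite normr0 addr0 mulr0 => /(_ (ltW r0)) D0.
  by apply/esym/eqP; rewrite -subr_eq0 -cmod_eq0 eq_le D0 cmod_ge0.
apply: ccvg_cmod; rewrite -a0.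
have lim : (fun n => M / r * n.+1%:R^-1) @ \oo --> (0 : R).
  by rewrite -[X in _ --> X](mulr0 (M / r)); apply: cvgMr; exact: cvg_harmonic.
apply: (squeeze_cvgr _ (cvg_cst 0) lim); near=> n.
rewrite cmod_ge0/=; have hn : `|(n.+1%:R^-1 : R)| <= r; last first.
  by apply: le_trans (H1 _ hn) _; rewrite ger0_norm// invr_ge0.
by near: n; exact: (cvgr0_norm_le _ (@cvg_harmonic R)).
Unshelve. all: end_near.
Qed.

Lemma lap_cvg_right g s0 : cintble mu nonneg (fun t => (expR (- (s0 * t)))%:C * g t) ->
  cmeas nonneg g ->
  ccvg (fun n => lap nonneg g (s0 + n.+1%:R^-1)) (lap nonneg g s0).
Proof.
move=> ig mg; apply: (@cint_dominated _ _ _ mu nonneg _ _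
  (fun t => cmod ((expR (- (s0 * t)))%:C * g t))).
- by [].
- by move=> n; exact: cmeas_lap.
- exact: cmeas_lap.
- move=> t _; apply: ccvgM; last exact: ccvg_cst.
  have H := psexpZ (expR (- (s0 * t)))%:C (psexp_expR (- t) ltr01).
  apply: (psexp_cvg_right (D := fun s => (expR (- (s * t)))%:C) ltr01).
  apply: eq_psexp H => h _; rewrite -rmorphM -expRD; congr ((expR _)%:C); ring.
- exact: integrable_cmod ig.
- move=> n t; rewrite /= in_itv/= andbT => t0.
  rewrite !cmodM !cmodr !ger0_norm ?expR_ge0// ler_wpM2r ?cmod_ge0// ler_expR.
  by rewrite lerN2 ler_wpM2r// lerDl invr_ge0.
Qed.

Lemma lap_integrable g s0 s : s0 <= s ->
  cintble mu nonneg (fun t => (expR (- (s0 * t)))%:C * g t) -> cmeas nonneg g ->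
  cintble mu nonneg (fun t => (expR (- (s * t)))%:C * g t).
Proof.
move=> s0s ig mg; apply: (@cintble_le _ _ _ mu nonneg _
  (fun t => cmod ((expR (- (s0 * t)))%:C * g t))) => //.
- exact: cmeas_lap.
- exact: integrable_cmod ig.
move=> t; rewrite /= in_itv/= andbT => t0.
rewrite !cmodM !cmodr !ger0_norm ?expR_ge0// ler_wpM2r ?cmod_ge0// ler_expR.
by rewrite lerN2 ler_wpM2r.
Qed.

(** The difference of the two sides vanishes to the right of s0 by continuation,
    and at s0 since the transforms and H are continuous there from the right. *)
Lemma lap_factor_extend f g (H : R -> R[i]) s0 s1 :
  cmeas nonneg f -> cmeas nonneg g ->
  cintble mu nonneg (fun t => (expR (- (s0 * t)))%:C * f t) ->
  cintble mu nonneg (fun t => (expR (- (s0 * t)))%:C * g t) ->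
  (forall c, s0 <= c -> exists r a M, 0 < r /\ psexp (fun h => H (c + h)) a r M) ->
  (forall s, s0 <= s -> s1 <= s -> lap nonneg g s = H s * lap nonneg f s) ->
  lap nonneg g s0 = H s0 * lap nonneg f s0.
Proof.
move=> mf mg if0 ig anH eq1.
pose D s := lap nonneg g s - H s * lap nonneg f s.
have lapE e c : cmeas nonneg e ->
    cintble mu nonneg (fun t => (expR (- (s0 * t)))%:C * e t) -> s0 < c ->
    exists a M, psexp (fun h => lap nonneg e (c + h)) a (c - s0) M.
  move=> me ie s0c; eexists; eexists; apply: psexp_lap => //.
  - by move=> t; rewrite /= in_itv/= andbT.
  - by rewrite subr_gt0.
  rewrite subKr; have := integrable_cmod _ ie => /(_ (measurable_itv _)).
  apply: eq_integrable => // t _.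
  by rewrite cmodM cmodr ger0_norm ?expR_ge0.
have D0 : forall s, s0 < s -> D s = 0.
  apply: (@psexp_continuation _ _ (Num.max s0 s1)) => [c s0c|s]; last first.
    by rewrite ge_max => /andP[s0s s1s]; rewrite /D eq1// subrr.
  have [af [Mf Hf]] := lapE f c mf if0 s0c.
  have [ag [Mg Hg]] := lapE g c mg ig s0c.
  have [r [aH [MH [r0 HH]]]] := anH c (ltW s0c).
  have cs : 0 < c - s0 by rewrite subr_gt0.
  pose r' := Num.min r (c - s0).
  have r'0 : 0 < r' by rewrite lt_min r0.
  have r'r : 0 < r' <= r by rewrite r'0 ge_min lexx.
  have r'c : 0 < r' <= c - s0 by rewrite r'0 ge_min lexx orbT.
  have r'2 : 0 < r' / 2 <= c - s0.
    by move: r'c => /andP[_ h2]; apply/andP; split; lra.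
  do 3 eexists; split; last first.
    apply: psexpB (psexp_shrink r'2 Hg) (psexpM r'0 (psexp_shrink r'r HH) (psexp_shrink r'c Hf)).
  by move: r'2 => /andP[].
have [r [a [M [r0 HH]]]] := anH s0 (lexx _).
have c1 := lap_cvg_right ig mg.
have c2 := ccvgM (psexp_cvg_right r0 HH) (lap_cvg_right if0 mf).
apply: ccvg_unique c1 _; move: c2; congr (ccvg _ _); apply/funext => n.
apply/esym/eqP; rewrite -subr_eq0; apply/eqP; apply: D0.
by rewrite ltrDl invr_gt0.
Qed.

End Continuation.

(** * The Sumudu transform of the k-Prabhakar integral *)

(** A scaling rule that covers divergent integrals: the convolution integrand is
    integrable for almost all x only, while lap_kPrabhakar argues for each x. *)
Lemma Rintegral_scale d (T : measurableType d) (R : realType)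
    (mu : {measure set T -> \bar R}) (D : set T) (c : R) (f : T -> R) :
  measurable D -> 0 < c -> measurable_fun D f ->
  \int[mu]_(x in D) (c * f x) = c * \int[mu]_(x in D) f x.
Proof.
move=> mD c0 mf; have mF : measurable_fun D (EFin \o f) by exact/measurable_EFinP.
rewrite /Rintegral; under eq_integral do rewrite EFinM.
rewrite integralE (ge0_funeposM (EFin \o f) (ltW c0)) (ge0_funenegM (EFin \o f) (ltW c0)).
rewrite !ge0_integralZl ?lee_fin ?(ltW c0)//; try exact: measurable_funepos;
  try exact: measurable_funeneg.
rewrite [in RHS]integralE -/(EFin \o f).
set A := (\int[mu]_(x in D) _ x)%E; set B := (\int[mu]_(x in D) (_ ^\- x))%E.
have : (0 <= A)%E by apply: integral_ge0.
have : (0 <= B)%E by apply: integral_ge0.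
case: A B => [x| |] [y| |] // _ _.
- by rewrite /= mulrBr.
- by rewrite mulry gtr0_sg// mul1e/= mulr0.
- by rewrite mulry gtr0_sg// mul1e/= mulr0.
- by rewrite mulry gtr0_sg// mul1e/= mulr0.
Qed.

Lemma cint_scale d (T : measurableType d) (R : realType)
    (mu : {measure set T -> \bar R}) (D : set T) (c : R) (f : T -> R[i]) :
  measurable D -> 0 < c -> cmeas D f ->
  cint mu D (fun x => c%:C * f x) = c%:C * cint mu D f.
Proof.
move=> mD c0 [m1 m2]; apply: complexP; rewrite mulrC ?cReMr ?cImMr /cint/=.
- under eq_Rintegral do rewrite mulrC cReMr mulrC.
  by rewrite Rintegral_scale// mulrC.
- under eq_Rintegral do rewrite mulrC cImMr mulrC.
  by rewrite Rintegral_scale// mulrC.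
Qed.

Section Assembly.
Context {R : realType}.
Implicit Types (f : R -> R[i]) (s x : R).

Local Notation mu := (@lebesgue_measure R).
Local Notation nonneg := (`[0%R, +oo[%classic : set R).

Lemma cint_closed_right (a b : R) f : cmeas `[a, b[ f ->
  cint mu `[a, b] f = cint mu `[a, b[ f.
Proof.
move=> [m1 m2]; rewrite /cint /Rintegral.
by rewrite !(integral_itv_bndo_bndc (a := BLeft a))//; exact/measurable_EFinP.
Qed.

(** The integrands agree for each x, once f and the kernel are extended by zero
    to the negative half-line; the end point t = x is a null set. *)
Lemma lap_kPrabhakar k alpha nu omega gamma f s : 0 < k ->
  0 < complex.Re alpha -> 0 < complex.Re nu -> cmeas nonneg f ->
  cintble mu nonneg (fun t => (expR (- (s * t)))%:C * f t) ->
  cintble mu setT (fun x => (expR (- (s * x)))%:C * prabhakar_ker k alpha nu omega gamma x) ->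
  lap nonneg (kPrabhakar k alpha nu omega gamma f) s =
  cint mu setT (fun x => (expR (- (s * x)))%:C * prabhakar_ker k alpha nu omega gamma x) *
  lap nonneg f s.
Proof.
move=> k0 alpha0 nu0 mf if_ ik.
set K := prabhakar_ker k alpha nu omega gamma in ik *.
set g1 := (fun x => (expR (- (s * x)))%:C * K x).
pose g2 t := if t \in nonneg then (expR (- (s * t)))%:C * f t else 0.
have mnn : measurable (nonneg : set (measurableTypeR R)) := measurable_itv _.
have ig2 : cintble mu setT g2 := proj1 (cintble_mkcond mu _ mnn) if_.
have -> : lap nonneg f s = cint mu setT g2 by exact: cint_mkcond.
rewrite -(convolution ik ig2) /lap cint_mkcond; apply: eq_cint => x _.
have mK : cmeas (setT : set (measurableTypeR R)) K.
  have -> : K = (fun x => (expR (s * x))%:C * g1 x).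
    by apply/funext => y; rewrite /g1 mulrA -rmorphM -expRD addrN expR0 mul1r.
  apply: cmeasM; last exact: (cintble_meas ik).
  have H : cmeas setT (fun y : R => (expR (s * y))%:C).
    by apply: cmeas_real; apply: measurableT_comp => //; exact: measurable_funM.
  exact: H.
case: ifPn; rewrite mem_setE in_itv/= andbT => x0; last first.
  rewrite (_ : (fun _ => _) = (fun=> 0)) ?cint0//; apply/funext => t.
  rewrite /g1 /g2 mem_setE in_itv/= andbT; case: ifPn => t0; last by rewrite mulr0.
  by rewrite /K /prabhakar_ker ifN ?mulr0 ?mul0r// -leNgt subr_le0 (le_trans _ t0)// ltW// ltNge.
pose G t := K (x - t) * f t.
have sub : `[0, x[ `<=` nonneg.
  by move=> t; rewrite /= !in_itv/= andbT => /andP[].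
have mG : cmeas (`[0, x[ : set (measurableTypeR R)) G.
  apply: cmeasM; last exact: cmeasS mnn sub mf.
  apply: (cmeasS measurableT (@subsetT _ _)).
  apply: (cmeas_comp (phi := fun t : measurableTypeR R => x - t : measurableTypeR R)) => //.
  by apply: measurable_funB; [exact: measurable_cst|exact: measurable_id].
have -> : kPrabhakar k alpha nu omega gamma f x = cint mu `[0, x[ G.
  pose G' t := cpow (x - t)%:C (nu / k%:C - 1) / k%:C *
    kMittagLeffler k alpha nu gamma (omega * cpow (x - t)%:C (alpha / k%:C)) * f t.
  have GE : {in (`[0, x[%classic : set R), G' =1 G}.
    move=> t; rewrite mem_setE in_itv/= => /andP[_ tx].
    by rewrite /G' prabhakar_kerE// subr_gt0.
  transitivity (cint mu `[0, x[ G'); last exact: eq_cint.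
  apply: cint_closed_right.
  by case: mG => G1 G2; split; [apply: eq_measurable_fun G1|apply: eq_measurable_fun G2];
    move=> t tx; rewrite -(GE t tx).
rewrite -cint_scale ?expR_gt0// cint_mkcond; apply: eq_cint => t _.
rewrite /g1 /g2 /G !mem_setE !in_itv/= andbT.
have [t0|//] := leP 0 t; last by rewrite mulr0.
have [tx|xt] := ltP t x; last first.
  by rewrite /K /prabhakar_ker ifN ?mulr0 ?mul0r// -leNgt subr_le0.
rewrite (_ : - (s * x) = - (s * (x - t)) + - (s * t)); last by ring.
rewrite expRD rmorphM/=; ring.
Qed.

Lemma sumudu_lap g u : 0 < u -> sumudu_exists g u ->
  [/\ cmeas nonneg g, cintble mu nonneg (fun t => (expR (- (u^-1 * t)))%:C * g t) &
      sumudu g u = u^-1%:C * lap nonneg g u^-1].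
Proof.
move=> u0 ig; pose h t := (expR (- (u^-1 * t)))%:C * g t.
have ih : cintble mu nonneg h.
  have := cintbleZ u%:C _ ig; move=> /(_ (measurable_itv _)).
  apply: eq_cintble => //.
  move=> t _; rewrite /sumudu_integrand /h mulrA -rmorphM mulrA divff ?gt_eqF// mul1r.
  by rewrite (mulrC t).
split => //.
  have -> : g = fun t => (expR (u^-1 * t))%:C * h t.
    by apply/funext => t; rewrite /h mulrA -rmorphM -expRD addrN expR0 mul1r.
  apply: cmeasM; last exact: cintble_meas ih.
  by apply: cmeas_real; apply: measurable_funTS; apply: measurableT_comp => //; exact: measurable_funM.
rewrite /lap -cintZ//; apply: eq_cint => t _.
by rewrite /sumudu_integrand rmorphM mulrA (mulrC t).
Qed.

End Assembly.

Theorem lemma3p5 (R : realType) (k : R) (alpha mu omega gamma : R[i])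
    (f : R -> R[i]) (u : R) :
  0 < k ->
  0 < complex.Re alpha ->
  0 < complex.Re mu ->
  0 < u ->
  sumudu_exists f u ->
  sumudu_exists (kPrabhakar k alpha mu omega gamma f) u ->
  `|omega * k%:C * cpow (u / k)%:C (alpha / k%:C)| < 1 ->
  sumudu (kPrabhakar k alpha mu omega gamma f) u =
    cpow (u / k)%:C (mu / k%:C)
    * cpow (1 - omega * k%:C * cpow (u / k)%:C (alpha / k%:C))
        (- (gamma / k%:C))
    * sumudu f u.
Proof.
move=> k0 alpha0 nu0 u0 Sf SPf.
have ik : u^-1 * k = (u / k)^-1 by rewrite invf_div mulrC.
have uk : 0 < u / k by rewrite divr_gt0.
have cpowE z : cpow (u / k)%:C z = rpow (u^-1 * k) (- z).
  by rewrite cpow_pos// ik rpowVl// rpowN invrK.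
rewrite !cpowE normr_cmod ltcR => w1.
have [mf if_ ->] := sumudu_lap u0 Sf.
have [mPf iPf ->] := sumudu_lap u0 SPf.
have s0 : 0 < u^-1 by rewrite invr_gt0.
have [s1 s1_gt0 Hker] := lap_prabhakar_ker omega gamma k0 alpha0 nu0.
rewrite (@lap_factor_extend _ f _ (ker_transform k alpha mu omega gamma) _ s1)//.
- by rewrite /ker_transform mulrCA.
- move=> c uc; apply: psexp_ker_transform => //; first exact: lt_le_trans uc.
  by apply: le_lt_trans w1; exact: cmod_w_antitone.
- move=> s us s1s; have [i1 <-] := Hker s s1s.
  exact: lap_kPrabhakar (lap_integrable us if_ mf) i1.
Qed.
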